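(* Let $k>0$. A $\Gamma_d(\alpha,\beta)$ distribution $\mu$ on $\mathbb{R}^d$ (with respect to a norm $\|\cdot\|$) has a finite moment of order $k$, i.e. $\int_{\mathbb{R}^d}\|x\|^k\mu(\mathrm{d}x)<\infty$, if and only if $$\int_{\mathbf{S}_{\mathbb{R}^d,\|\cdot\|}}\beta(v)^{-k}\alpha(\mathrm{d}v)<\infty.$$ Moreover, the mean vector $m$ and the covariance matrix $\Sigma$ of $\mu$ (when the first, respectively second, moment is finite) are given by $$m=\int_{\mathbf{S}_{\mathbb{R}^d,\|\cdot\|}}\beta(v)^{-1}v\,\alpha(\mathrm{d}v),\qquad \Sigma=\int_{\mathbf{S}_{\mathbb{R}^d,\|\cdot\|}}\beta(v)^{-2}vv^\top\alpha(\mathrm{d}v).$$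
   Context: $\mathbb{R}_+=[0,\infty)$ and $\mathbf{S}_{\mathbb{R}^d,\|\cdot\|}=\{v\in\mathbb{R}^d:\|v\|=1\}$. For a finite Borel measure $\alpha$ on $\mathbf{S}_{\mathbb{R}^d,\|\cdot\|}$ and a Borel function $\beta:\mathbf{S}_{\mathbb{R}^d,\|\cdot\|}\to\mathbb{R}_+$, an infinitely divisible probability measure $\mu$ on $\mathbb{R}^d$ is called a $d$-dimensional Gamma distribution $\Gamma_d(\alpha,\beta)$ if its characteristic function is $$\hat\mu(z)=\int e^{iz^\top x}\mu(\mathrm{d}x)=\exp\left(\int_{\mathbf{S}_{\mathbb{R}^d,\|\cdot\|}}\int_{\mathbb{R}_+}\left(e^{irv^\top z}-1\right)\frac{e^{-\beta(v)r}}{r}\,\mathrm{d}r\,\alpha(\mathrm{d}v)\right),\quad z\in\mathbb{R}^d.$$ *)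

(* Defs.v *)
From HB Require Import structures.
From mathcomp Require Import all_boot all_order all_algebra.
From mathcomp Require Import complex.
From mathcomp Require Import all_classical all_reals all_analysis.

Set Implicit Arguments.
Unset Strict Implicit.
Unset Printing Implicit Defensive.

Import Order.TTheory GRing.Theory Num.Theory.
Import numFieldNormedType.Exports.

Local Open Scope classical_set_scope.
Local Open Scope ring_scope.

(* The column space of dimension d with the Borel sigma-algebra of its usual
   topology (all norms induce the same one). *)
Notation borelRd R d := (g_sigma_algebraType (@open 'cV[R]_d)).

Section norm.
Variables (R : realType) (d : nat).

Record is_norm (N : 'cV[R]_d -> R) : Prop := {
  is_norm_triangle : forall x y, N (x + y) <= N x + N y;
  is_norm_homog : forall (a : R) x, N (a *: x) = `|a| * N x;
  is_norm_eq0 : forall x, N x = 0 -> x = 0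
}.

Definition unit_sphere (N : 'cV[R]_d -> R) : set (borelRd R d) :=
  [set v | N v = 1].

Definition dotv (v z : 'cV[R]_d) : R := (v^T *m z) ord0 ord0.

End norm.

Section complex_integral.
Variable R : realType.
Local Open Scope complex_scope.

Definition cexp (w : R[i]) : R[i] :=
  (expR (complex.Re w) * cos (complex.Im w)) +i* (expR (complex.Re w) * sin (complex.Im w)).

(* Meaningful only when f is absolutely integrable on D. *)
Definition cintegral (disp : measure_display) (T : measurableType disp)
    (mu : {measure set T -> \bar R}) (D : set T) (f : T -> R[i]) : R[i] :=
  (\int[mu]_(x in D) complex.Re (f x)) +i* (\int[mu]_(x in D) complex.Im (f x)).

End complex_integral.

Definition mxintegral (R : realType) (disp : measure_display)
    (T : measurableType disp) (mu : {measure set T -> \bar R}) (D : set T)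
    (m n : nat) (f : T -> 'M[R]_(m, n)) : 'M[R]_(m, n) :=
  \matrix_(i, j) \int[mu]_(x in D) f x i j.

Section distributions.
Variables (R : realType) (d : nat).
Implicit Types mu nu : probability (borelRd R d) R.

Definition charfun mu (z : 'cV[R]_d) : R[i] :=
  cintegral mu setT (fun x => cexp ('i * (dotv z x)%:C)%C).

(* n-fold convolution power: (nu * rho)(A) is the integral of rho(A - x)
   against nu(dx). *)
Fixpoint convolution_power nu (n : nat) (A : set (borelRd R d)) : \bar R :=
  if n is n'.+1 then
    (\int[nu]_x convolution_power nu n'
       [set y : 'cV[R]_d | A ((x : 'cV[R]_d) + y)%R])%E
  else dirac (T := borelRd R d) (0 : 'cV[R]_d) A.

Definition infinitely_divisible mu : Prop :=
  forall n : nat, (0 < n)%N ->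
    exists nu, forall A, measurable A -> mu A = convolution_power nu n A.

(* int ||x||^k mu(dx) *)
Definition moment (N : 'cV[R]_d -> R) mu (k : R) : \bar R :=
  (\int[mu]_x ((N x) `^ k)%:E)%E.

Definition mean_vector mu : 'cV[R]_d :=
  \col_i fine 'E_mu[fun x : 'cV[R]_d => x i ord0].

Definition covariance_matrix mu : 'M[R]_d :=
  \matrix_(i, j) fine (covariance mu (fun x : 'cV[R]_d => x i ord0)
                                     (fun x : 'cV[R]_d => x j ord0)).

(* (e^{i r v^T z} - 1) e^{-beta(v) r} / r; the value at r = 0 is irrelevant. *)
Definition gamma_integrand (beta : 'cV[R]_d -> R) (z v : 'cV[R]_d) (r : R)
    : R[i] :=
  ((cexp ('i * (r * dotv v z)%:C) - 1) * (expR (- beta v * r) / r)%:C)%C.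

(* Since integrals are total functions here, the existence of the double
   integral in the exponent is a separate clause (absolute convergence).  It
   forces beta > 0 alpha-almost everywhere on the sphere. *)
Record is_gamma (N : 'cV[R]_d -> R)
    (alpha : {finite_measure set (borelRd R d) -> \bar R})
    (beta : 'cV[R]_d -> R) mu : Prop := {
  is_gamma_infdiv : infinitely_divisible mu;
  is_gamma_cvg : forall z : 'cV[R]_d,
    (\int[alpha]_(v in unit_sphere N) \int[lebesgue_measure]_(r in `[0%R, +oo[)
       (Normc.normc (gamma_integrand beta z v r))%:E < +oo)%E;
  is_gamma_charfun : forall z : 'cV[R]_d,
    charfun mu z = cexp (cintegral alpha (unit_sphere N) (fun v =>
      cintegral lebesgue_measure `[0, +oo[ (gamma_integrand beta z v)))
}.

End distributions.

(* Main.v *)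
(* A marginal X = x.z of mu satisfies
     E exp (i t X) = exp (- a(t) + i theta(t)),
     a(t) = int h (1 - cos (t J)) dm,  theta(t) = int h sin (t J) dm,
   with jumps J = r v.z and h dm = exp (- beta(v) r) / r dr alpha(dv).
   Moments of X and J of order k are read off the dyadic sums
   W(u) = sum_n 2^(k n) q (u / 2^n), with q a power of 1 - cos: these are at most
   C |u|^k and, for |u| >= 1, eventually at least c |u|^k.  For small k the
   comparison of E W(X) with int h W(J) dm comes directly from the formula for the
   characteristic function.  For k >= 1 it comes from the size-bias identity
     E q(X) = E int h J q(X + J) / (X + J) dm,
   which lowers the order of the moment by one.  Integrating out r turns
   int h |J|^k dm into int |v.z|^k beta(v)^(-k) alpha(dv), and coordinate
   directions z recover the norm.  The mean and the second moment are derivatives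
   at 0 of the same identities; the covariance follows by polarisation in z. *)
Require Import Defs.
From HB Require Import structures.
From mathcomp Require Import all_boot all_order all_algebra.
From mathcomp Require Import all_classical all_reals all_analysis.
From mathcomp Require Import measurable_realfun.
From mathcomp Require Import ring lra.

Import Order.TTheory GRing.Theory Num.Theory.
Import numFieldNormedType.Exports.

Local Open Scope classical_set_scope.
Local Open Scope ring_scope.

(** * Dyadic sums *)

Section elementary.
Context {R : realType}.
Implicit Types x y k : R.

(** No moment may be assumed finite while it is being estimated. All comparisons are therefore made
    on the partial sums over [n < M], with bounds independent of [M], and monotone convergence is
    applied last. Two orders at 0 limit the direct comparison: [sin u] is of order 1, so bounding
    [X] by the jumps needs [k < 1]; [1 - cos u] is of order 2, so bounding the jumps by [X] needs
    [k < 2]. Higher [k] requires powers of [1 - cos], which are again combinations of functions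
    [1 - cos (t u)]; an identity for the latter extends by linearity. The size-bias identity
    presupposes that [h |J|] is integrable. When only moments of [X] are given, this is the direct
    comparison at [k = 1], which lies within its range. Jump moments come out only on [|J| >= K].
    This costs nothing: if [|v.z| / beta(v) >= K], jumps of that size are kept and carry a fixed
    share of the integral; otherwise [(|v.z| / beta(v))^k <= K^k], and [alpha] is finite. *)

Lemma norm_sin_le x : `|sin x| <= `|x|.
Proof.
wlog x0 : x / 0 <= x => [H|].
  have [/H//|x0] := leP 0 x.
  by rewrite -normrN -sinN -[leRHS]normrN H// oppr_ge0 ltW.
have [|c _] := @MVT_segment R sin cos 0 x x0 (fun y _ => is_derive_sin y).

  exact/continuous_subspaceT/continuous_sin.
rewrite sin0 !subr0 => ->.
by rewrite normrM ler_piMl// cos_max.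
Qed.

Lemma onem_cos_ge0 x : 0 <= 1 - cos x.
Proof. by rewrite subr_ge0 cos_le1. Qed.

Lemma onem_cos_le2 x : 1 - cos x <= 2.
Proof. have := cos_geN1 x; lra. Qed.

Lemma onem_cosE x : 1 - cos x = 2 * sin (x / 2) ^+ 2.
Proof.
rewrite -{1}(_ : x / 2 *+ 2 = x); last by rewrite -mulr_natr divfK.
by rewrite cos_mulr2n cos2sin2 -mulr_natr; ring.
Qed.

Lemma onem_cos_le_norm x : 1 - cos x <= `|x|.
Proof.
rewrite onem_cosE -real_normK ?num_real// expr2 mulrA.
apply: (@le_trans _ _ (2 * `|sin (x / 2)|)).
  by rewrite ler_piMr ?sin_max// mulr_ge0.
have := norm_sin_le (x / 2); rewrite normrM (ger0_norm (_ : 0 <= 2^-1))//; lra.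
Qed.

Lemma onem_cos_le_sqr x : 1 - cos x <= x ^+ 2.
Proof.
rewrite onem_cosE -real_normK ?num_real//.
have h := norm_sin_le (x / 2); rewrite normrM (ger0_norm (_ : 0 <= 2^-1))// in h.
rewrite -(real_normK (num_real x)).
have := normr_ge0 (sin (x / 2)); have := normr_ge0 x; nra.
Qed.

Lemma onem_cos_half_gt0 : 0 < 1 - cos (2^-1 : R).
Proof.
have p2 := @pi_ge2 R.
rewrite subr_gt0 -[ltRHS](@cos0 R) ltr_cos ?invr_gt0// in_itv/= ?lexx ?pi_ge0//.
by rewrite invr_ge0 ler0n/=; lra.
Qed.

Lemma onem_cos_ge_half x : 2^-1 <= `|x| <= 1 -> 1 - cos 2^-1 <= 1 - cos x.
Proof.
move=> /andP[x1 x2]; rewrite lerB// -[leLHS]cos_norm.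
have p2 := @pi_ge2 R.
have [->//|x3] := eqVneq `|x| 2^-1.
apply/ltW; rewrite ltr_cos; first by rewrite lt_neqAle eq_sym x3.
all: rewrite in_itv/=; apply/andP; split; try lra.
Qed.

Lemma powR2_gt1 k : 0 < k -> 1 < 2 `^ k.
Proof. by move=> k0; rewrite -[ltLHS]/((fun=> 1) k) -powR1 gt0_ltr_powR// ?nnegrE// ltr1n. Qed.

Lemma norm_half x : `|x / 2| = `|x| / 2.
Proof. by rewrite normrM (ger0_norm (_ : 0 <= 2^-1)) ?invr_ge0. Qed.

(* The dyadic analogue of the scale invariant integral of t^(-k-1) f(t y) dt. *)
Definition dyadic (f : R -> R) k M y : R :=
  \sum_(n < M) (2 `^ k) ^+ n * f (y / 2 ^+ n).

Lemma dyadicS f k M y :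
  dyadic f k M.+1 y = f y + 2 `^ k * dyadic f k M (y / 2).
Proof.
rewrite /dyadic big_ord_recl/= !expr0 divr1 mul1r; congr (_ + _).
rewrite mulr_sumr; apply: eq_bigr => i _; rewrite mulrA -exprS; congr (_ * f _).
by rewrite /bump/= add1n exprS invfM mulrA.
Qed.

Lemma dyadic_ge0 f k M y : (forall x, 0 <= f x) -> 0 <= dyadic f k M y.
Proof.
by move=> f0; apply: sumr_ge0 => i _; rewrite mulr_ge0// exprn_ge0// powR_ge0.
Qed.

Lemma dyadic_nd f k y : (forall x, 0 <= f x) ->
  {homo (dyadic f k)^~ y : m n / (m <= n)%N >-> m <= n}.
Proof.
move=> f0; apply/nondecreasing_seqP => n.
by rewrite /dyadic big_ord_recr/= lerDl mulr_ge0// exprn_ge0// powR_ge0.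
Qed.

(** The scales with [|y| / 2^n <= 1] contribute a geometric series of ratio [2^(k - e) < 1], by the
    bound of order [e]. At the earlier scales [f <= D] leaves the growing series of [2^(k n)],
    comparable with its last term, about [|y|^k]. *)
Lemma dyadic_le (f : R -> R) k (e : nat) (D : R) :
  0 < k < e%:R -> 0 <= D ->
  (forall y, f y <= D) -> (forall y, f y <= D * `|y| ^+ e) ->
  exists2 C, 0 <= C & forall M y, dyadic f k M y <= C * `|y| `^ k.
Proof.
move=> /andP[k0 ke] D0 fD fDe.
set p := 2 `^ k; have p1 : 1 < p := powR2_gt1 k k0.
set q := p / 2 ^+ e.
have q0 : 0 <= q by rewrite divr_ge0// ?exprn_ge0// ltW// (lt_trans _ p1).
have q1 : q < 1.
  rewrite ltr_pdivrMr ?exprn_gt0// mul1r /p -powR_mulrn//.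
  by rewrite /powR pnatr_eq0/= ltr_expR ltr_pM2r// ln_gt0// ltr1n.
set u := (1 - q)^-1; have u0 : 0 < u by rewrite invr_gt0 subr_gt0.
have uq : (1 - q) * u = 1 by rewrite mulfV// gt_eqF// subr_gt0.
set dl := (p - 1)^-1; have dl0 : 0 < dl by rewrite invr_gt0 subr_gt0.
have dlp : (p - 1) * dl = 1 by rewrite mulfV// gt_eqF// subr_gt0.
pose C := 1 + (1 + p) * u + dl.
have pu : 0 <= p * u by rewrite mulr_ge0 ?(ltW u0)// ltW// (lt_trans _ p1).
(* The term [- dl] closes the induction: as [dl = 1 / (p - 1)], passing from [y / 2] to [y] turns
   [- dl] into [- p dl = - dl - 1], which pays for the new summand [f y <= D]. *)
suff H M y : (`|y| <= 1 -> dyadic f k M y <= D * (`|y| ^+ e * u)) /\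
             (1 < `|y| -> dyadic f k M y <= D * (C * `|y| `^ k - dl)).
  exists (D * C) => [|M y]; first by rewrite mulr_ge0// /C; nra.
  have [y1|y1] := leP `|y| 1.
    apply: (le_trans ((H M y).1 y1)); rewrite -mulrA ler_wpM2l// mulrC.
    have [y0|y0] := eqVneq `|y| 0.
      have e0 : (0 < e)%N by rewrite -(ltr_nat R) (lt_trans k0).
      by rewrite y0 expr0n gtn_eqF//= mulr0 powR0 ?gt_eqF// mulr0.
    rewrite ler_pM// ?exprn_ge0// ?(ltW u0)//; first by rewrite /C; nra.
    rewrite -powR_mulrn// ger_powR ?y1 ?andbT ?lt_def ?y0//=.
    exact: ltW.
  apply: (le_trans ((H M y).2 y1)); rewrite -mulrA ler_wpM2l//; lra.
have half_e z : p * `|z / 2| ^+ e = q * `|z| ^+ e.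
  by rewrite norm_half expr_div_n /q; ring.
have half_k z : p * `|z / 2| `^ k = `|z| `^ k.
  rewrite norm_half powRM// ?invr_ge0// mulrCA /p -powRM ?invr_ge0//.
  by rewrite divff// powR1 mulr1.
have ge1 (z : R) : 1 < `|z| -> 1 <= `|z| `^ k.
  move=> z1; rewrite -[leLHS]/((fun=> 1) k) -powR1 ge0_ler_powR ?nnegrE//; first exact: ltW.
  exact: ltW.
elim: M y => [|M IH] y.
  rewrite /dyadic big_ord0; split=> [_|/ge1 y1].
    by rewrite mulr_ge0// mulr_ge0 ?exprn_ge0// ltW.
  by rewrite mulr_ge0// /C; nra.
rewrite dyadicS -/p; split => y1.
  have h : `|y / 2| <= 1 by rewrite norm_half; have := normr_ge0 y; lra.
  have := (IH (y / 2)).1 h; have := fDe y; have := half_e y.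
  move: (`|y / 2| ^+ e) (`|y| ^+ e) (dyadic _ _ _ _) => a b c h1 h2 h3.
  have : p * c <= p * (D * (a * u)) by rewrite ler_wpM2l// ltW// (lt_trans _ p1).
  have -> : p * (D * (a * u)) = D * (q * b) * u by rewrite -h1; ring.
  have -> : D * (b * u) = D * (b * ((1 - q) * u)) + D * (q * b) * u by ring.
  by rewrite uq mulr1; lra.
have [y2|y2] := leP `|y / 2| 1.
  have := (IH (y / 2)).1 y2; have := fD y; have := ge1 y y1.
  have a1 : `|y / 2| ^+ e <= 1 by rewrite exprn_ile1.
  have a0 : 0 <= `|y / 2| ^+ e by rewrite exprn_ge0.
  move: (`|y / 2| ^+ e) (`|y| `^ k) (dyadic _ _ _ _) a1 a0 => a b c a1 a0 b1 h2 h3.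
  apply: (@le_trans _ _ (D + p * (D * u))).
    apply: lerD => //; rewrite ler_wpM2l ?(le_trans h3)//; first by rewrite ltW// (lt_trans _ p1).
    by rewrite ler_wpM2l// ler_piMl// ltW.
  have -> : D + p * (D * u) = D * (1 + p * u) by ring.
  rewrite ler_wpM2l// /C; nra.
have := (IH (y / 2)).2 y2; have := fD y; have := half_k y.
move: (`|y / 2| `^ k) (`|y| `^ k) (dyadic _ _ _ _) => a b c h1 h2 h3.
have : p * c <= p * (D * (C * a - dl)) by rewrite ler_wpM2l// ltW// (lt_trans _ p1).
have -> : p * (D * (C * a - dl)) = D * (C * b - dl) - D * ((p - 1) * dl).
  by rewrite -h1; ring.
by rewrite dlp; lra.
Qed.

(** One term suffices: for the least [n] with [|y| <= 2^n], the point [y / 2^n] has modulus in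
    [1/2, 1] and [2^(k n) >= |y|^k]. The condition [1 <= |y|] settles [n = 0]. *)
Lemma dyadic_ge (f : R -> R) k (c : R) :
  0 < k -> 0 <= c -> (forall x, 0 <= f x) ->
  (forall x, 2^-1 <= `|x| <= 1 -> c <= f x) ->
  forall y, 1 <= `|y| -> exists M, c * `|y| `^ k <= dyadic f k M y.
Proof.
move=> k0 c0 f0 fc y y1.
have : exists n, `|y| <= 2 ^+ n.
  exists (Num.bound `|y|); apply: (le_trans (ltW (archi_boundP (normr_ge0 y)))).
  by rewrite -natrX ler_nat ltnW// ltn_expl.
move=> /ex_minnP[n yn nmin].
have y2n : 2^-1 <= `|y / 2 ^+ n| <= 1.
  have p2 m : 0 < 2 ^+ m :> R by rewrite exprn_gt0.
  rewrite normrM normfV (ger0_norm (ltW (p2 n))) ler_pdivrMr// mul1r yn andbT.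
  rewrite ler_pdivlMr//; case: n yn nmin => [|n] yn nmin; first by rewrite expr0; lra.
  rewrite exprS mulrA mulVf// mul1r leNgt; apply/negP => /ltW /nmin.
  by rewrite ltnn.
exists n.+1; rewrite /dyadic big_ord_recr/=.
apply: (@le_trans _ _ ((2 `^ k) ^+ n * f (y / 2 ^+ n))); last first.
  by rewrite lerDr; exact: (dyadic_ge0 f k n y).
rewrite mulrC ler_pM ?powR_ge0 ?fc//.
rewrite -powR_mulrn ?powR_ge0// powRAC powR_mulrn//.
by rewrite ge0_ler_powR ?nnegrE// ?(ltW k0)// exprn_ge0.
Qed.

(** From [|x + y| <= 2 max (|x|, |y|)]; the constant is crude but valid for concave and convex
    powers alike. *)
Lemma powRD_le x y k : 0 <= k ->
  `|x + y| `^ k <= 2 `^ k * (`|x| `^ k + `|y| `^ k).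
Proof.
move=> k0.
wlog xy : x y / `|x| <= `|y| => [H|].
  have [/H//|/ltW/H] := leP `|x| `|y|.
  by rewrite addrC [X in _ * X]addrC.
apply: (@le_trans _ _ (2 `^ k * `|y| `^ k)); last first.
  by rewrite ler_wpM2l ?powR_ge0// lerDr powR_ge0.
rewrite -powRM// ge0_ler_powR// ?nnegrE ?mulr_ge0//.
by rewrite (le_trans (ler_normD _ _))//; lra.
Qed.

End elementary.

(** * Measurability and integration tools *)

Section measurable_aux.
Context {d} {T : measurableType d} {R : realType}.
Implicit Types (D : set T) (f g : T -> R).

Lemma measurable_fun_cos D f : measurable_fun D f ->
  measurable_fun D (fun x => cos (f x)).
Proof. by move=> mf; apply: (measurableT_comp (continuous_measurable_fun (@continuous_cos R)) mf). Qed.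

Lemma measurable_fun_sin D f : measurable_fun D f ->
  measurable_fun D (fun x => sin (f x)).
Proof. by move=> mf; apply: (measurableT_comp (continuous_measurable_fun (@continuous_sin R)) mf). Qed.

Lemma measurable_fun_norm D f : measurable_fun D f ->
  measurable_fun D (fun x => `|f x|).
Proof. by apply: measurableT_comp. Qed.

Lemma measurable_fun_powR D f k : measurable_fun D f ->
  measurable_fun D (fun x => f x `^ k).
Proof. by move=> mf; apply: (measurableT_comp (measurable_powR k) mf). Qed.

Lemma measurable_fun_expR D f : measurable_fun D f ->
  measurable_fun D (fun x => expR (f x)).
Proof. by move=> mf; apply: measurableT_comp => //; exact: measurable_expR. Qed.

(** Inversion is discontinuous at 0, so it is written [x^-1 = x (x^2)^-1], with the second factor a
    real power of a nonnegative number; both sides are 0 at [x = 0]. *)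
Lemma measurable_fun_inv D f : measurable_fun D f ->
  measurable_fun D (fun x => (f x)^-1).
Proof.
move=> mf; rewrite (_ : (fun _ => _) = fun x => f x * (f x ^+ 2) `^ (-1)).
  by apply: measurable_funM => //; apply/measurable_fun_powR/measurable_funX.
apply/funext => x; rewrite powR_inv1 ?sqr_ge0//.
have [->|fx0] := eqVneq (f x) 0; first by rewrite invr0 mul0r.
by rewrite expr2 invfM mulVKf.
Qed.

Lemma measurable_fun_dyadic D (F : R -> R) k M f :
  measurable_fun setT F -> measurable_fun D f ->
  measurable_fun D (fun x => dyadic F k M (f x)).
Proof.
move=> mF mf; rewrite /dyadic; apply: measurable_sum => n.
apply: measurable_funM => //; apply: measurableT_comp => //.
exact: measurable_funM.
Qed.

End measurable_aux.

Ltac mfun := repeat first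
  [ assumption | exact: measurable_cst | apply: measurable_fun_powR
  | apply: measurable_fun_cos | apply: measurable_fun_sin
  | apply: measurable_fun_norm | apply: measurable_fun_expR | apply: measurable_fun_inv
  | apply: measurable_funM | apply: measurable_funB | apply: measurable_funD
  | apply: measurable_funX ].

Section integral_aux.
Context {d} {T : measurableType d} {R : realType}.
Context {mu : {measure set T -> \bar R}} {D : set T}.
Hypothesis mD : measurable D.

Local Open Scope ereal_scope.

(** Monotone convergence for the limit of [g], which dominates [f] because at each point some [g n]
    does; the index may vary with the point, and [g] need not converge to [f]. *)
Lemma integral_le_of_truncations (f : T -> \bar R) (g : nat -> T -> R) (B : \bar R) :
  measurable_fun D f -> (forall x, D x -> 0 <= f x) ->
  (forall n, measurable_fun D (g n)) -> (forall n x, (0 <= g n x)%R) ->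
  (forall x, {homo g^~ x : m n / (m <= n)%N >-> (m <= n)%R}) ->
  (forall x, D x -> exists n, f x <= (g n x)%:E) ->
  (forall n, \int[mu]_(x in D) (g n x)%:E <= B) ->
  \int[mu]_(x in D) f x <= B.
Proof.
move=> mf f0 mg g0 ndg fg gB.
have nd x : nondecreasing_seq (fun n => (g n x)%:E) by move=> a b ab; rewrite lee_fin ndg.
have mg' n : measurable_fun D (EFin \o g n) by exact/measurable_EFinP.
have g0' n x : D x -> 0 <= (g n x)%:E by rewrite lee_fin.
have limg x : (g n x)%:E @[n --> \oo] --> limn (fun n => (g n x)%:E).
  exact: ereal_nondecreasing_is_cvgn.
apply: (@le_trans _ _ (\int[mu]_(x in D) limn (fun n => (g n x)%:E))).
  apply: ge0_le_integral => //.
    by apply: emeasurable_fun_cvg => [n|x _]; [exact: mg'|exact: limg].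
  move=> x Dx; have [n fn] := fg x Dx; apply: (le_trans fn).
  apply: lime_ge; first exact: limg.
  near=> m; rewrite lee_fin; apply: ndg.
  by near: m; exists n.
rewrite monotone_convergence//.
apply: lime_le; last by apply: nearW => n; exact: gB.
apply: ereal_nondecreasing_is_cvgn => a b ab; apply: ge0_le_integral => //;
  [exact: g0'|exact: mg'|exact: mg'|by move=> x Dx; exact: nd].
Unshelve. all: by end_near. Qed.

Lemma integrable_le_norm {f g : T -> R} : measurable_fun D f ->
  mu.-integrable D (EFin \o g) -> (forall x, (`|f x| <= `|g x|)%R) ->
  mu.-integrable D (EFin \o f).
Proof.
move=> mf ig fg; apply: le_integrable ig => //; first exact/measurable_EFinP.
by move=> x _; rewrite /= lee_fin.
Qed.

Lemma integrable_ge0P {f : T -> R} : measurable_fun D f ->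
  (forall x, (0 <= f x)%R) ->
  \int[mu]_(x in D) (f x)%:E < +oo -> mu.-integrable D (EFin \o f).
Proof.
move=> mf f0 foo; apply/integrableP; split; first exact/measurable_EFinP.
by under eq_integral do rewrite /= ger0_norm//.
Qed.

Lemma EFin_Rintegral {f : T -> R} : mu.-integrable D (EFin \o f) ->
  (\int[mu]_(x in D) f x)%R%:E = \int[mu]_(x in D) (f x)%:E.
Proof. by move=> fi; rewrite fineK//; exact: integrable_fin_num. Qed.

(** Reduces the comparison of two integrated dyadic sums to one comparison per scale. Everything is
    nonnegative, so no integrability is involved. *)
Lemma integral_dyadic (w : T -> R) (F : R -> R) k M (f : T -> R) :
  measurable_fun setT F -> (forall x, (0 <= F x)%R) ->
  measurable_fun D f -> measurable_fun D w -> (forall x, (0 <= w x)%R) ->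
  \int[mu]_(x in D) (w x * dyadic F k M (f x))%:E =
  \sum_(n < M) ((2 `^ k)%R ^+ n)%:E *
     \int[mu]_(x in D) (w x * F (f x / 2 ^+ n)%R)%:E.
Proof.
move=> mF F0 mf mw w0.
have mm (n : 'I_M) : measurable_fun D (fun x => (w x * F (f x / 2 ^+ n)))%R.
  by apply: measurable_funM => //; apply: measurableT_comp => //; mfun.
transitivity (\int[mu]_(x in D) \sum_(n < M)
   ((2 `^ k)%R ^+ n)%:E * (w x * F (f x / 2 ^+ n)%R)%:E).
  apply: eq_integral => x _; rewrite /dyadic mulr_sumr -sumEFin.
  by apply: eq_bigr => n _; rewrite -EFinM mulrCA.
rewrite ge0_integral_sum//.
- apply: eq_bigr => n _; rewrite ge0_integralZl_EFin//.
  + by move=> x _; rewrite lee_fin mulr_ge0.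
  + exact/measurable_EFinP.
- by move=> n; apply: emeasurable_funM => //; exact/measurable_EFinP.
- by move=> n x _; rewrite -EFinM lee_fin !mulr_ge0// exprn_ge0// powR_ge0.
Qed.

End integral_aux.

Definition norm_ge {T : Type} {R : realType} (f : T -> R) (K : R) : set T :=
  [set x | K <= `|f x|].

Section dyadic_integral.
Context {d} {T : measurableType d} {R : realType}.
Context {mu : {measure set T -> \bar R}}.
Variables (F : R -> R) (k c : R).
Hypotheses (mF : measurable_fun setT F) (F0 : forall x, 0 <= F x).
Hypotheses (k0 : 0 < k) (c0 : 0 < c).
Hypothesis Fc : forall x, 2^-1 <= `|x| <= 1 -> c <= F x.

Lemma measurable_norm_ge K {f : T -> R} : measurable_fun setT f ->
  measurable (norm_ge f K).
Proof.
move=> mf; rewrite -[X in measurable X]setTI.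
by apply: measurable_fun_ler => //; mfun.
Qed.

(** The domain [|f| >= 1] is the one on which [dyadic_ge] bounds the sums from below. The weight is
    1 for moments of [X], the Levy density for jumps, and a truncated density in the size-bias
    argument. *)
Lemma integral_powR_le_dyadic {w f : T -> R} {B : \bar R} :
  measurable_fun setT w -> measurable_fun setT f -> (forall x, 0 <= w x) ->
  (forall M, (\int[mu]_x (w x * dyadic F k M (f x))%:E <= B)%E) ->
  (c%:E * \int[mu]_(x in norm_ge f 1) (w x * `|f x| `^ k)%:E <= B)%E.
Proof.
move=> mw mf w0 HB.
have mD := measurable_norm_ge 1 mf.
have mdy M : measurable_fun setT (fun x => w x * dyadic F k M (f x)).
  by apply: measurable_funM => //; exact: measurable_fun_dyadic.
have mTD A (g : T -> R) : measurable_fun setT g -> measurable_fun A g.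
  by move=> mg; exact: measurable_funS mg.
rewrite -ge0_integralZl_EFin//; [|
  by move=> x _; rewrite lee_fin mulr_ge0// powR_ge0 |
  by apply/measurable_EFinP/mTD; mfun | exact: ltW].
apply: (@integral_le_of_truncations _ _ _ _ _ _ _
    (fun M x => w x * dyadic F k M (f x))) => //.
- by apply/measurable_EFinP; apply: mTD; mfun.
- by move=> x _; rewrite -EFinM lee_fin !mulr_ge0 ?powR_ge0// ltW.
- by move=> n; exact: mTD.
- by move=> n x; rewrite mulr_ge0// dyadic_ge0.
- by move=> x a b ab; rewrite ler_wpM2l//; apply: dyadic_nd.
- move=> x /= x1; have [M HM] := dyadic_ge F k c k0 (ltW c0) F0 Fc _ x1.
  by exists M; rewrite -EFinM lee_fin mulrCA ler_wpM2l.
- move=> n; apply: le_trans (HB n); apply: ge0_subset_integral => //.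
    exact/measurable_EFinP.
  by move=> x _; rewrite lee_fin mulr_ge0// dyadic_ge0.
Qed.

Lemma integral_powR_lty_of_dyadic {w f : T -> R} {B : \bar R} :
  measurable_fun setT w -> measurable_fun setT f -> (forall x, 0 <= w x) ->
  (forall M, (\int[mu]_x (w x * dyadic F k M (f x))%:E <= B)%E) -> (B < +oo)%E ->
  (\int[mu]_(x in norm_ge f 1) (w x * `|f x| `^ k)%:E < +oo)%E.
Proof.
move=> mw mf w0 HB Boo.
have := le_lt_trans (integral_powR_le_dyadic mw mf w0 HB) Boo.
case: (\int[mu]_(x in _) _)%E => [r _|//|//]; first by rewrite ltry.
by rewrite mulry gtr0_sg// mul1e.
Qed.

End dyadic_integral.

(** Where [|X| < K] the integrand is at most [|K|^k], and [P] has mass 1. *)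
Lemma moment_split {d} {T : measurableType d} {R : realType} {P : probability T R}
    {X : T -> R} {k} (K : R) : measurable_fun setT X -> 0 <= k ->
  (\int[P]_(x in norm_ge X K) (`|X x| `^ k)%:E < +oo)%E ->
  (\int[P]_x (`|X x| `^ k)%:E < +oo)%E.
Proof.
move=> mX k0 Xoo.
have mD := measurable_norm_ge K mX.
have mXk A : measurable_fun A (fun x => (`|X x| `^ k)%:E).
  by apply/measurable_EFinP; apply: (@measurable_funS _ _ _ _ setT) => //; mfun.
rewrite -(setUv (norm_ge X K)) ge0_integral_setU//.
- apply: lte_add_pinfty => //.
  apply: (@le_lt_trans _ _ (\int[P]_(x in ~` norm_ge X K) (cst (`|K| `^ k)%:E x))%E).
    apply: ge0_le_integral => //; first exact: measurableC.
    move=> x /= /negP; rewrite -ltNge => XK; rewrite lee_fin.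
    by rewrite ge0_ler_powR ?nnegrE// (le_trans (ltW XK))// ler_norm.
  rewrite integral_cst; last exact: measurableC.
  rewrite lte_mul_pinfty ?lee_fin ?powR_ge0//.
  by rewrite (le_lt_trans (probability_le1 _ _))//; [exact: measurableC|rewrite ltry].
- exact: measurableC.
- by rewrite disj_set2E setICr.
Qed.

(** * Fractional moments and the Levy-Khintchine formula *)

(* A random variable X without Gaussian part, with Levy measure the image by J
   of the measure of density h with respect to m. *)
Record levy_khintchine {R : realType} {d1 d2} {T1 : measurableType d1}
    {T2 : measurableType d2} (P : probability T1 R)
    (m : {measure set T2 -> \bar R})
    (X : T1 -> R) (h J : T2 -> R) : Prop := LevyKhintchine {
  lk_measurable_X : measurable_fun setT X;
  lk_measurable_h : measurable_fun setT h;
  lk_measurable_J : measurable_fun setT J;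
  lk_h_ge0 : forall y, 0 <= h y;
  lk_integrable_cos : forall t,
    m.-integrable setT (fun y => (h y * (1 - cos (t * J y)))%:E);
  lk_integrable_sin : forall t,
    m.-integrable setT (fun y => (h y * sin (t * J y))%:E);
  lk_cos : forall t, \int[P]_x cos (t * X x) =
    expR (- \int[m]_y (h y * (1 - cos (t * J y)))) *
    cos (\int[m]_y (h y * sin (t * J y)));
  lk_sin : forall t, \int[P]_x sin (t * X x) =
    expR (- \int[m]_y (h y * (1 - cos (t * J y)))) *
    sin (\int[m]_y (h y * sin (t * J y))) }.
Arguments lk_measurable_X {R d1 d2 T1 T2 P m X h J}.
Arguments lk_measurable_h {R d1 d2 T1 T2 P m X h J}.
Arguments lk_measurable_J {R d1 d2 T1 T2 P m X h J}.
Arguments lk_h_ge0 {R d1 d2 T1 T2 P m X h J}.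
Arguments lk_integrable_cos {R d1 d2 T1 T2 P m X h J}.
Arguments lk_integrable_sin {R d1 d2 T1 T2 P m X h J}.
Arguments lk_cos {R d1 d2 T1 T2 P m X h J}.
Arguments lk_sin {R d1 d2 T1 T2 P m X h J}.

Section fractional_moments.
Context {R : realType} {d1 d2} {T1 : measurableType d1} {T2 : measurableType d2}.
Context {P : probability T1 R} {m : {measure set T2 -> \bar R}}.
Context {X : T1 -> R} {h J : T2 -> R}.
Hypothesis lkX : levy_khintchine P m X h J.

Let mX := lk_measurable_X lkX.
Let mh := lk_measurable_h lkX.
Let mJ := lk_measurable_J lkX.
Let h0 := lk_h_ge0 lkX.

Let a t := \int[m]_y (h y * (1 - cos (t * J y))).
Let th t := \int[m]_y (h y * sin (t * J y)).

Lemma integrable_bounded {f : T1 -> R} C : measurable_fun setT f ->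
  (forall x, `|f x| <= C) -> P.-integrable setT (EFin \o f).
Proof.
move=> mf fC; apply: (@integrable_le_norm _ _ _ _ _ measurableT _ (cst C)) => //.
  exact: finite_measure_integrable_cst.
by move=> x; rewrite (le_trans (fC x))// ler_norm.
Qed.

Lemma integrable_cos t : P.-integrable setT (EFin \o (fun x => cos (t * X x))).
Proof. by apply: (integrable_bounded 1) => [|x]; [mfun|exact: cos_max]. Qed.

Lemma integrable_sin t : P.-integrable setT (EFin \o (fun x => sin (t * X x))).
Proof. by apply: (integrable_bounded 1) => [|x]; [mfun|exact: sin_max]. Qed.

Lemma Rintegral_onem_cos t :
  \int[P]_x (1 - cos (t * X x)) = 1 - expR (- a t) * cos (th t).
Proof.
rewrite RintegralB//; last exact: integrable_cos.
  have -> : \int[P]__ 1 = 1 by rewrite Rintegral_cst//= probability_setT/= mulr1.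
  by rewrite (lk_cos lkX).
exact: finite_measure_integrable_cst.
Qed.

Lemma integral_onem_cos t :
  (\int[P]_x (1 - cos (t * X x))%:E = (1 - expR (- a t) * cos (th t))%:E)%E.
Proof.
rewrite -Rintegral_onem_cos EFin_Rintegral//.
by apply: (integrable_bounded 2) => [|x]; [mfun|
  rewrite ger0_norm ?onem_cos_le2// onem_cos_ge0].
Qed.

Let a_ge0 t : 0 <= a t.
Proof. by apply: Rintegral_ge0 => y _; rewrite mulr_ge0// onem_cos_ge0. Qed.

(** By [1 - exp (- a) cos th = (1 - exp (- a)) + exp (- a) (1 - cos th) <= a + |th|], with [|th|] at
    most the integral of [h |sin (t J)|]. *)
Lemma integral_onem_cos_le t :
  (\int[P]_x (1 - cos (t * X x))%:E <=
   \int[m]_y (h y * ((1 - cos (t * J y)) + `|sin (t * J y)|))%:E)%E.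
Proof.
have ic := lk_integrable_cos lkX t; have iS := lk_integrable_sin lkX t.
have is' := integrable_norm iS.
rewrite integral_onem_cos; apply: (@le_trans _ _ (a t + `|th t|)%:E).
  rewrite lee_fin; have := expR_ge1Dx (- a t); have := a_ge0 t.
  have := onem_cos_le_norm (th t); have := onem_cos_ge0 (th t).
  have : expR (- a t) <= 1 by rewrite -expR0 ler_expR oppr_le0.
  have := expR_ge0 (- a t).
  move: (expR _) (cos _) `|_| => u v w; nra.
rewrite EFinD EFin_Rintegral//.
apply: (@le_trans _ _ (\int[m]_y (h y * (1 - cos (t * J y)))%:E +
    \int[m]_y (`|h y * sin (t * J y)|)%:E)%E).
  by rewrite leeD2l// -EFin_Rintegral// lee_fin le_normr_Rintegral.
rewrite -ge0_integralD//.
- rewrite le_eqVlt; apply/orP; left; apply/eqP; apply: eq_integral => y _.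
  by rewrite -EFinD normrM (ger0_norm (h0 y)) -mulrDr.
- by move=> y _; rewrite lee_fin mulr_ge0// onem_cos_ge0.
- by apply/measurable_EFinP; mfun.
- by apply/measurable_EFinP; mfun.
Qed.

(* Here 1 - E cos (t X) <= a(t) + |theta(t)|, whose integrand in the jumps is
   O(min (1, |t J|)), of order less than |t J|^k. *)
Lemma moment_finite_lt1 k : 0 < k < 1 ->
  (\int[m]_y (h y * `|J y| `^ k)%:E < +oo)%E ->
  (\int[P]_x (`|X x| `^ k)%:E < +oo)%E.
Proof.
move=> /andP[k0 k1] Joo.
pose q (u : R) := 1 - cos u.
pose q2 (u : R) := (1 - cos u) + `|sin u|.
have q0 u : 0 <= q u := onem_cos_ge0 u.
have q20 u : 0 <= q2 u by rewrite addr_ge0// onem_cos_ge0.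
have mq : measurable_fun setT q by rewrite /q; mfun.
have mq2 : measurable_fun setT q2 by rewrite /q2; mfun.
(* The sine makes [q2] of order 1 at 0, hence [e = 1] and the restriction [k < 1]; the constant 3 is
   [2 + 1], the bound of [q2]. *)
have [||u|u|C C0 HC] := @dyadic_le R q2 k 1 3.
- by rewrite k0.
- by [].
- by rewrite /q2; have := onem_cos_le2 u; have := sin_max u; lra.
- rewrite /q2 expr1; have := onem_cos_le_norm u; have := norm_sin_le u.
  by have := normr_ge0 u; lra.
set c := 1 - cos 2^-1 : R; have c0 : 0 < c := onem_cos_half_gt0.
have dyn M : (\int[P]_x (1 * dyadic q k M (X x))%:E <=
    C%:E * \int[m]_y (h y * `|J y| `^ k)%:E)%E.
  apply: (@le_trans _ _ (\int[m]_y (h y * dyadic q2 k M (J y))%:E)%E); last first.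
    rewrite -ge0_integralZl_EFin//; last 2 first.
    - by move=> y _; rewrite lee_fin mulr_ge0// powR_ge0.
    - by apply/measurable_EFinP; mfun.
    apply: ge0_le_integral => //.
    - by move=> y _; rewrite lee_fin mulr_ge0// dyadic_ge0.
    - by apply/measurable_EFinP/measurable_funM => //; exact: measurable_fun_dyadic.
    - by apply/measurable_EFinP; mfun.
    - by move=> y _; rewrite -EFinM lee_fin mulrCA ler_wpM2l.
  rewrite !integral_dyadic//.
  apply: lee_sum => n _; rewrite lee_wpmul2l ?lee_fin ?exprn_ge0 ?powR_ge0//.
  apply: (le_trans _ (le_trans (integral_onem_cos_le (2 ^+ n)^-1) _)).
    rewrite le_eqVlt; apply/orP; left; apply/eqP; apply: eq_integral => x _.
    by rewrite mul1r mulrC.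
  rewrite le_eqVlt; apply/orP; left; apply/eqP; apply: eq_integral => y _.
  by rewrite /q2 (mulrC (J y)).
apply: (moment_split 1 mX (ltW k0)).
have := @integral_powR_lty_of_dyadic _ _ _ P q k c mq q0 k0 c0 _ (fun=> 1) X _ _ _ _ dyn.
under [in X in _ -> X]eq_integral do rewrite -[_ `^ _]mul1r.
apply => //; first exact: onem_cos_ge_half.
by rewrite lte_mul_pinfty ?lee_fin.
Qed.

(* If 1 - E cos (t X) <= 1/2 then the modulus exp (- a t) of the characteristic
   function is at least 1/2. *)
Lemma integral_weight_onem_cos_le t :
  (\int[P]_x (1 - cos (t * X x))%:E <= (2^-1)%:E)%E ->
  (\int[m]_y (h y * (1 - cos (t * J y)))%:E <=
   2%:E * \int[P]_x (1 - cos (t * X x))%:E)%E.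
Proof.
rewrite integral_onem_cos -EFin_Rintegral//; last exact: (lk_integrable_cos lkX t).
rewrite -EFinM !lee_fin -/(a t) => H.
(* With [v = exp (- a)], the hypothesis gives [v >= 1/2], so [a <= exp a - 1 = (1 - v) / v <= 2 (1 -
   v)], and [1 - v <= 1 - v cos th]. *)
have := expR_ge1Dx (a t); have := a_ge0 t.
have eN : expR (- a t) * expR (a t) = 1 by rewrite -expRD addNr expR0.
have := cos_le1 (th t); have := expR_gt0 (- a t).
move: (expR (a t)) (expR (- a t)) (cos _) (a t) eN H => u v w z eN H v0 w1 z0 uz.
nra.
Qed.

(** The weight estimate applies only at frequencies where [1 - E cos] is at most 1/2. A finite
    moment of [X] ensures this at all frequencies [2^-n] with [n >= n0]; the dyadic sum in the jumps
    starts at scale [n0], whence [K = 2^n0]. *)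
Lemma levy_moment_finite_lt2 k : 0 < k < 2 ->
  (\int[P]_x (`|X x| `^ k)%:E < +oo)%E ->
  exists2 K, 0 < K &
    (\int[m]_(y in norm_ge J K) (h y * `|J y| `^ k)%:E < +oo)%E.
Proof.
move=> /andP[k0 k2] Xoo.
pose q (u : R) := 1 - cos u.
have q0 u : 0 <= q u := onem_cos_ge0 u.
have mq : measurable_fun setT q by rewrite /q; mfun.
have [||u|u|C C0 HC] := @dyadic_le R q k 2 2.
- by rewrite k0.
- by [].
- exact: onem_cos_le2.
- rewrite /q real_normK ?num_real//; have := onem_cos_le_sqr u.
  by have := sqr_ge0 u; lra.
set c := 1 - cos 2^-1 : R; have c0 : 0 < c := onem_cos_half_gt0.
set p := 2 `^ k; have p1 : 1 < p := powR2_gt1 k k0.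
have [B B0 HB] : exists2 B : R, 0 <= B &
    forall M, (\int[P]_x (1 * dyadic q k M (X x))%:E <= B%:E)%E.
  have fX : (\int[P]_x (`|X x| `^ k)%:E)%E \is a fin_num.
    by rewrite ge0_fin_numE// integral_ge0// => x _; rewrite lee_fin powR_ge0.
  exists (C * fine (\int[P]_x (`|X x| `^ k)%:E)%E).
    by rewrite mulr_ge0// fine_ge0// integral_ge0// => x _; rewrite lee_fin powR_ge0.
  move=> M; rewrite EFinM fineK// -ge0_integralZl_EFin//; last first.
    by apply/measurable_EFinP; mfun.
  apply: ge0_le_integral => //.
  - by move=> y _; rewrite lee_fin mul1r dyadic_ge0.
  - by apply/measurable_EFinP/measurable_funM => //; exact: measurable_fun_dyadic.
  - by apply/measurable_EFinP; mfun.
  - by move=> y _; rewrite -EFinM lee_fin mul1r.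
(* A single term of the bounded dyadic sum already yields the decay
   [1 - E cos (X / 2^n) <= B / p^n]. *)
have HBn n : ((p ^+ n)%:E * \int[P]_x (1 - cos ((2 ^+ n)^-1 * X x))%:E <= B%:E)%E.
  apply: le_trans (HB n.+1); rewrite integral_dyadic// big_ord_recr/= -/p.
  rewrite -[leLHS]add0e leeD//.
    apply: sume_ge0 => i _; rewrite mule_ge0 ?lee_fin ?exprn_ge0 ?powR_ge0//.
    by apply: integral_ge0 => x _; rewrite lee_fin mul1r.
  rewrite le_eqVlt; apply/orP; left; apply/eqP; congr (_ * _)%E.
  by apply: eq_integral => x _; rewrite mul1r mulrC.
have p0 n : 0 < p ^+ n by rewrite exprn_gt0// (lt_trans _ p1).
have pn1 n : 1 <= p ^+ n by rewrite exprn_ege1// ltW.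
(* From this index on the decay brings [1 - E cos] below 1/2. Bernoulli's inequality and the
   Archimedean property provide it. *)
have [n0 Hn0] : exists n0, 2 * B <= p ^+ n0.
  have bern n : 1 + n%:R * (p - 1) <= p ^+ n.
    elim: n => [|n IH]; first by rewrite mul0r addr0 expr0.
    rewrite exprS -(ler_pM2l (lt_trans ltr01 p1)) in IH *.
    have : 0 <= n%:R * (p - 1) ^+ 2 by rewrite mulr_ge0// sqr_ge0.
    by rewrite -nat1r; move: IH; move: (p ^+ n) => u; lra.
  exists (Num.bound (2 * B / (p - 1))); apply: le_trans (bern _).
  have /archi_boundP : 0 <= 2 * B / (p - 1) by rewrite divr_ge0 ?mulr_ge0// subr_ge0 ltW.
  by rewrite ltr_pdivrMr ?subr_gt0//; lra.
have small n : (n0 <= n)%N ->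
    (\int[P]_x (1 - cos ((2 ^+ n)^-1 * X x))%:E <= (2^-1)%:E)%E.
  move=> nn0; have := HBn n; rewrite integral_onem_cos -EFinM !lee_fin => H.
  have : 2 * B <= p ^+ n by rewrite (le_trans Hn0)// ler_weXn2l// ltW.
  by move: (p0 n) H; move: (1 - _) (p ^+ n) => u v; nra.
(* Term [i] of this sum is compared with term [n0 + i] of the sum in [X]. The missing factor
   [p^n0 >= 1] is given away, as are the first [n0] terms. *)
have dyn M : (\int[m]_y (h y * dyadic q k M (J y / 2 ^+ n0))%:E <= (2 * B)%:E)%E.
  rewrite integral_dyadic//; last by mfun.
  apply: (@le_trans _ _ (2%:E * \int[P]_x (1 * dyadic q k (n0 + M) (X x))%:E)%E); last first.
    by rewrite EFinM lee_wpmul2l.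
  rewrite integral_dyadic// big_split_ord/= -/p ge0_muleDr; last 2 first.
  - apply: sume_ge0 => i _; rewrite mule_ge0 ?lee_fin ?exprn_ge0 ?powR_ge0//.
    by apply: integral_ge0 => x _; rewrite lee_fin mul1r.
  - apply: sume_ge0 => i _; rewrite mule_ge0 ?lee_fin ?exprn_ge0 ?powR_ge0//.
    by apply: integral_ge0 => x _; rewrite lee_fin mul1r.
  rewrite -[leLHS]add0e leeD//.
    apply: mule_ge0 => //.
    apply: sume_ge0 => i _; rewrite mule_ge0 ?lee_fin ?exprn_ge0 ?powR_ge0//.
    by apply: integral_ge0 => x _; rewrite lee_fin mul1r.
  rewrite ge0_sume_distrr; last first.
    move=> i _; rewrite mule_ge0 ?lee_fin ?exprn_ge0 ?powR_ge0//.
    by apply: integral_ge0 => x _; rewrite lee_fin mul1r.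
  apply: lee_sum => i _.
  have := integral_weight_onem_cos_le _ (small _ (leq_addr i n0)).
  under eq_integral do rewrite mulrC.
  move=> H; apply: (@le_trans _ _ ((p ^+ i)%:E *
      (2%:E * \int[P]_x (1 - cos ((2 ^+ (n0 + i))^-1 * X x))%:E))%E).
    rewrite lee_wpmul2l ?lee_fin ?exprn_ge0 ?powR_ge0//; apply: le_trans H.
    rewrite le_eqVlt; apply/orP; left; apply/eqP; apply: eq_integral => y _.
    by rewrite mulrC /q exprD invfM -mulrA (mulrC (J y)).
  rewrite muleCA lee_wpmul2l//.
  under [X in (_ <= _ * X)%E]eq_integral do rewrite mul1r /q mulrC.
  rewrite lee_wpmul2r ?integral_ge0//.
  by rewrite lee_fin ler_weXn2l ?leq_addl// ltW.
exists (2 ^+ n0); first exact: exprn_gt0.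
have := @integral_powR_lty_of_dyadic _ _ _ m q k c mq q0 k0 c0 _ h
  (fun y => J y / 2 ^+ n0) _ _ _ _ dyn.
have n2 : 0 < 2 ^+ n0 :> R by exact: exprn_gt0.
have -> : norm_ge (fun y => J y / 2 ^+ n0) 1 = norm_ge J (2 ^+ n0).
  apply/seteqP; split => y; rewrite /norm_ge/= normrM normfV (ger0_norm (ltW n2));
  by rewrite ler_pdivlMr// mul1r.
have mD := measurable_norm_ge (2 ^+ n0) mJ.
have -> : (\int[m]_(x in norm_ge J (2 ^+ n0)) (h x * `|J x / 2 ^+ n0| `^ k)%:E =
  (((2 ^+ n0)^-1 `^ k)%:E * \int[m]_(x in norm_ge J (2 ^+ n0)) (h x * `|J x| `^ k)%:E))%E.
  rewrite -ge0_integralZl_EFin//; last 2 first.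
  - by move=> y _; rewrite lee_fin mulr_ge0// powR_ge0.
  - by apply/measurable_EFinP; apply: (@measurable_funS _ _ _ _ setT) => //; mfun.
  apply: eq_integral => y _; rewrite -EFinM normrM powRM// normfV (ger0_norm (ltW n2)).
  by congr EFin; ring.
case: (\int[m]_(x in _) _)%E => [r _|H|//]; first by rewrite ltry.
have {}H : ((((2 ^+ n0)^-1 `^ k)%:E * +oo) < +oo :> \bar R)%E.
  apply: H => //; [exact: onem_cos_ge_half|mfun|by rewrite ltry].
by move: H; rewrite mulry gtr0_sg ?mul1e// powR_gt0// invr_gt0.
Qed.

End fractional_moments.

(** * The size-bias identity *)

Section differentiation.
Context {d} {T : measurableType d} {R : realType}.
Context {mu : {measure set T -> \bar R}}.

Lemma is_derive_integral {f df : R -> T -> R} {G : T -> R} :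
  (forall t, mu.-integrable setT (EFin \o f t)) ->
  (forall (t : R) y, is_derive t 1 (f^~ y) (df t y)) ->
  mu.-integrable setT (EFin \o G) ->
  (forall t y, `|df t y| <= G y) ->
  forall a : R, is_derive a 1 (fun t => \int[mu]_y f t y) (\int[mu]_y df a y).
Proof.
move=> fi fd Gi fG a.
have aI : `]a - 1, a + 1[%classic a by rewrite /= in_itv/=; apply/andP; split; lra.
have dfE t y : partial1of2 f t y = df t y.
  by rewrite partial1of2E; apply: derive_val.
have h1 t y : `]a - 1, a + 1[%classic t -> [set: T] y -> derivable (f^~ y) t 1.
  by move=> _ _; have [] := fd t y.
have h2 t y : `]a - 1, a + 1[%classic t -> [set: T] y -> `|partial1of2 f t y| <= G y.
  by move=> _ _; rewrite dfE.
have G0 y : 0 <= G y by rewrite (le_trans _ (fG 0 y)).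
apply: DeriveDef.
  exact: (derivable_under_integral measurableT aI (fun t _ => fi t) h1 G0 Gi h2).
rewrite -derive1E.
rewrite (differentiation_under_integral measurableT aI (fun t _ => fi t) h1 G0 Gi h2).
by apply: eq_Rintegral => y _; exact: dfE.
Qed.

End differentiation.

Section product_integral.
Context {R : realType} {d1 d2} {T1 : measurableType d1} {T2 : measurableType d2}.
Context {m1 : {sigma_finite_measure set T1 -> \bar R}}.
Context {m2 : {sigma_finite_measure set T2 -> \bar R}}.

Lemma measurable_fst_comp {f : T1 -> R} : measurable_fun setT f ->
  measurable_fun setT (fun z : T1 * T2 => f z.1).
Proof. by move=> mf; exact: (measurableT_comp mf measurable_fst). Qed.

Lemma measurable_snd_comp {g : T2 -> R} : measurable_fun setT g ->
  measurable_fun setT (fun z : T1 * T2 => g z.2).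
Proof. by move=> mg; exact: (measurableT_comp mg measurable_snd). Qed.

Lemma ge0_integral_prod (f : T1 -> R) (g : T2 -> R) :
  measurable_fun setT f -> measurable_fun setT g ->
  (forall x, 0 <= f x) -> (forall y, 0 <= g y) ->
  (\int[m1 \x m2]_z (f z.1 * g z.2)%:E =
   \int[m1]_x (f x)%:E * \int[m2]_y (g y)%:E)%E.
Proof.
move=> mf mg f0 g0.
rewrite fubini_tonelli1; last 2 first.
- apply/measurable_EFinP/measurable_funM; first exact: measurable_fst_comp.
  exact: measurable_snd_comp.
- by move=> z; rewrite lee_fin mulr_ge0.
rewrite -ge0_integralZr//; last 3 first.
- exact/measurable_EFinP.
- by move=> x _; rewrite lee_fin.
- by apply: integral_ge0 => y _; rewrite lee_fin.
apply: eq_integral => x _; rewrite /fubini_F/= -ge0_integralZl//.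
- exact/measurable_EFinP.
- by move=> y _; rewrite lee_fin.
- by rewrite lee_fin.
Qed.

Lemma integrable_prod {f : T1 -> R} {g : T2 -> R} :
  m1.-integrable setT (EFin \o f) -> m2.-integrable setT (EFin \o g) ->
  (m1 \x m2)%E.-integrable setT (EFin \o (fun z => f z.1 * g z.2)).
Proof.
move=> fi gi.
have mf : measurable_fun setT f by exact/measurable_EFinP/(measurable_int _ fi).
have mg : measurable_fun setT g by exact/measurable_EFinP/(measurable_int _ gi).
apply/integrableP; split.
  apply/measurable_EFinP/measurable_funM; first exact: measurable_fst_comp.
  exact: measurable_snd_comp.
under eq_integral do rewrite /= normrM.
rewrite (@ge0_integral_prod (fun x => `|f x|) (fun y => `|g y|))//; [|by mfun..].
move/integrableP : fi => [_ /= fi]; move/integrableP : gi => [_ /= gi].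
rewrite lte_mul_pinfty//; first by apply: integral_ge0.
by rewrite ge0_fin_numE// integral_ge0.
Qed.

Lemma Rintegral_prod {f : T1 -> R} {g : T2 -> R} :
  m1.-integrable setT (EFin \o f) -> m2.-integrable setT (EFin \o g) ->
  \int[(m1 \x m2)%E]_z (f z.1 * g z.2) = \int[m1]_x f x * \int[m2]_y g y.
Proof.
move=> fi gi; apply: EFin_inj; rewrite EFinM !EFin_Rintegral//; last exact: integrable_prod.
rewrite -integral12_prod_meas1; last exact: integrable_prod.
rewrite -[X in (_ * X)%E](EFin_Rintegral measurableT gi).
rewrite -integralZr//.
apply: eq_integral => x _; rewrite /fubini_F/=.
under eq_integral do rewrite EFinM.
by rewrite integralZl// EFin_Rintegral.
Qed.

End product_integral.

Lemma is_derive_congr {R : realType} {f g : R -> R} {x df dg : R} :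
  is_derive x 1 f df -> f =1 g -> df = dg -> is_derive x 1 g dg.
Proof. by move=> fdf /funext <- <-. Qed.

Lemma is_derive_onem_cos {R : realType} (x : R) :
  is_derive x 1 (fun x => 1 - cos x) (sin x).
Proof.
apply: (is_derive_congr (is_deriveB (is_derive_cst (1 : R) x 1) (is_derive_cos x))) => //.
by rewrite sub0r opprK.
Qed.

Lemma is_derive_dilate {R : realType} {f : R -> R} (u : R) {s df : R} :
  is_derive (s * u) 1 f df -> is_derive s 1 (fun s => f (s * u)) (u * df).
Proof.
move=> h1; have h2 : is_derive s 1 (fun s => s * u) u.
  by apply: is_derive_eq; rewrite /GRing.scale/= mulr0 add0r mulr1.
by apply: (is_derive_congr (@is_derive1_comp R f (fun s => s * u) s _ _ h1 h2)) => //; rewrite mulrC.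
Qed.

Section size_bias.
Context {R : realType} {d1 d2} {T1 : measurableType d1} {T2 : measurableType d2}.
Context {P : probability T1 R} {m : {sigma_finite_measure set T2 -> \bar R}}.
Context {X : T1 -> R} {h J : T2 -> R}.
Hypothesis lkX : levy_khintchine P m X h J.
Hypothesis iJ : m.-integrable setT (fun y => (h y * `|J y|)%:E).

Let mX := lk_measurable_X lkX.
Let mh := lk_measurable_h lkX.
Let mJ := lk_measurable_J lkX.
Let h0 := lk_h_ge0 lkX.

Let a t := \int[m]_y (h y * (1 - cos (t * J y))).
Let th t := \int[m]_y (h y * sin (t * J y)).

Let ihJ : m.-integrable setT (EFin \o (fun y => h y * J y)).
Proof.
apply: (@integrable_le_norm _ _ _ m _ _ _ _ _ iJ) => //; first by mfun.
by move=> y; rewrite !normrM normr_id.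
Qed.

(** The derivative of the integrand is dominated by [h |J|]; this is the point at which [iJ] makes
    the exponents differentiable. *)
Let derive_exponent (f df : R -> R) :
  (forall x : R, is_derive x 1 f (df x)) -> (forall x, `|df x| <= 1) ->
  measurable_fun setT df ->
  (forall t, m.-integrable setT (fun y => (h y * f (t * J y))%:E)) ->
  forall t : R, is_derive t 1 (fun t => \int[m]_y (h y * f (t * J y)))
    (\int[m]_y (h y * J y * df (t * J y))).
Proof.
move=> fd df1 mdf fi t.
apply: (@is_derive_integral _ _ _ m (fun s y => h y * f (s * J y))
  (fun s y => h y * J y * df (s * J y)) (fun y => h y * `|J y|)) => //.
  move=> s y.
  apply: (is_derive_congr (is_deriveZ (h y) (is_derive_dilate (J y) (fd (s * J y))))) => //.
  by rewrite /GRing.scale/= mulrA.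
move=> s y; rewrite !normrM (ger0_norm (h0 y)).
by rewrite ler_piMr// mulr_ge0.
Qed.

Lemma derive_levy_cos (t : R) : is_derive t 1 a (\int[m]_y (h y * J y * sin (t * J y))).
Proof.
apply: (derive_exponent (fun x => 1 - cos x)) => [x|x||s].
- exact: is_derive_onem_cos.
- exact: sin_max.
- by mfun.
- exact: (lk_integrable_cos lkX s).
Qed.

Lemma derive_levy_sin (t : R) : is_derive t 1 th (\int[m]_y (h y * J y * cos (t * J y))).
Proof.
apply: (derive_exponent sin) => [x||s].
- exact: cos_max.
- by mfun.
- exact: (lk_integrable_sin lkX s).
Qed.

(* At a zero of X + J the quotient is the junk value 0. *)
Definition biased_integral (q : R -> R) : R :=
  \int[(P \x m)%E]_z (h z.2 * J z.2 * (q (X z.1 + J z.2) / (X z.1 + J z.2))).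

Let mu1 : measurable_fun setT (fun z : T1 * T2 => X z.1 + J z.2).
Proof.
by apply: measurable_funD; [exact: measurable_fst_comp|exact: measurable_snd_comp].
Qed.

Let mhJ : measurable_fun setT (fun z : T1 * T2 => h z.2 * J z.2).
Proof. by apply: measurable_funM; exact: measurable_snd_comp. Qed.

Let iJ2 C : (P \x m)%E.-integrable setT
  (EFin \o (fun z => C * (h z.2 * `|J z.2|))).
Proof.
apply: (@integrable_prod _ _ _ _ _ P m (fun=> C) (fun y => h y * `|J y|)) => //.
exact: finite_measure_integrable_cst.
Qed.

(** The quotient [q u / u] is bounded by [C], so the integrand is at most [C h |J|], integrable on
    the product because [P] is finite. *)
Lemma integrable_biased {q : R -> R} {C} : measurable_fun setT q ->
  (forall u, `|q u| <= C * `|u|) ->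
  (P \x m)%E.-integrable setT (EFin \o
    (fun z => h z.2 * J z.2 * (q (X z.1 + J z.2) / (X z.1 + J z.2)))).
Proof.
move=> mq qC.
have C0 : 0 <= C by have := qC 1; rewrite normr1 mulr1; apply: le_trans.
apply: (@integrable_le_norm _ _ _ _ _ _ _ _ _ (iJ2 C)) => //.
  apply: measurable_funM => //; apply: measurable_funM.
    exact: (measurableT_comp mq mu1).
  exact: measurable_fun_inv.
move=> z; rewrite !normrM (ger0_norm C0) (ger0_norm (h0 _)) normr_id mulrC.
rewrite ler_wpM2r ?mulr_ge0// normfV.
have [->|u0] := eqVneq (X z.1 + J z.2) 0; first by rewrite normr0 invr0 mulr0.
by rewrite ler_pdivrMr ?normr_gt0.
Qed.

(** Differentiation in [t] produces a factor [X + J] that cancels the denominator. Where [X + J = 0]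
    the sine vanishes too, in agreement with the default value of the quotient. *)
Lemma derive_biased_onem_cos (t : R) :
  is_derive t 1 (fun t => biased_integral (fun u => 1 - cos (t * u)))
   (\int[(P \x m)%E]_z (h z.2 * J z.2 * sin (t * (X z.1 + J z.2)))).
Proof.
apply: (@is_derive_integral _ _ _ (P \x m)%E
  (fun t z => h z.2 * J z.2 * ((1 - cos (t * (X z.1 + J z.2))) / (X z.1 + J z.2)))
  (fun t z => h z.2 * J z.2 * sin (t * (X z.1 + J z.2)))
  (fun z => 1 * (h z.2 * `|J z.2|))) => //.
- move=> s; apply: (@integrable_biased (fun u => 1 - cos (s * u)) `|s|).
    by mfun.
  by move=> u; rewrite ger0_norm ?onem_cos_ge0// -normrM onem_cos_le_norm.
- move=> s z; set u := X z.1 + J z.2.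
  have h1 := is_derive_dilate u (is_derive_onem_cos (s * u)).
  apply: (is_derive_congr (is_deriveZ (h z.2 * J z.2 / u) h1)).
    by move=> x; rewrite /= /GRing.scale/=; ring.
  rewrite /GRing.scale/=.
  have [->|u0] := eqVneq u 0; first by rewrite mulr0 sin0 !mulr0.
  by rewrite mulrA divfK.
- move=> s z; rewrite !normrM (ger0_norm (h0 _)) mul1r.
  by rewrite ler_piMr ?mulr_ge0// sin_max.
Qed.

(* Both sides vanish at t = 0; by the Levy-Khintchine formula and the addition
   formula of sin they have the same derivative. *)
Lemma size_bias_onem_cos t :
  \int[P]_x (1 - cos (t * X x)) = biased_integral (fun u => 1 - cos (t * u)).
Proof.
rewrite (Rintegral_onem_cos lkX) -/(a t) -/(th t).
pose F s := biased_integral (fun u => 1 - cos (s * u)) - (1 - expR (- a s) * cos (th s)).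
have F' (s : R) : is_derive s 1 F 0.
  have ea : is_derive s 1 (fun s => expR (- a s))
      (- \int[m]_y (h y * J y * sin (s * J y)) * expR (- a s)).
    have h1 := is_derive_expR (- a s).
    apply: (is_derive_congr (@is_derive1_comp R expR (fun s => - a s) _ _ _ h1
      (is_deriveN (derive_levy_cos s)))) => //.
    by rewrite mulrN mulrC.
  have ct : is_derive s 1 (fun s => cos (th s))
      (- \int[m]_y (h y * J y * cos (s * J y)) * sin (th s)).
    apply: (is_derive_congr (@is_derive1_comp R cos th _ _ _
      (is_derive_cos (th s)) (derive_levy_sin s))) => //.
    by rewrite mulrC mulrN.
  apply: (is_derive_congr (is_deriveB (derive_biased_onem_cos s)
    (is_deriveB (is_derive_cst (1 : R) s 1) (is_deriveM ea ct)))) => //.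
  have sinE : \int[(P \x m)%E]_z (h z.2 * J z.2 * sin (s * (X z.1 + J z.2))) =
     \int[P]_x sin (s * X x) * \int[m]_y (h y * J y * cos (s * J y)) +
     \int[P]_x cos (s * X x) * \int[m]_y (h y * J y * sin (s * J y)).
    have iw (g : R -> R) : (forall x, `|g x| <= 1) -> measurable_fun setT g ->
        m.-integrable setT (EFin \o (fun y => h y * J y * g (s * J y))).
      move=> g1 mg; apply: (@integrable_le_norm _ _ _ m _ _ _ _ _ ihJ) => //.
        apply: measurable_funM; first by mfun.
        by apply: (measurableT_comp mg); mfun.
      by move=> y; rewrite normrM ler_piMr.
    have wC := iw cos (@cos_max R) (continuous_measurable_fun (@continuous_cos R)).
    have wS := iw sin (@sin_max R) (continuous_measurable_fun (@continuous_sin R)).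
    have XS := integrable_sin lkX s.
    have XC := integrable_cos lkX s.
    have iSC := integrable_prod XS wC.
    have iCS := integrable_prod XC wS.
    rewrite -(Rintegral_prod XS wC) -(Rintegral_prod XC wS).
    rewrite -RintegralD//; apply: eq_Rintegral => z _.
    by rewrite mulrDr sinD; ring.
  rewrite sinE (lk_cos lkX) (lk_sin lkX) -/(a s) -/(th s) /GRing.scale/=.
  ring.
have := @is_derive_0_is_cst _ F t 0 F'; rewrite /F.
have -> : biased_integral (fun u => 1 - cos (0 * u)) = 0.
  rewrite /biased_integral; under eq_Rintegral do rewrite mul0r cos0 subrr mul0r mulr0.
  by rewrite Rintegral_cst// mul0r.
have -> : a 0 = 0.
  rewrite /a; under eq_Rintegral do rewrite mul0r cos0 subrr mulr0.
  by rewrite Rintegral_cst// mul0r.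
have -> : th 0 = 0.
  rewrite /th; under eq_Rintegral do rewrite mul0r sin0 mulr0.
  by rewrite Rintegral_cst// mul0r.
by rewrite oppr0 expR0 cos0 mulr1 !subrr => /eqP; rewrite subr_eq0 => /eqP.
Qed.

End size_bias.
Arguments biased_integral {R d1 d2 T1 T2} P m X h J q.

(** * Moments of order at least one *)

(** Under the hypothesis [x + y] has the sign of [y] and modulus at most [3 |y| / 2]. *)
Lemma ratio_ge_twothirds {R : realType} (x y : R) :
  y != 0 -> `|x| <= `|y| / 2 -> 2 / 3 <= y / (x + y).
Proof.
have x1 := ler_norm x; have := ler_norm (- x); rewrite normrN => x2.
case: (ltrgtP y 0) => // [y0|y0] _.
  rewrite (ltr0_norm y0) => xy.
  by rewrite -[leRHS]mulrNN -invrN ler_pdivlMr; lra.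
rewrite (gtr0_norm y0) => xy.
by rewrite ler_pdivlMr; lra.
Qed.

(** * Linear combinations of the functions [1 - cos (t u)] *)

Section trigonometric_sums.
Context {R : realType}.
Implicit Types (q : R -> R) (s : seq (R * R)).

(** Even trigonometric polynomials with arbitrary real frequencies that vanish at 0, listed as pairs
    (coefficient, frequency). This is the span to which the size-bias identity extends. *)
Definition trigsum s (u : R) : R := \sum_(ct <- s) ct.1 * (1 - cos (ct.2 * u)).

Definition is_trigsum q := exists s, q =1 trigsum s.

Lemma is_trigsumD {q1} {q2} : is_trigsum q1 -> is_trigsum q2 ->
  is_trigsum (fun u => q1 u + q2 u).
Proof.
by move=> [s1 E1] [s2 E2]; exists (s1 ++ s2) => u; rewrite E1 E2 /trigsum big_cat.
Qed.

Lemma is_trigsumZ c {q} : is_trigsum q -> is_trigsum (fun u => c * q u).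
Proof.
move=> [s E]; exists [seq (c * ct.1, ct.2) | ct <- s] => u.
by rewrite E /trigsum big_map mulr_sumr; apply: eq_bigr => ct _; rewrite mulrA.
Qed.

Lemma is_trigsum_dilate c {q} : is_trigsum q -> is_trigsum (fun u => q (c * u)).
Proof.
move=> [s E]; exists [seq (ct.1, ct.2 * c) | ct <- s] => u.
by rewrite E /trigsum big_map; apply: eq_bigr => ct _; rewrite mulrA.
Qed.

Lemma is_trigsum_sum n (q : nat -> R -> R) : (forall i, is_trigsum (q i)) ->
  is_trigsum (fun u => \sum_(i < n) q i u).
Proof.
move=> qT; elim: n => [|n [s E]].
  by exists [::] => u; rewrite big_ord0 /trigsum big_nil.
have [s' E'] : is_trigsum (fun u => (\sum_(i < n) q i u) + q n u).
  by apply: is_trigsumD => //; exists s.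
by exists s' => u; rewrite big_ord_recr/= -E'.
Qed.

Lemma is_trigsum_mul t {q} : is_trigsum q ->
  is_trigsum (fun u => q u * (1 - cos (t * u))).
Proof.
move=> [s]; elim: s q => [|[c r] s IH] q E.
  by exists [::] => u; rewrite E /trigsum !big_nil mul0r.
have [s' E'] := IH _ (frefl (trigsum s)).
(* With [A = cos (r u)] and [B = cos (t u)], expand [(1 - A) (1 - B)] and write [A B] as half the
   sum of the cosines at [r + t] and [r - t]; the constants recombine as [1 = 1 + 1 - 1/2 - 1/2]. *)
exists ([:: (c, r); (c, t); (- (c / 2), r + t); (- (c / 2), r - t)] ++ s') => u.
rewrite E /trigsum big_cat/= -/(trigsum s' u) -E' !big_cons big_nil/=.
rewrite -/(trigsum s u) (mulrDl r t) (mulrBl u r t) cosD cosB.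
by field.
Qed.

Lemma is_trigsum_exp e : is_trigsum (fun u => (1 - cos u) ^+ e.+1).
Proof.
elim: e => [|e IH].
  by exists [:: (1, 1)] => u; rewrite expr1 /trigsum big_seq1/= !mul1r.
have [s E] := is_trigsum_mul 1 IH.
by exists s => u; rewrite -E mul1r exprSr.
Qed.

Lemma is_trigsum_dyadic {q} k M : is_trigsum q -> is_trigsum (dyadic q k M).
Proof.
move=> qT; apply: (@is_trigsum_sum M (fun n u => (2 `^ k) ^+ n * q (u / 2 ^+ n))) => n.
apply: is_trigsumZ; have [s E] := is_trigsum_dilate (2 ^+ n)^-1 qT.
by exists s => u; rewrite -E mulrC.
Qed.

Lemma measurable_trigsum {q} : is_trigsum q -> measurable_fun setT q.
Proof.
move=> [s /funext ->]; apply: measurable_sum => ct.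
by mfun.
Qed.

Lemma trigsum_bounded {q} : is_trigsum q -> exists C, forall u, `|q u| <= C.
Proof.
move=> [s E]; exists (\sum_(ct <- s) `|ct.1| * 2) => u; rewrite E.
rewrite (le_trans (ler_norm_sum _ _ _))//; apply: ler_sum => ct _.
by rewrite normrM ler_wpM2l// ger0_norm ?onem_cos_ge0// onem_cos_le2.
Qed.

(** The constant depends on the list, hence on [M] for a dyadic sum. It serves only for
    integrability of [q u / u]; bounds uniform in [M] come from [dyadic_le]. *)
Lemma trigsum_lipschitz0 {q} : is_trigsum q -> exists C, forall u, `|q u| <= C * `|u|.
Proof.
move=> [s E]; exists (\sum_(ct <- s) `|ct.1| * `|ct.2|) => u; rewrite E.
rewrite (le_trans (ler_norm_sum _ _ _))// mulr_suml; apply: ler_sum => ct _.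
rewrite normrM -mulrA ler_wpM2l// -normrM ger0_norm ?onem_cos_ge0//.
exact: onem_cos_le_norm.
Qed.

End trigonometric_sums.

(** On [|X| >= 1] powers increase with the exponent; the rest is bounded. *)
Lemma le_moment {d} {T : measurableType d} {R : realType} {P : probability T R}
    {X : T -> R} k {k' : R} : measurable_fun setT X -> 0 <= k' <= k ->
  (\int[P]_x (`|X x| `^ k)%:E < +oo)%E ->
  (\int[P]_x (`|X x| `^ k')%:E < +oo)%E.
Proof.
move=> mX /andP[k'0 k'k] Xk; apply: (moment_split 1 mX k'0).
have mD := measurable_norm_ge 1 mX.
apply: le_lt_trans Xk.
apply: (@le_trans _ _ (\int[P]_(x in norm_ge X 1) (`|X x| `^ k)%:E)%E).
  apply: ge0_le_integral => //.
  - by apply/measurable_EFinP; apply: (@measurable_funS _ _ _ _ setT) => //; mfun.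
  - by apply/measurable_EFinP; apply: (@measurable_funS _ _ _ _ setT) => //; mfun.
  - by move=> x /= X1; rewrite lee_fin ler_powR.
apply: ge0_subset_integral => //.
by apply/measurable_EFinP; mfun.
Qed.

Section moments_ge1.
Context {R : realType} {d1 d2} {T1 : measurableType d1} {T2 : measurableType d2}.
Context {P : probability T1 R} {m : {sigma_finite_measure set T2 -> \bar R}}.
Context {X : T1 -> R} {h J : T2 -> R}.
Hypothesis lkX : levy_khintchine P m X h J.
Hypothesis iJ : m.-integrable setT (fun y => (h y * `|J y|)%:E).

Let mX := lk_measurable_X lkX.
Let mh := lk_measurable_h lkX.
Let mJ := lk_measurable_J lkX.
Let h0 := lk_h_ge0 lkX.

(** Linearity in [q], by induction on the list of terms; boundedness of [q] and of [q u / u]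
    supplies integrability on the two sides. *)
Lemma size_bias_trigsum {q} : is_trigsum q ->
  \int[P]_x q (X x) = biased_integral P m X h J q.
Proof.
move=> [s E].
have -> : q = trigsum s by exact/funext.
elim: s {q E} => [|[c t] s IH].
  under eq_Rintegral do rewrite /trigsum big_nil.
  rewrite /biased_integral; under [RHS]eq_Rintegral do rewrite /trigsum big_nil mul0r mulr0.
  by rewrite !Rintegral_cst// !mul0r.
have sT : is_trigsum (trigsum s) by exists s.
have cT : is_trigsum (fun u => 1 - cos (t * u)).
  by exists [:: (1, t)] => u; rewrite /trigsum big_seq1 mul1r.
have iP q : is_trigsum q -> P.-integrable setT (EFin \o (fun x => q (X x))).
  move=> qT; have [C qC] := trigsum_bounded qT.
  apply: (integrable_bounded C) => [|x]; last exact: qC.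
  exact: (measurableT_comp (measurable_trigsum qT)).
have iPm q : is_trigsum q -> (P \x m)%E.-integrable setT (EFin \o
    (fun z => h z.2 * J z.2 * (q (X z.1 + J z.2) / (X z.1 + J z.2)))).
  move=> qT; have [C qC] := trigsum_lipschitz0 qT.
  exact: (integrable_biased lkX iJ (measurable_trigsum qT)).
transitivity (c * \int[P]_x (1 - cos (t * X x)) + \int[P]_x trigsum s (X x)).
  rewrite -RintegralZl//; last exact: (iP _ cT).
  rewrite -RintegralD//; last 2 first.
  - exact: (iP _ (is_trigsumZ c cT)).
  - exact: (iP _ sT).
  by apply: eq_Rintegral => x _; rewrite /trigsum big_cons.
rewrite IH (size_bias_onem_cos lkX iJ) /biased_integral.
rewrite -RintegralZl//; last exact: (iPm _ cT).
rewrite -RintegralD//; last 2 first.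
- have := iPm _ (is_trigsumZ c cT); apply: eq_integrable => // z _ /=.
  by congr EFin; ring.
- exact: (iPm _ sT).
apply: eq_Rintegral => x _; rewrite /trigsum big_cons/=; ring.
Qed.

Let absJ_lty : (\int[m]_y (h y * `|J y|)%:E < +oo)%E.
Proof. exact: integrable_lty. Qed.

Let integral_size_bias q : is_trigsum q -> (forall u, 0 <= q u) ->
  (\int[P]_x (1 * q (X x))%:E =
   \int[P \x m]_z (h z.2 * J z.2 * (q (X z.1 + J z.2) / (X z.1 + J z.2)))%:E)%E.
Proof.
move=> qT q0; under eq_integral do rewrite mul1r.
have [C qC] := trigsum_bounded qT.
rewrite -EFin_Rintegral//; last first.
  apply: (integrable_bounded C) => [|x]; last exact: qC.
  exact: (measurableT_comp (measurable_trigsum qT)).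
rewrite (size_bias_trigsum qT) /biased_integral EFin_Rintegral//.
have [D qD] := trigsum_lipschitz0 qT.
exact: (integrable_biased lkX iJ (measurable_trigsum qT)).
Qed.

(** The exponent will be chosen with [k < e + 1]; the bound [1 - cos u <= |u|] then gives the order
    at 0 that [dyadic_le] demands. *)
Let W k e := @dyadic R (fun u => (1 - cos u) ^+ e.+1) k.

Let W_trigsum k e M : is_trigsum (W k e M).
Proof. by apply: is_trigsum_dyadic; exact: is_trigsum_exp. Qed.

Let kernel_ge0 e (u : R) : 0 <= (1 - cos u) ^+ e.+1.
Proof. by rewrite exprn_ge0// onem_cos_ge0. Qed.

Let mkernel e : measurable_fun setT (fun u : R => (1 - cos u) ^+ e.+1).
Proof. by mfun. Qed.

Let W_ge0 k e M u : 0 <= W k e M u.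
Proof. exact: dyadic_ge0. Qed.

Let W_le k e : 0 < k < e.+1%:R ->
  exists2 C, 0 <= C & forall M y, W k e M y <= C * `|y| `^ k.
Proof.
move=> ke; apply: (@dyadic_le _ _ k e.+1 (2 ^+ e.+1)) => //.
- by move=> y; rewrite lerXn2r ?nnegrE ?onem_cos_ge0 ?onem_cos_le2.
- move=> y; apply: (@le_trans _ _ (`|y| ^+ e.+1)).
    by rewrite lerXn2r ?nnegrE ?onem_cos_ge0 ?onem_cos_le_norm.
  by rewrite ler_peMl ?exprn_ge0// exprn_ege1// ler1n.
Qed.

Let kernel_ge e (u : R) : 2^-1 <= `|u| <= 1 ->
  (1 - cos 2^-1) ^+ e.+1 <= (1 - cos u) ^+ e.+1.
Proof.
move=> u1; rewrite lerXn2r ?nnegrE ?onem_cos_ge0//.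
exact: onem_cos_ge_half.
Qed.

Let kernel_gt0 e : 0 < (1 - cos (2^-1 : R)) ^+ e.+1.
Proof. by rewrite exprn_gt0// onem_cos_half_gt0. Qed.

Let mu1 : measurable_fun setT (fun z : T1 * T2 => X z.1 + J z.2).
Proof.
by apply: measurable_funD; [exact: measurable_fst_comp|exact: measurable_snd_comp].
Qed.

Let mh2 : measurable_fun setT (fun z : T1 * T2 => h z.2).
Proof. exact: measurable_snd_comp. Qed.

Let mJ2 : measurable_fun setT (fun z : T1 * T2 => J z.2).
Proof. exact: measurable_snd_comp. Qed.

Let mX1 : measurable_fun setT (fun z : T1 * T2 => X z.1).
Proof. exact: measurable_fst_comp. Qed.

Let exists_exponent (k : R) : exists e : nat, k < e.+1%:R.
Proof.
exists (Num.bound `|k|); rewrite (le_lt_trans (ler_norm k))//.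
rewrite (lt_le_trans (archi_boundP (normr_ge0 k)))// ler_nat; exact: leqnSn.
Qed.

Let integral_cross p (f : T2 -> R) : measurable_fun setT f -> (forall y, 0 <= f y) ->
  (\int[P]_x (`|X x| `^ p)%:E < +oo)%E -> (\int[m]_y (f y)%:E < +oo)%E ->
  (\int[P \x m]_z (`|X z.1| `^ p * f z.2)%:E < +oo)%E.
Proof.
move=> mf f0 Xp fp; rewrite (ge0_integral_prod (fun x => `|X x| `^ p) f)//.
  by rewrite lte_mul_pinfty// ?integral_ge0// ge0_fin_numE// integral_ge0.
by mfun.
Qed.

Let W_quotient_le k e C M u : 1 <= k -> 0 <= C ->
  (forall y, W k e M y <= C * `|y| `^ k) ->
  `|W k e M u / u| <= C * `|u| `^ (k - 1).
Proof.
move=> k1 C0 WC; rewrite normrM (ger0_norm (W_ge0 _ _ _ _)) normfV.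
have [->|u0] := eqVneq u 0.
  by rewrite normr0 invr0 mulr0 mulr_ge0// powR_ge0.
rewrite ler_pdivrMr ?normr_gt0// -mulrA [X in _ * X]mulrC.
by rewrite mulr_powRB1// (lt_le_trans ltr01).
Qed.

(* In the size-bias identity the quotient W (u) / u is O(|u|^(k-1)) at u = X + J,
   and |X + J|^(k-1) splits: this is where a moment of order k - 1 suffices. *)
Lemma moment_finite_ge1 k : 1 <= k ->
  (\int[P]_x (`|X x| `^ (k - 1))%:E < +oo)%E ->
  (\int[m]_y (h y * `|J y| `^ k)%:E < +oo)%E ->
  (\int[P]_x (`|X x| `^ k)%:E < +oo)%E.
Proof.
move=> k1 Xk1 Jk.
have k0 : 0 < k by rewrite (lt_le_trans ltr01).
have [e ke] := exists_exponent k.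
have [|C C0 WC] := W_le k e; first by rewrite k0.
apply: (moment_split 1 mX (ltW k0)).
(* A bound free of [M]: [C] is the uniform constant of the dyadic sums, and [2^(k - 1)] comes from
   splitting [|X + J|^(k - 1)]. *)
set B := (\int[P \x m]_z (C * 2 `^ (k - 1) *
   (`|X z.1| `^ (k - 1) * (h z.2 * `|J z.2|) + h z.2 * `|J z.2| `^ k))%:E)%E.
have WB M : (\int[P]_x (1 * W k e M (X x))%:E <= B)%E.
  rewrite integral_size_bias//.
  have mint : measurable_fun setT (fun z : T1 * T2 =>
      h z.2 * J z.2 * (W k e M (X z.1 + J z.2) / (X z.1 + J z.2))).
    apply: measurable_funM; first by mfun.
    apply: measurable_funM; last exact: measurable_fun_inv.
    exact: (measurableT_comp (measurable_trigsum (W_trigsum k e M)) mu1).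
  apply: (le_trans (lee_abs _)); apply: (le_trans (le_abse_integral _ _ _)) => //.
    exact/measurable_EFinP.
  apply: ge0_le_integral => //.
  - by apply: measurableT_comp => //; exact/measurable_EFinP.
  - by apply/measurable_EFinP; mfun.
  move=> z _; rewrite /= lee_fin.
  set u := X z.1 + J z.2; set q := W k e M u.
  have Hq := W_quotient_le k e C M u k1 C0 (WC M).
  rewrite normrM (le_trans (ler_wpM2l (normr_ge0 _) Hq))//.
  rewrite normrM (ger0_norm (h0 _)).
  have hu := powRD_le (X z.1) (J z.2) (k - 1).
  have Jk' : `|J z.2| * `|J z.2| `^ (k - 1) = `|J z.2| `^ k by rewrite mulr_powRB1.
  rewrite -Jk'.
  have : 0 <= h z.2 * `|J z.2| * C by rewrite !mulr_ge0.
  move=> /ler_wpM2l /(_ _ _ (hu _)); rewrite subr_ge0 => /(_ k1).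
  rewrite -/u => H; rewrite [leLHS]mulrA; apply: (le_trans H); rewrite le_eqVlt; apply/orP; left.
  by apply/eqP; ring.
have := @integral_powR_lty_of_dyadic _ _ _ P _ k _ (mkernel e) (kernel_ge0 e) k0
  (kernel_gt0 e) (kernel_ge e) (fun=> 1) X B _ _ _ WB.
under [in X in _ -> X]eq_integral do rewrite -[_ `^ _]mul1r.
apply => //.
rewrite /B; under eq_integral do rewrite EFinM.
rewrite ge0_integralZl_EFin//; last 3 first.
- by move=> z _; rewrite lee_fin addr_ge0 ?mulr_ge0 ?powR_ge0.
- by apply/measurable_EFinP; mfun.
- by rewrite mulr_ge0// powR_ge0.
under eq_integral do rewrite EFinD.
rewrite ge0_integralD//; last 4 first.
- by move=> z _; rewrite lee_fin !mulr_ge0 ?powR_ge0.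
- by apply/measurable_EFinP; mfun.
- by move=> z _; rewrite lee_fin mulr_ge0 ?powR_ge0.
- by apply/measurable_EFinP; mfun.
have c1 := integral_cross (k - 1) (fun y => h y * `|J y|).
(* The summand without [X] is treated as a cross term with factor [|X|^0 = 1]. *)
have c2 := integral_cross 0 (fun y => h y * `|J y| `^ k).
rewrite lte_mul_pinfty ?lee_fin ?mulr_ge0 ?powR_ge0//.
apply: lte_add_pinfty.
  by apply: c1 => // [|y]; [mfun|rewrite mulr_ge0].
under eq_integral => z _ do rewrite -[h _ * _]mul1r -(powRr0 `|X z.1|).
apply: c2 => // [|y|]; [by mfun|by rewrite mulr_ge0 ?powR_ge0|].
under eq_integral do rewrite powRr0.
by rewrite integral_cst//= probability_setT mul1e ltry.
Qed.

(** Otherwise the whole space would be a countable union of null sets. Restricting [X] to such an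
    event of positive probability lets the jump integral be recovered from an integral over the
    product. *)
Lemma exists_mass_bounded : exists2 K : R, 0 <= K & (0 < P [set x | `|X x| <= K]%R)%E.
Proof.
have mK (n : nat) : measurable [set x | `|X x| <= n%:R].
  rewrite -[X in measurable X]setTI; apply: measurable_fun_ler => //; mfun.
apply: contrapT => H.
have HK (n : nat) : P [set x | `|X x| <= n%:R] = 0%E.
  apply/eqP; rewrite eq_le measure_ge0 andbT leNgt; apply/negP => Pn.
  by apply: H; exists n%:R.
have : P.-negligible (\bigcup_n [set x | `|X x| <= n%:R]).
  by apply: negligible_bigcup => n; apply/negligibleP => //; exact: HK.
have -> : \bigcup_n [set x | `|X x| <= n%:R] = setT.
  apply/seteqP; split => // x _; exists (Num.bound `|X x|) => //=.
  exact/ltW/archi_boundP.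
by move/negligibleP => /(_ measurableT) /eqP; rewrite /= probability_setT onee_eq0.
Qed.

(* If 2 |X| <= |J| then J / (X + J) >= 2/3; elsewhere |X + J| <= 3 |X| and the
   possibly negative integrand of the size-bias identity is O(|X|^(k-1) h |J|). *)
Lemma levy_moment_finite_ge1 k : 1 <= k ->
  (\int[P]_x (`|X x| `^ k)%:E < +oo)%E ->
  exists2 K, 0 < K &
    (\int[m]_(y in norm_ge J K) (h y * `|J y| `^ k)%:E < +oo)%E.
Proof.
move=> k1 Xk.
have k0 : 0 < k by rewrite (lt_le_trans ltr01).
have Xk1 : (\int[P]_x (`|X x| `^ (k - 1))%:E < +oo)%E.
  by apply: (le_moment k mX _ Xk); rewrite subr_ge0 k1/= gerBl.
have [e ke] := exists_exponent k.
have [|C C0 WC] := W_le k e; first by rewrite k0.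
have [K K0 PK] := exists_mass_bounded.
set D := [set x | `|X x| <= K].
have mD : measurable D.
  by rewrite -[X in measurable X]setTI; apply: measurable_fun_ler => //; mfun.
(* If [|X| <= K] and [|J| >= L], then [|X| <= |J| / 2], as the ratio bound requires, and
   [|X + J| >= |J| / 2 >= 1], as the lower bound on dyadic sums requires. *)
set L := 2 * K + 2.
have mL : measurable (norm_ge J L) := measurable_norm_ge L mJ.
(* The factor comes from [|X + J| <= 3 |X|] in the region [|J| < 2 |X|]. *)
pose C' := C * 3 `^ (k - 1).
have C'0 : 0 <= C' by rewrite mulr_ge0// powR_ge0.
pose w (z : T1 * T2) : R := \1_D z.1 * (2 / 3 * h z.2 * \1_(norm_ge J L) z.2).
have mw : measurable_fun setT w.
  apply: measurable_funM; first exact: measurable_fst_comp.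
  apply: measurable_funM; first by mfun.
  exact: measurable_snd_comp.
have w0 z : 0 <= w z by rewrite !mulr_ge0.
have lower M (z : T1 * T2) : let u := X z.1 + J z.2 in
    w z * W k e M u <=
    h z.2 * J z.2 * (W k e M u / u) + C' * (`|X z.1| `^ (k - 1) * (h z.2 * `|J z.2|)).
  move=> u; set x := X z.1; set y := J z.2; set q := W k e M u.
  have q0 : 0 <= q := W_ge0 _ _ _ _.
  have hz := h0 z.2; set hh := h z.2 in hz *.
  have indc (T : Type) (A : set T) t : 0 <= (\1_A t : R) <= 1.
    by rewrite indicE; case: (_ \in _); rewrite ?lexx ?ler01.
  have [xy|yx] := leP `|x| (`|y| / 2).
    rewrite -[leLHS]addr0 lerD//; last by rewrite !mulr_ge0// powR_ge0.
    have [y0|y0] := eqVneq y 0.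
      rewrite y0 mulr0 mul0r /w indicE [X in _ * (_ * X)]indicE.
      rewrite [z.2 \in _](_ : _ = false) ?mulr0 ?mul0r//.
      by apply/negbTE/negP; rewrite inE /norm_ge/= -/y y0 normr0 /L; lra.
    have yu : 2 / 3 <= y / u := ratio_ge_twothirds x y y0 xy.
    apply: (@le_trans _ _ (hh * (y / u) * q)); last first.
      by rewrite le_eqVlt; apply/orP; left; apply/eqP; ring.
    rewrite ler_wpM2r// /w -/hh.
    apply: (@le_trans _ _ (1 * (2 / 3 * hh * 1))).
      have /andP[i1 i2] := indc _ D z.1; have /andP[i3 i4] := indc _ (norm_ge J L) z.2.
      by rewrite ler_pM ?ler_wpM2l ?mulr_ge0.
    by rewrite mul1r mulr1 mulrC ler_wpM2l.
  have -> : w z = 0.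
    rewrite /w !indicE; have [zD|] := boolP (z.1 \in D); last by rewrite mul0r.
    have [zJ|] := boolP (z.2 \in norm_ge J L); last by rewrite !mulr0.
    move: zD zJ; rewrite !inE /D /norm_ge/= -/x -/y /L => zD zJ; exfalso; lra.
  rewrite mul0r -/hh.
  have Hq := W_quotient_le k e C M u k1 C0 (WC M); rewrite -/q in Hq.
  have ux : `|u| `^ (k - 1) <= 3 `^ (k - 1) * `|x| `^ (k - 1).
    rewrite -powRM// ge0_ler_powR ?nnegrE ?mulr_ge0 ?subr_ge0//.
    by rewrite (le_trans (ler_normD _ _))//; lra.
  have : `|hh * y * (q / u)| <= C' * (`|x| `^ (k - 1) * (hh * `|y|)).
    rewrite normrM (normrM hh) (ger0_norm hz).
    apply: (le_trans (ler_wpM2l _ Hq)); first by rewrite mulr_ge0.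
    apply: (@le_trans _ _ (hh * `|y| * (C * (3 `^ (k - 1) * `|x| `^ (k - 1))))).
      by rewrite ler_wpM2l ?mulr_ge0// ler_wpM2l.
    by rewrite le_eqVlt; apply/orP; left; apply/eqP; rewrite /C'; ring.
  by rewrite ler_norml => /andP[H _]; lra.
set B := ((C%:E * \int[P]_x (`|X x| `^ k)%:E) +
  \int[P \x m]_z (C' * (`|X z.1| `^ (k - 1) * (h z.2 * `|J z.2|)))%:E)%E.
have Boo : (B < +oo)%E.
  apply: lte_add_pinfty; first by rewrite lte_mul_pinfty// ?lee_fin.
  under eq_integral do rewrite EFinM.
  rewrite ge0_integralZl_EFin//; last 2 first.
  - by move=> z _; rewrite lee_fin !mulr_ge0 ?powR_ge0.
  - by apply/measurable_EFinP; mfun.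
  rewrite lte_mul_pinfty ?lee_fin//.
  by apply: (integral_cross (k - 1) (fun y => h y * `|J y|)) => // [|y]; [mfun|rewrite mulr_ge0].
have mJW M : measurable_fun setT (fun z : T1 * T2 =>
    h z.2 * J z.2 * (W k e M (X z.1 + J z.2) / (X z.1 + J z.2))).
  apply: measurable_funM; first by mfun.
  apply: measurable_funM; last exact: measurable_fun_inv.
  exact: (measurableT_comp (measurable_trigsum (W_trigsum k e M)) mu1).
have WB M : (\int[P \x m]_z (w z * W k e M (X z.1 + J z.2))%:E <= B)%E.
  apply: (@le_trans _ _ (\int[P \x m]_z
      ((h z.2 * J z.2 * (W k e M (X z.1 + J z.2) / (X z.1 + J z.2)))%:E +
       (C' * (`|X z.1| `^ (k - 1) * (h z.2 * `|J z.2|)))%:E))%E).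
    apply: ge0_le_integral => //.
    - by move=> z _; rewrite lee_fin mulr_ge0// W_ge0.
    - apply/measurable_EFinP/measurable_funM => //.
      exact: (measurableT_comp (measurable_trigsum (W_trigsum k e M)) mu1).
    - by apply/measurable_EFinP/measurable_funD => //; mfun.
    - by move=> z _; rewrite -EFinD lee_fin; exact: lower.
  have [D' qD] := trigsum_lipschitz0 (W_trigsum k e M).
  rewrite integralD//; last 2 first.
  - exact: (integrable_biased lkX iJ (measurable_trigsum (W_trigsum k e M)) qD).
  - apply: integrable_ge0P => //; first by mfun.
      by move=> z; rewrite !mulr_ge0 ?powR_ge0.
    under eq_integral do rewrite EFinM.
    rewrite ge0_integralZl_EFin//; last 2 first.
    + by move=> z _; rewrite lee_fin !mulr_ge0 ?powR_ge0.
    + by apply/measurable_EFinP; mfun.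
    rewrite lte_mul_pinfty ?lee_fin//.
    by apply: (integral_cross (k - 1) (fun y => h y * `|J y|)) => // [|y]; [mfun|rewrite mulr_ge0].
  rewrite leeD2r// -integral_size_bias//.
  rewrite -ge0_integralZl_EFin//; last first.
    by apply/measurable_EFinP; mfun.
  apply: ge0_le_integral => //.
  - by move=> x _; rewrite lee_fin mul1r W_ge0.
  - apply/measurable_EFinP/measurable_funM => //.
    exact: (measurableT_comp (measurable_trigsum (W_trigsum k e M)) mX).
  - by apply/measurable_EFinP; mfun.
  - by move=> x _; rewrite -EFinM lee_fin mul1r.
exists L; first by rewrite /L; lra.
have := @integral_powR_lty_of_dyadic _ _ _ (P \x m)%E _ k _ (mkernel e) (kernel_ge0 e) k0
  (kernel_gt0 e) (kernel_ge e) w _ B mw mu1 w0 WB Boo.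
(* A lower bound of [w |X + J|^k] by a product, through [|X + J| >= |J| / 2]: its integral factors
   into the positive mass of [D] and the integral of [g], which must then be finite. *)
pose g (y : T2) : R := 2 / 3 * h y * \1_(norm_ge J L) y * (2^-1 * `|J y|) `^ k.
have g0 y : 0 <= g y by rewrite !mulr_ge0 ?powR_ge0.
have mg : measurable_fun setT g.
  by rewrite /g; apply: measurable_funM; [apply: measurable_funM => //|]; mfun.
move=> fin; have : (\int[P \x m]_z (\1_D z.1 * g z.2)%:E < +oo)%E.
  apply: le_lt_trans fin; rewrite [leRHS]integral_mkcond.
  have mU := measurable_norm_ge 1 mu1.
  apply: ge0_le_integral => //.
  - by move=> z _; rewrite lee_fin mulr_ge0.
  - apply/measurable_EFinP/measurable_funM; last exact: measurable_snd_comp.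
    exact: measurable_fst_comp.
  - apply: (measurable_restrictT _ mU).1; apply/measurable_EFinP.
    by apply: (@measurable_funS _ _ _ _ setT) => //; mfun.
  move=> z _; rewrite patchE /w /g.
  have [zD|zD] := boolP (z.1 \in D); last first.
    by rewrite indicE (negbTE zD) !mul0r; case: ifP.
  have [zJ|zJ] := boolP (z.2 \in norm_ge J L); last first.
    by rewrite [\1_(norm_ge J L) _]indicE (negbTE zJ) !(mulr0, mul0r); case: ifP.
  have Ju : 2^-1 * `|J z.2| <= `|X z.1 + J z.2|.
    rewrite !inE /D /norm_ge/= /L in zD zJ.
    by have := ler_normB (X z.1 + J z.2) (X z.1); rewrite addrAC subrr add0r; lra.
  rewrite ifT; last first.
    by rewrite inE /norm_ge/=; rewrite !inE /norm_ge/= /L in zJ; lra.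
  rewrite lee_fin mulrA ler_wpM2l ?mulr_ge0// ge0_ler_powR ?nnegrE ?mulr_ge0//.
  exact: ltW.
rewrite ge0_integral_prod//.
rewrite integral_indic// setIT => PDg.
have {PDg}goo : (\int[m]_y (g y)%:E < +oo)%E.
  rewrite ltNge leye_eq; apply/negP => /eqP gy.
  by move: PDg; rewrite gy gt0_muley// ltxx.
pose c0 := 2 / 3 * 2^-1 `^ k : R.
have c00 : 0 < c0 by rewrite mulr_gt0// powR_gt0.
apply: (@le_lt_trans _ _ (c0^-1%:E * \int[m]_y (g y)%:E)%E); last first.
  by rewrite lte_mul_pinfty// lee_fin invr_ge0 ltW.
rewrite -ge0_integralZl_EFin//; last 3 first.
- by move=> y _; rewrite lee_fin.
- exact/measurable_EFinP.
- by rewrite invr_ge0 ltW.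
rewrite [leLHS]integral_mkcond; apply: ge0_le_integral => //.
- by move=> y _; rewrite patchE; case: ifP => // _; rewrite lee_fin mulr_ge0// powR_ge0.
- apply: (measurable_restrictT _ mL).1; apply/measurable_EFinP.
  by apply: (@measurable_funS _ _ _ _ setT) => //; mfun.
- by apply/measurable_EFinP; apply: measurable_funM.
move=> y _; rewrite patchE -EFinM; case: ifP => yL; last first.
  by rewrite lee_fin mulr_ge0// invr_ge0 ltW.
rewrite lee_fin /g indicE yL mulr1 powRM// le_eqVlt; apply/orP; left; apply/eqP.
rewrite /c0; have : 2^-1 `^ k != 0 :> R by rewrite gt_eqF// powR_gt0.
by move: (2^-1 `^ k) => r r0; field.
Qed.

End moments_ge1.

(** * The first two moments *)

Section first_two_moments.
Context {R : realType} {d1 d2} {T1 : measurableType d1} {T2 : measurableType d2}.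
Context {P : probability T1 R} {m : {sigma_finite_measure set T2 -> \bar R}}.
Context {X : T1 -> R} {h J : T2 -> R}.
Hypothesis lkX : levy_khintchine P m X h J.
Hypothesis iJ : m.-integrable setT (fun y => (h y * `|J y|)%:E).
Hypothesis iX : P.-integrable setT (EFin \o X).

Let mX := lk_measurable_X lkX.
Let mh := lk_measurable_h lkX.
Let mJ := lk_measurable_J lkX.
Let h0 := lk_h_ge0 lkX.

Let integrable_levy_jump : m.-integrable setT (EFin \o (fun y => h y * J y)).
Proof.
apply: (integrable_le_norm _ _ iJ) => //; first by mfun.
by move=> y; rewrite !normrM normr_id.
Qed.

Let iXn : P.-integrable setT (EFin \o (fun x => `|X x|)).
Proof. exact: integrable_norm. Qed.

Let iP1 : P.-integrable setT (EFin \o cst 1).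
Proof. exact: finite_measure_integrable_cst. Qed.

Let is_derive_unique (f : R -> R) (t l1 l2 : R) :
  is_derive t 1 f l1 -> is_derive t 1 f l2 -> l1 = l2.
Proof. by move=> [_ <-] [_ <-]. Qed.

(** The derivative at 0 of [E sin (t X) = exp (- a) sin th]: the left side gives [E X], the right
    side [th'(0)], since [a] and [th] vanish at 0. *)
Lemma mean_levy : \int[P]_x X x = \int[m]_y (h y * J y).
Proof.
have d1' : is_derive (0 : R) 1 (fun t => \int[P]_x sin (t * X x))
    (\int[P]_x (X x * cos (0 * X x))).
  apply: (@is_derive_integral _ _ _ P (fun t x => sin (t * X x)) (fun t x => X x * cos (t * X x)) (fun x => `|X x|)) => [t|t x||t x].
  - exact: integrable_sin lkX t.
  - exact: is_derive_dilate.
  - exact: iXn.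
  - by rewrite normrM ler_piMr// cos_max.
have d2' := is_deriveM (@is_derive1_comp R expR (fun s => - _) 0 _ _ (is_derive_expR _)
    (is_deriveN (derive_levy_cos lkX iJ 0)))
  (@is_derive1_comp R sin _ _ _ _ (is_derive_sin _) (derive_levy_sin lkX iJ 0)).
have := is_derive_unique _ _ _ _ d1' (is_derive_congr d2' _ erefl).
under eq_Rintegral do rewrite mul0r cos0 mulr1.
move=> ->; last by move=> t /=; rewrite (lk_sin lkX).
have z1 : \int[m]_y (h y * sin (0 * J y)) = 0.
  by under eq_Rintegral do rewrite mul0r sin0 mulr0; rewrite Rintegral_cst// mul0r.
have z2 : \int[m]_y (h y * (1 - cos (0 * J y))) = 0.
  by under eq_Rintegral do rewrite mul0r cos0 subrr mulr0; rewrite Rintegral_cst// mul0r.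
rewrite /= z1 z2 oppr0 expR0 sin0 cos0 /GRing.scale/= !mul1r mul0r addr0.
by apply: eq_Rintegral => y _; rewrite mul0r cos0 mulr1.
Qed.

Hypothesis iX2 : P.-integrable setT (EFin \o (fun x => X x ^+ 2)).
Hypothesis iJ2 : m.-integrable setT (EFin \o (fun y => h y * J y ^+ 2)).

(** The size-bias identity for [1 - cos (t u)], differentiated once in [t]. *)
Let integral_X_sin (t : R) : \int[P]_x (X x * sin (t * X x)) =
  \int[(P \x m)%E]_z (h z.2 * J z.2 * sin (t * (X z.1 + J z.2))).
Proof.
have d1' : is_derive t 1 (fun t => \int[P]_x (1 - cos (t * X x)))
    (\int[P]_x (X x * sin (t * X x))).
  apply: (@is_derive_integral _ _ _ P (fun t x => 1 - cos (t * X x)) (fun t x => X x * sin (t * X x)) (fun x => `|X x|)) => [s|s x||s x].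
  - apply: (integrable_bounded 2) => [|x]; first by mfun.
    by rewrite ger0_norm ?onem_cos_ge0 ?onem_cos_le2.
  - by apply: (is_derive_dilate (f := fun x => 1 - cos x)); exact: is_derive_onem_cos.
  - exact: iXn.
  - by rewrite normrM ler_piMr// sin_max.
apply: (is_derive_unique _ _ _ _ d1').
by apply: (is_derive_congr (derive_biased_onem_cos lkX iJ t)) => // s; rewrite -size_bias_onem_cos.
Qed.

(** One more derivative, at [t = 0], gives [E X^2] as the integral of [h J (X + J)] over the
    product; independence and [mean_levy] turn the cross term into the squared mean. *)
Lemma second_moment_levy : \int[P]_x (X x ^+ 2) =
  (\int[m]_y (h y * J y)) ^+ 2 + \int[m]_y (h y * J y ^+ 2).
Proof.
(* Dominates [h |J| |X + J|]; the factor 1 puts the second summand in product form. *)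
pose G (z : T1 * T2) := `|X z.1| * (h z.2 * `|J z.2|) + 1 * (h z.2 * J z.2 ^+ 2).
have iG : (P \x m)%E.-integrable setT (EFin \o G).
  have := integrableD measurableT (integrable_prod iXn iJ)
    (@integrable_prod _ _ _ _ _ P m (cst 1) _ iP1 iJ2).
  exact.
have d1' : is_derive (0 : R) 1 (fun t => \int[P]_x (X x * sin (t * X x)))
    (\int[P]_x (X x ^+ 2 * cos (0 * X x))).
  apply: (@is_derive_integral _ _ _ P (fun t x => X x * sin (t * X x)) (fun t x => X x ^+ 2 * cos (t * X x)) (fun x => X x ^+ 2)) => [s|s x||s x].
  - apply: (integrable_le_norm _ _ iX) => // [|x]; first by mfun.
    by rewrite normrM ler_piMr// sin_max.
  - apply: (is_derive_congr (is_deriveZ (X x) (is_derive_dilate (X x) (is_derive_sin _)))) => //.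
    by rewrite /GRing.scale/= mulrA.
  - exact: iX2.
  - by rewrite normrM ger0_norm ?sqr_ge0// ler_piMr ?sqr_ge0// cos_max.
have d2' : is_derive (0 : R) 1
    (fun t => \int[(P \x m)%E]_z (h z.2 * J z.2 * sin (t * (X z.1 + J z.2))))
    (\int[(P \x m)%E]_z (h z.2 * J z.2 * (X z.1 + J z.2) * cos (0 * (X z.1 + J z.2)))).
  have mu1 : measurable_fun setT (fun z : T1 * T2 => X z.1 + J z.2).
    by apply: measurable_funD; [exact: measurable_fst_comp|exact: measurable_snd_comp].
  have mhJ : measurable_fun setT (fun z : T1 * T2 => h z.2 * J z.2).
    by apply: measurable_funM; exact: measurable_snd_comp.
  apply: (@is_derive_integral _ _ _ (P \x m)%E (fun t z => h z.2 * J z.2 * sin (t * (X z.1 + J z.2))) (fun t z => h z.2 * J z.2 * (X z.1 + J z.2) * cos (t * (X z.1 + J z.2))) (G)) => [s|s z||s z].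
  - have iw := @integrable_prod _ _ _ _ _ P m (cst 1) _
      iP1 integrable_levy_jump.
    apply: (integrable_le_norm _ _ iw) => // [|z]; first by mfun.
    by rewrite normrM mul1r ler_piMr// sin_max.
  - apply: (is_derive_congr (is_deriveZ (h z.2 * J z.2)
      (is_derive_dilate (X z.1 + J z.2) (is_derive_sin _)))) => //.
    by rewrite /GRing.scale/= mulrA.
  - exact: iG.
  - rewrite normrM (le_trans (ler_piMr _ (cos_max _)))// !normrM (ger0_norm (h0 _)).
    rewrite /G mul1r -(real_normK (num_real (J z.2))).
    have := ler_wpM2l (mulr_ge0 (h0 z.2) (normr_ge0 (J z.2))) (ler_normD (X z.1) (J z.2)).
    by move=> H; apply: (le_trans H); rewrite le_eqVlt; apply/orP; left; apply/eqP; ring.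
have := is_derive_unique _ _ _ _ d1' (is_derive_congr d2' (fun t => esym (integral_X_sin t)) erefl).
under eq_Rintegral do rewrite mul0r cos0 mulr1.
move=> ->.
under eq_Rintegral do rewrite mul0r cos0 mulr1 (mulrC (_ * _)) mulrDl.
have i1 := integrable_prod iX integrable_levy_jump.
have i2 := @integrable_prod _ _ _ _ _ P m (cst 1) _ iP1 iJ2.
transitivity (\int[(P \x m)%E]_z (X z.1 * (h z.2 * J z.2)) +
  \int[(P \x m)%E]_z (cst 1 z.1 * (h z.2 * J z.2 ^+ 2))).
  rewrite -RintegralD//; apply: eq_Rintegral => z _ /=; ring.
rewrite (Rintegral_prod iX integrable_levy_jump) (Rintegral_prod iP1 iJ2).
by rewrite mean_levy Rintegral_cst//= probability_setT/= !mul1r expr2.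
Qed.

End first_two_moments.

(** * Gamma integrals *)

Section gamma_integrals.
Context {R : realType}.
Notation leb := (@lebesgue_measure R).
Implicit Types b k : R.

Lemma integral_ge0_primitive (f F : R -> R) (a l : R) :
  (forall x, a <= x -> 0 <= f x) -> continuous f ->
  (forall x : R, is_derive x 1 F (f x)) -> F x @[x --> +oo%R] --> l ->
  (\int[leb]_(x in `[a, +oo[) (f x)%:E = (l - F a)%:E)%E.
Proof.
move=> f0 cf dF Fl.
rewrite (@ge0_continuous_FTC2y _ f F a l)//.
- exact: continuous_subspaceT.
- have : {for a, continuous F}.
    by apply/differentiable_continuous/derivable1_diffP; case: (dF a).
  exact: cvg_at_right_filter.
- by move=> x _; rewrite derive1E; apply: derive_val.
Qed.

Lemma is_derive_expRN b (x : R) :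
  is_derive x 1 (fun x => expR (- b * x)) (- b * expR (- b * x)).
Proof.
apply: (is_derive_congr (is_derive_dilate (f := expR) (- b) (is_derive_expR (x * - b)))) => [y|].
  by rewrite /= mulrC.
by rewrite (mulrC x).
Qed.

Lemma continuous_expRN b : continuous (fun x : R => expR (- b * x)).
Proof.
move=> x; apply/differentiable_continuous/derivable1_diffP.
by case: (is_derive_expRN b x).
Qed.

Lemma cvg_expRN b : 0 < b -> expR (- b * x) @[x --> +oo%R] --> 0.
Proof.
move=> b0; rewrite (_ : (fun x => expR (- b * x)) =
  (fun z => expR (- z)) \o (fun z => b * z)); last by apply: eq_fun => x; rewrite mulNr.
apply: (@cvg_comp _ _ _ _ _ _ (pinfty_nbhs R)); last exact: cvgr_expR.
exact: gt0_cvgMry.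
Qed.

Lemma integral_expRN b : 0 < b ->
  (\int[leb]_(x in `[0%R, +oo[) (expR (- b * x))%:E = (b^-1)%:E)%E.
Proof.
move=> b0.
transitivity (0 - (- b^-1 * expR (- b * 0)))%:E; last first.
  by rewrite mulr0 expR0 mulr1 sub0r opprK.
apply: (integral_ge0_primitive _ (fun x => - b^-1 * expR (- b * x)) 0 0).
- by move=> x _; exact: expR_ge0.
- exact: continuous_expRN.
- move=> x; apply: (is_derive_congr (is_deriveZ (- b^-1) (is_derive_expRN b x))) => //.
  by rewrite /GRing.scale/= mulrA mulrNN mulVf ?mul1r// gt_eqF.
- by rewrite -[X in _ --> X](mulr0 (- b^-1)); apply: cvgM; [exact: cvg_cst|exact: cvg_expRN].
Qed.

(** From [exp y >= 1 + y^2 / 2]; quadratic decay is enough to kill the linear factor in the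
    primitive of [x exp (- b x)]. *)
Lemma expRN_le b x : 0 < b -> 0 < x -> expR (- b * x) <= 2 / (b * x) ^+ 2.
Proof.
move=> b0 x0; have bx : 0 < b * x by rewrite mulr_gt0.
have := expR_ge1Dxn 1 (ltW bx).
rewrite mulNr expRN (_ : 2`!%:R = 2)// => H.
rewrite -[leRHS]invrK lef_pV2 ?posrE ?expR_gt0 ?invr_gt0 ?divr_gt0 ?exprn_gt0//.
by rewrite invfM invrK mulrC; lra.
Qed.

Lemma integral_id_expRN b : 0 < b ->
  (\int[leb]_(x in `[0%R, +oo[) (x * expR (- b * x))%:E = (b ^- 2)%:E)%E.
Proof.
move=> b0.
have bn0 : b != 0 by rewrite gt_eqF.
transitivity (0 - (- ((0 / b + b ^- 2) * expR (- b * 0))))%:E; last first.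
  by rewrite mul0r !add0r mulr0 expR0 mulr1 opprK.
apply: (integral_ge0_primitive _ (fun x => - ((x / b + b ^- 2) * expR (- b * x))) 0 0).
- by move=> x x0; rewrite mulr_ge0// expR_ge0.
- by move=> x; apply: cvgM; [exact: cvg_id|exact: continuous_expRN].
- move=> x.
  have d1 : is_derive x 1 (fun x => x / b + b ^- 2) b^-1.
    apply: (is_derive_congr (is_deriveD (is_deriveZ b^-1 (is_derive_id x 1))
      (is_derive_cst (b ^- 2) x 1))) => [y|].
      by rewrite /= /GRing.scale/= mulrC.
    by rewrite /GRing.scale/= mulr1 addr0.
  apply: (is_derive_congr (is_deriveN (is_deriveM d1 (is_derive_expRN b x)))) => //.
  by rewrite /GRing.scale/=; field.
(* For [x >= 1] the linear factor is at most [x (b^-1 + b^-2)]; multiplied by [2 / (b x)^2] it gives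
   [K / x]. *)
- pose K := (b^-1 + b ^- 2) * (2 / b ^+ 2).
  rewrite -[X in _ --> X]oppr0; apply: cvgN.
  apply: (@squeeze_cvgr _ _ _ _ (cst 0) (fun x => K * x^-1)).
  + near=> x; have x1 : 1 <= x by near: x; exact: nbhs_pinfty_ge.
    have x0 : 0 < x by rewrite (lt_le_trans ltr01).
    have bx0 : 0 <= x / b + b ^- 2 by rewrite addr_ge0 ?divr_ge0 ?invr_ge0 ?exprn_ge0 ?ltW.
    rewrite /= mulr_ge0 ?expR_ge0//=.
    apply: (@le_trans _ _ ((x * (b^-1 + b ^- 2)) * (2 / (b * x) ^+ 2))).
      apply: ler_pM => //.
        by rewrite mulrDr lerD2l ler_peMl ?invr_ge0 ?exprn_ge0 ?(ltW b0).
      exact: expRN_le.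
    rewrite le_eqVlt; apply/orP; left; apply/eqP; rewrite /K.
    have xn0 : x != 0 by rewrite gt_eqF.
    by field; rewrite bn0 xn0.
  + exact: cvg_cst.
  + rewrite -[X in _ --> X](mulr0 K); apply: cvgM; first exact: cvg_cst.
    apply/gtr0_cvgV0; last exact: cvg_id.
    exact: nbhs_pinfty_gt.
Unshelve. all: by end_near. Qed.

(** For [k < 1] the integrand blows up at 0, so the primitive [x^k / k] is used on
    [[b / (n + 1), b]] and the cutoff is removed monotonically. *)
Lemma integral_powR_near0 k b : 0 < k -> 0 < b ->
  (\int[leb]_(r in `]0%R, b]) (r `^ (k - 1))%:E <= (b `^ k / k)%:E)%E.
Proof.
move=> k0 b0.
pose g (n : nat) (r : R) := r `^ (k - 1) * \1_(`[b / n.+1%:R, b]%classic) r.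
apply: (@integral_le_of_truncations _ _ _ leb `]0, b]%classic _ _ g) => //.
- by apply/measurable_EFinP; apply: measurable_funTS; mfun.
- by move=> x _; rewrite lee_fin powR_ge0.
- by move=> n; apply: measurable_funTS; apply: measurable_funM => //; mfun.
- by move=> n x; rewrite mulr_ge0// powR_ge0.
- move=> x p n pn; rewrite ler_wpM2l ?powR_ge0// !indicE ler_nat.
  have [|//] := boolP (x \in `[b / p.+1%:R, b]%classic); rewrite !inE/= !in_itv/=.
  move=> /andP[px xb]; rewrite [X in (_ <= X)%N](_ : _ = true :> nat)//.
  rewrite mem_set//= in_itv/= xb andbT (le_trans _ px)// ler_pM2l// lef_pV2 ?posrE//.
  by rewrite ler_nat.
- move=> x /=; rewrite in_itv/= => /andP[x0 xb].
  exists (Num.bound (b / x)); rewrite lee_fin /g indicE mem_set ?mulr1//=.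
  rewrite in_itv/= xb andbT ler_pdivrMr// mulrC -ler_pdivrMr//.
  rewrite (le_trans (ltW (archi_boundP (divr_ge0 (ltW b0) (ltW x0)))))// ler_nat.
  exact: leqnSn.
move=> n; have bn0 : 0 < b / n.+1%:R by rewrite divr_gt0.
have bnb : b / n.+1%:R <= b by rewrite ler_pdivrMr// ler_peMr ?ler1n// ltW.
have -> : (\int[leb]_(r in `]0%R, b]) (g n r)%:E = \int[leb]_(r in `[(b / n.+1%:R)%R, b]) (r `^ (k - 1))%:E)%E.
  rewrite integral_mkcond [RHS]integral_mkcond; apply: eq_integral => r _.
  rewrite !patchE /g indicE; have [rn|rn] := boolP (r \in `[b / n.+1%:R, b]%classic).
    rewrite mulr1 ifT//; move: rn; rewrite !inE/= !in_itv/= => /andP[rn ->].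
    by rewrite (lt_le_trans bn0 rn).
  by rewrite mulr0; case: ifP.
move: bnb; rewrite le_eqVlt => /orP[/eqP bE|bnb].
  by rewrite bE set_itv1 integral_set1 lee_fin divr_ge0 ?powR_ge0// ltW.
have pos x : x \in `[b / n.+1%:R, b] -> 0 < x.
  by rewrite in_itv/= => /andP[+ _]; apply: lt_le_trans.
have dF (x : R) : 0 < x -> is_derive x 1 (fun x => k^-1 * x `^ k) (x `^ (k - 1)).
  move=> x0; have h : is_derive x 1 (fun x : R => x `^ k) (k * x `^ (k - 1)) by exact: is_derive1_powR.
  apply: (is_derive_congr (is_deriveZ k^-1 h)) => //.
  by rewrite /GRing.scale/= mulKf// gt_eqF.
have cF (x : R) : 0 < x -> {for x, continuous (fun x => k^-1 * x `^ k)}.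
  move=> x0; apply/differentiable_continuous/derivable1_diffP.
  by case: (dF x x0).
rewrite (@continuous_FTC2 _ _ (fun x => k^-1 * x `^ k) _ _ bnb).
- by rewrite -EFinB lee_fin mulrC gerBl mulr_ge0 ?powR_ge0// invr_ge0 ltW.
- apply: derivable_within_continuous => x /pos x0.
  by apply: derivable_powR; rewrite in_itv/= x0.
- split.
  + by move=> x /subset_itv_oo_cc /pos /dF [].
  + exact/cvg_at_right_filter/cF.
  + exact/cvg_at_left_filter/cF.
- by move=> x /subset_itv_oo_cc /pos /dF dFx; rewrite derive1E; apply: derive_val.
Qed.

(** One term of the exponential series, of degree above [k]. Only half of the exponent is spent, so
    that an integrable exponential remains. *)
Lemma powR_expRN_bound k : exists2 C, 0 <= C &
  forall x, 1 <= x -> x `^ k <= C * expR (x / 2).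
Proof.
pose n := (Num.bound `|k|).
exists (n.+1`!%:R * 2 ^+ n.+1); first by rewrite mulr_ge0.
move=> x x1; have x0 : 0 <= x / 2 by rewrite divr_ge0// (le_trans ler01).
apply: (@le_trans _ _ (x ^+ n.+1)).
  rewrite -powR_mulrn ?(le_trans ler01)// ler_powR// (le_trans (ler_norm _))//.
  rewrite (le_trans (ltW (archi_boundP (normr_ge0 k))))// ler_nat; exact: leqnSn.
have := expR_ge1Dxn n x0; rewrite exprMn exprVn.
have f0 : 0 < n.+1`!%:R :> R by rewrite ltr0n fact_gt0.
have p0 : 0 < 2 ^+ n.+1 :> R by rewrite exprn_gt0.
move: (n.+1`!%:R) (2 ^+ n.+1) (x ^+ n.+1) (expR (x / 2)) f0 p0 => u v w z u0 v0 H.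
have {}H : w / v / u <= z by apply: le_trans H; rewrite lerDr.
by move: H; rewrite ler_pdivrMr// ler_pdivrMr//; lra.
Qed.


Lemma measurable_gamma_density b k (D : set R) :
  measurable_fun D (fun r => expR (- b * r) / r * r `^ k).
Proof. by apply: measurable_funTS; mfun. Qed.

Lemma gamma_density_ge0 b k r : 0 <= r -> 0 <= expR (- b * r) / r * r `^ k.
Proof. by move=> r0; rewrite mulr_ge0 ?powR_ge0// divr_ge0// expR_ge0. Qed.

(** The exact value is [Gamma(k) b^-k]; only the power of [b] matters. Split at [r = 1 / b]: below,
    the integral of [r^(k - 1)] is at most [b^-k / k]; above, [1 / r <= b] and
    [(b r)^k <= C exp (b r / 2)] leave [2 C b^-k]. *)
Lemma gamma_moment_le k : 0 < k -> exists2 C, 0 <= C & forall b, 0 < b ->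
  (\int[leb]_(r in `[0%R, +oo[) (expR (- b * r) / r * r `^ k)%:E <=
   (C * (b `^ k)^-1)%:E)%E.
Proof.
move=> k0; have [C C0 HC] := powR_expRN_bound k.
exists (k^-1 + 2 * C) => [|b b0]; first by rewrite addr_ge0 ?mulr_ge0// invr_ge0 ltW.
have ib0 : 0 < b^-1 by rewrite invr_gt0.
have itvE : `[0%R, +oo[%classic = `[0%R, b^-1]%classic `|` `]b^-1, +oo[%classic.
  by rewrite -itv_bndbnd_setU// bnd_simp// ltW.
rewrite itvE ge0_integral_setU//; last 3 first.
- by apply/measurable_EFinP; exact: measurable_gamma_density.
- move=> r; rewrite -itvE/= in_itv/= andbT => r0.
  by rewrite lee_fin gamma_density_ge0.
- by apply/disj_setPLR => r /=; rewrite !in_itv/= andbT => /andP[_]; rewrite leNgt => /negP.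
rewrite mulrDl EFinD leeD//.
  rewrite -integral_itv_obnd_cbnd; last first.
    by apply/measurable_EFinP; exact: measurable_gamma_density.
  apply: (@le_trans _ _ ((b^-1) `^ k / k)%:E); last first.
    rewrite lee_fin mulrC ler_wpM2l ?invr_ge0 ?(ltW k0)//.
    by rewrite -powR_inv1 ?(ltW b0)// powRAC powR_inv1 ?powR_ge0.
  apply: le_trans (integral_powR_near0 _ _ k0 ib0).
  apply: ge0_le_integral => //.
  - move=> r /=; rewrite in_itv/= => /andP[r0 _].
    by rewrite lee_fin gamma_density_ge0// ltW.
  - by apply/measurable_EFinP; exact: measurable_gamma_density.
  - by apply/measurable_EFinP; apply: measurable_funTS; mfun.
  - move=> r /=; rewrite in_itv/= => /andP[r0 _]; rewrite lee_fin.
    rewrite -(mulr_powRB1 (ltW r0) k0) mulrA divfK ?gt_eqF//.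
    by rewrite ler_piMl ?powR_ge0// -expR0 ler_expR mulNr oppr_le0 mulr_ge0// ltW.
apply: (@le_trans _ _ (\int[leb]_(r in `[0%R, +oo[)
    (b * (b `^ k)^-1 * C * expR (- (b / 2) * r))%:E)%E).
  apply: (@le_trans _ _ (\int[leb]_(r in `]b^-1%R, +oo[)
    (b * (b `^ k)^-1 * C * expR (- (b / 2) * r))%:E)%E).
    apply: ge0_le_integral => //.
    - move=> r /=; rewrite in_itv/= andbT => br.
      by rewrite lee_fin gamma_density_ge0// ltW// (lt_trans ib0).
    - by apply/measurable_EFinP; exact: measurable_gamma_density.
    - by apply/measurable_EFinP; apply: measurable_funTS; mfun.
    - move=> r /=; rewrite in_itv/= andbT => br.
      have r0 : 0 < r by rewrite (lt_trans ib0).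
      have br1 : 1 <= b * r by rewrite mulrC -ler_pdivrMr// div1r ltW.
      have := HC _ br1; rewrite powRM ?(ltW b0) ?(ltW r0)// => H.
      have bk : 0 < b `^ k by rewrite powR_gt0.
      have rk : r `^ k <= C * expR (b * r / 2) / b `^ k.
        by rewrite ler_pdivlMr// mulrC.
      have rib : r^-1 <= b by rewrite -[leRHS]invrK lef_pV2 ?posrE// ltW.
      rewrite lee_fin mulrAC.
      apply: (@le_trans _ _ (expR (- b * r) * (C * expR (b * r / 2) / b `^ k) * b)).
        by rewrite ler_pM ?invr_ge0 ?(ltW r0) ?mulr_ge0 ?powR_ge0 ?expR_ge0// ler_wpM2l// expR_ge0.
      have -> : - b * r = - (b / 2) * r + - (b * r / 2) by field.
      rewrite expRD expRN.
      rewrite le_eqVlt; apply/orP; left; apply/eqP; field.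
      by rewrite (gt_eqF bk) expR_eq0.
  apply: ge0_subset_integral => //.
  - by apply/measurable_EFinP; apply: measurable_funTS; mfun.
  - by move=> r _; rewrite lee_fin !mulr_ge0 ?expR_ge0 ?invr_ge0 ?powR_ge0// ltW.
  - by move=> r /=; rewrite !in_itv/= !andbT => /ltW; apply: le_trans; rewrite ltW.
under eq_integral do rewrite EFinM.
rewrite ge0_integralZl_EFin//.
- rewrite integral_expRN ?divr_gt0// -EFinM lee_fin le_eqVlt; apply/orP; left; apply/eqP.
  have bn0 : b != 0 by rewrite gt_eqF.
  have bkn0 : b `^ k != 0 by rewrite gt_eqF// powR_gt0.
  by field; rewrite ?bn0 ?bkn0.
- by apply/measurable_EFinP; apply: measurable_funTS; mfun.
- by rewrite !mulr_ge0 ?invr_ge0 ?powR_ge0// ltW.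
Qed.

(* On [[rho, 2 rho]] with [b rho <= 1] the density is bounded below. *)
Lemma gamma_moment_ge k b rho (D : set R) : 0 < k -> 0 <= b -> 0 < rho -> b * rho <= 1 ->
  measurable D -> `[rho, 2 * rho]%classic `<=` D -> (forall r, D r -> 0 <= r) ->
  ((expR (-2) / 2 * rho `^ k)%:E <=
   \int[leb]_(r in D) (expR (- b * r) / r * r `^ k)%:E)%E.
Proof.
move=> k0 b0 rho0 brho mD rD D0.
(* On this interval [exp (- b r) >= exp (- 2)], [1 / r >= 1 / (2 rho)] and [r^k >= rho^k]; its
   length [rho] cancels the one in the denominator. *)
apply: (@le_trans _ _ (\int[leb]_(r in `[rho, (2 * rho)%R]) (cst (expR (-2) / (2 * rho) * rho `^ k)%:E r))%E).
  rewrite integral_cst//= lebesgue_measure_itv/= lte_fin ltr_pMl// ltr1n -EFinB -EFinM.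
  rewrite lee_fin le_eqVlt; apply/orP; left; apply/eqP; field.
  by rewrite gt_eqF.
apply: (@le_trans _ _ (\int[leb]_(r in `[rho, (2 * rho)%R]) (expR (- b * r) / r * r `^ k)%:E)%E).
  apply: ge0_le_integral => //.
  - by move=> r _; rewrite lee_fin mulr_ge0 ?powR_ge0// divr_ge0 ?expR_ge0// mulr_ge0// ltW.
  - by apply/measurable_EFinP; exact: measurable_gamma_density.
  - move=> r /=; rewrite in_itv/= => /andP[r1 r2].
    have r0 : 0 < r by rewrite (lt_le_trans rho0).
    rewrite lee_fin ler_pM ?mulr_ge0 ?powR_ge0 ?invr_ge0 ?expR_ge0 ?(ltW rho0)//.
    - by rewrite mulr_ge0// ltW.
    - rewrite ler_pM ?expR_ge0 ?invr_ge0 ?mulr_ge0 ?(ltW rho0)//.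
        rewrite ler_expR mulNr lerN2 (le_trans (ler_wpM2l b0 r2))//; lra.
      by rewrite lef_pV2 ?posrE// mulr_gt0.
    - by rewrite ge0_ler_powR ?nnegrE ?(ltW k0) ?(ltW rho0) ?(ltW r0).
apply: ge0_subset_integral => //.
- by apply/measurable_EFinP; exact: measurable_gamma_density.
- by move=> r /D0 r0; rewrite lee_fin gamma_density_ge0.
Qed.

End gamma_integrals.

(** * Norms and Borel measurability *)

Section norm_equivalence.
Context {R : realType} {d : nat} {N : 'cV[R]_d -> R}.
Hypothesis N_norm : is_norm N.
Implicit Types x y : 'cV[R]_d.

Let norm0 : N 0 = 0.
Proof. by rewrite -(scale0r (0 : 'cV[R]_d)) (is_norm_homog N_norm) normr0 mul0r. Qed.

Let normN x : N (- x) = N x.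
Proof. by rewrite -scaleN1r (is_norm_homog N_norm) normrN normr1 mul1r. Qed.

Lemma is_norm_ge0 x : 0 <= N x.
Proof.
have := is_norm_triangle N_norm x (- x).
by rewrite subrr norm0 normN; lra.
Qed.

Lemma is_norm_le_coord x : N x <= \sum_i `|x i ord0| * N (delta_mx i ord0).
Proof.
have {1}-> : x = \sum_i x i ord0 *: delta_mx i ord0.
  by rewrite {1}(matrix_sum_delta x); apply: eq_bigr => i _; rewrite big_ord1.
elim/big_rec2 : _ => [|i u v _ H]; first by rewrite norm0.
rewrite (le_trans (is_norm_triangle N_norm _ _))// lerD//.
by rewrite (is_norm_homog N_norm).
Qed.

Lemma is_norm_continuous : continuous N.
Proof.
pose K := \sum_i N (delta_mx i ord0).
have K0 : 0 <= K by apply: sumr_ge0 => i _; exact: is_norm_ge0.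
have lip x y : `|N x - N y| <= N (x - y).
  have h x' y' : N x' - N y' <= N (x' - y').
    by rewrite lerBlDr -{1}(subrK y' x') (is_norm_triangle N_norm).
  by rewrite ler_norml h andbT lerNl opprB -(opprB y x) normN h.
move=> x B /nbhs_ballP[e e0 eB]; apply/nbhs_ballP.
have e'0 : 0 < e / (K + 1) by rewrite divr_gt0// ltr_wpDl.
exists (e / (K + 1)) => // y [_ xy]; apply: eB; rewrite /ball/=.
apply: (le_lt_trans (lip x y)); apply: (le_lt_trans (is_norm_le_coord _)).
apply: (@le_lt_trans _ _ (e / (K + 1) * K)).
  rewrite mulr_sumr; apply: ler_sum => i _; rewrite ler_wpM2r ?is_norm_ge0// !mxE ltW//.
  exact: xy.
rewrite mulrAC ltr_pdivrMr ?ltr_wpDl// ltr_pM2l// ltrDl//.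
Qed.

(** Compactness of the unit sphere of the maximum norm, on which the continuous [N] attains a
    positive minimum. Row vectors and transposes appear because the extreme value theorem is applied
    to row vectors. *)
Lemma coord_le_is_norm : (0 < d)%N ->
  exists2 C, 0 < C & forall x i, `|x i ord0| <= C * N x.
Proof.
move=> d0.
pose A := [set y : 'rV[R]_d | `|y| = 1].
have A0 : A !=set0.
  pose v : 'rV[R]_d := const_mx 1.
  have v0 : `|v| != 0.
    rewrite normr_eq0; apply/eqP => /matrixP /(_ ord0 (Ordinal d0)).
    by rewrite !mxE => /eqP; rewrite oner_eq0.
  exists (`|v|^-1 *: v); rewrite /A/= normrZ normfV normr_id mulVf//.
have cA : compact A.
  apply: bounded_closed_compact.
    by exists 1; split => // M M1 y /= ->; exact: ltW.
  rewrite (_ : A = (@Num.Def.normr R 'rV[R]_d) @^-1` [set 1])//.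
  apply: closed_comp => [y _|]; first exact: norm_continuous.
  exact: closed_eq.
have cN : {within A, continuous (fun y : 'rV[R]_d => N y^T)}.
  apply: continuous_subspaceT => y; apply: continuous_comp; last exact: is_norm_continuous.
  move=> B /nbhs_ballP[e e0 eB]; apply/nbhs_ballP; exists e => // z [_ zB].
  by apply: eB; split => // i j; rewrite !mxE; exact: zB.
have [y0 y0A y0min] := EVT_min_rV A0 cA cN.
have c0 : 0 < N y0^T.
  rewrite lt_neqAle is_norm_ge0 andbT eq_sym; apply/eqP => /(is_norm_eq0 N_norm).
  move=> /(congr1 trmx); rewrite trmxK trmx0 => y00.
  by move: y0A; rewrite inE /A/= y00 normr0 => /esym/eqP; rewrite oner_eq0.
exists (N y0^T)^-1; first by rewrite invr_gt0.
move=> x i; have [->|x0] := eqVneq x 0.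
  by rewrite mxE normr0 norm0 mulr0.
have tx0 : 0 < `|x^T|.
  rewrite normr_gt0; apply: contra x0 => /eqP H.
  by rewrite -(trmxK x) H trmx0.
have := y0min (`|x^T|^-1 *: x^T).
rewrite linearZ/= trmxK (is_norm_homog N_norm) normfV normr_id.
move=> /(_ _)/wrap[].
  by rewrite inE /A/= normrZ normfV normr_id mulVf// gt_eqF.
rewrite ler_pdivlMl// => H.
rewrite ler_pdivlMl//; apply: le_trans H; rewrite mulrC ler_wpM2r ?is_norm_ge0//.
rewrite [leRHS]/Num.Def.normr /= mx_normrE.
have := @le_bigmax _ _ _ 0 (fun j : 'I_1 * 'I_d => `|x^T j.1 j.2|) (ord0, i).
by rewrite /= mxE.
Qed.

End norm_equivalence.

Section borel_measurability.
Context {R : realType} {d : nat}.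

Lemma continuous_measurable_borelRd (f : 'cV[R]_d -> R) : continuous f ->
  measurable_fun setT (f : borelRd R d -> R).
Proof.
move=> /continuousP cf; apply: (measurability _ (RGenOpens.measurableE R)).
move=> _ [_ [a [b ->] <-]]; rewrite setTI.
by apply: sub_gen_smallest; exact/cf/interval_open.
Qed.

Lemma measurable_coord i : measurable_fun setT (fun v : borelRd R d => (v : 'cV[R]_d) i ord0).
Proof. by apply: continuous_measurable_borelRd; exact: coord_continuous. Qed.

Lemma dotvE (v z : 'cV[R]_d) : dotv v z = \sum_i v i ord0 * z i ord0.
Proof. by rewrite /dotv mxE; apply: eq_bigr => i _; rewrite mxE. Qed.

Lemma dotvC (v z : 'cV[R]_d) : dotv v z = dotv z v.
Proof. by rewrite !dotvE; apply: eq_bigr => i _; rewrite mulrC. Qed.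

Lemma dotvZr t (v z : 'cV[R]_d) : dotv v (t *: z) = t * dotv v z.
Proof. by rewrite !dotvE mulr_sumr; apply: eq_bigr => i _; rewrite mxE mulrCA. Qed.

Lemma dotvDr (v z z' : 'cV[R]_d) : dotv v (z + z') = dotv v z + dotv v z'.
Proof. by rewrite !dotvE -big_split; apply: eq_bigr => i _; rewrite mxE mulrDr. Qed.

Lemma dotv_delta (v : 'cV[R]_d) i : dotv v (delta_mx i ord0) = v i ord0.
Proof.
rewrite dotvE (bigD1 i)//= mxE !eqxx mulr1 big1 ?addr0// => j ji.
by rewrite mxE (negbTE ji) mulr0.
Qed.

Lemma measurable_dotv z : measurable_fun setT (fun v : borelRd R d => dotv v z).
Proof.
rewrite (_ : (fun v => _) = fun v : borelRd R d => \sum_i (v : 'cV[R]_d) i ord0 * z i ord0); last first.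
  by apply/funext => v; rewrite dotvE.
apply: measurable_sum => i; apply: measurable_funM => //.
exact: measurable_coord.
Qed.

End borel_measurability.

(** * The Levy measure in polar coordinates *)

Section polar_measure.
Context {R : realType} {d : nat}.
Variable alpha : {finite_measure set (borelRd R d) -> \bar R}.
(** Given a name so that it can carry a sigma-finite structure of its own, needed for its product
    with [mu]. *)
Definition polar_measure : set (borelRd R d * measurableTypeR R)%type -> \bar R :=
  (alpha \x @lebesgue_measure R)%E.
HB.instance Definition _ := Measure.on polar_measure.

Let polar_measure_sigma_finite : sigma_finite setT polar_measure.
Proof.
have [G TG Goo] := sigma_finiteT (@lebesgue_measure R).
exists (fun n => setT `*` G n).
  by apply/seteqP; split => // -[x y] _; have : setT y by []; rewrite TG => -[n _ Gy]; exists n.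
move=> k; have [mG Gk] := Goo k; split; first exact: measurableX.
rewrite /polar_measure product_measure1E// lte_mul_pinfty//.
exact: fin_num_measure.
Qed.

HB.instance Definition _ :=
  Measure_isSigmaFinite.Build _ _ _ polar_measure polar_measure_sigma_finite.
End polar_measure.
Notation normc := complex.ComplexField.Normc.normc (only parsing).

Section gamma_levy.
Context {R : realType} {d : nat} {N : 'cV[R]_d -> R}.
Context {alpha : {finite_measure set (borelRd R d) -> \bar R}}.
Context {beta : 'cV[R]_d -> R} {mu : probability (borelRd R d) R}.
Hypothesis N_norm : is_norm N.
Hypothesis beta_meas : measurable_fun (unit_sphere N) (beta : borelRd R d -> R).
Hypothesis beta_ge0 : forall v, unit_sphere N v -> 0 <= beta v.
Hypothesis mu_gamma : is_gamma N alpha beta mu.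

Let leb : {sigma_finite_measure set (measurableTypeR R) -> \bar R} := (@lebesgue_measure R).
Let S : set (borelRd R d) := unit_sphere N.
Let I : set (measurableTypeR R) := `[0, +oo[%classic.

Lemma measurable_unit_sphere : measurable S.
Proof.
have mN := continuous_measurable_borelRd _ (is_norm_continuous N_norm).
have := mN measurableT [set 1] (measurable_set1 1).
by rewrite setTI.
Qed.

Let mS := measurable_unit_sphere.

Let mI : measurable I.
Proof. exact: measurable_itv. Qed.

(** Extension of [beta] by 0, measurable and nonnegative on the whole space. *)
Let b : borelRd R d -> R := beta \_ S.

Let mb : measurable_fun setT b.
Proof. by apply: (measurable_restrictT _ mS).1. Qed.

Let bE v : S v -> b v = beta v.
Proof. by move=> Sv; rewrite /b patchE mem_set. Qed.

Let b_ge0 v : 0 <= b v.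
Proof.
by rewrite /b patchE; case: ifPn => //; rewrite inE; exact: beta_ge0.
Qed.

(** The domain is encoded by indicator factors because [levy_khintchine] integrates over the whole
    space. *)
Definition polar_restrict (Q : borelRd R d -> R -> R)
    (p : (borelRd R d * measurableTypeR R)%type) : R :=
  \1_S p.1 * (\1_I p.2 * Q p.1 p.2).

Lemma measurable_polar_restrict Q : measurable_fun setT
  (fun p : (borelRd R d * measurableTypeR R)%type => Q p.1 p.2) ->
  measurable_fun setT (polar_restrict Q).
Proof.
move=> mQ; apply: measurable_funM.
  by apply: (measurable_fst_comp (f := \1_S)); exact: measurable_indic.
apply: measurable_funM => //.
by apply: (measurable_snd_comp (g := \1_I)); exact: measurable_indic.
Qed.

Let fubini_polar Q v : fubini_F leb (EFin \o polar_restrict Q) v =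
  ((fun v => \int[leb]_(r in I) (Q v r)%:E) \_ S)%E v.
Proof.
rewrite /fubini_F patchE /= /polar_restrict/=; have [vS|vS] := boolP (v \in S).
  rewrite [RHS]integral_mkcond; apply: eq_integral => r _.
  rewrite patchE indicE vS mul1r indicE.
  by case: (r \in I); rewrite ?mul1r ?mul0r.
rewrite (eq_integral (fun=> 0%E)) ?integral0// => r _.
by rewrite indicE (negbTE vS) mul0r.
Qed.

Lemma polar_restrict_ge0 (Q : borelRd R d -> R -> R) p :
  (forall v r, S v -> 0 <= r -> 0 <= Q v r) -> 0 <= polar_restrict Q p.
Proof.
case: p => v r Q0; rewrite /polar_restrict/= !indicE.
have [vS|vS] := boolP (v \in S); last by rewrite mul0r.
have [rI|rI] := boolP (r \in I); last by rewrite mul0r mulr0.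
rewrite !mul1r; apply: Q0; first exact: set_mem.
by move: rI; rewrite inE /I/= in_itv/= andbT.
Qed.

Lemma integral_polar (Q : borelRd R d -> R -> R) :
  measurable_fun setT (fun p : (borelRd R d * measurableTypeR R)%type => Q p.1 p.2) ->
  (forall v r, S v -> 0 <= r -> 0 <= Q v r) ->
  (\int[polar_measure alpha]_p (polar_restrict Q p)%:E =
   \int[alpha]_(v in S) \int[leb]_(r in I) (Q v r)%:E)%E.
Proof.
move=> mQ Q0; rewrite /polar_measure fubini_tonelli1.
- rewrite [RHS]integral_mkcond; apply: eq_integral => v _; exact: fubini_polar.
- by apply/measurable_EFinP; exact: measurable_polar_restrict.
- by move=> p; rewrite lee_fin polar_restrict_ge0.
Qed.

Lemma measurable_fun_integral_polar (Q : borelRd R d -> R -> R) :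
  measurable_fun setT (fun p : (borelRd R d * measurableTypeR R)%type => Q p.1 p.2) ->
  (forall v r, S v -> 0 <= r -> 0 <= Q v r) ->
  measurable_fun S (fun v => \int[leb]_(r in I) (Q v r)%:E)%E.
Proof.
move=> mQ Q0; apply: (measurable_restrictT _ mS).2.
rewrite (_ : _ \_ S = fubini_F leb (EFin \o polar_restrict Q)); last first.
  by apply/funext => v; rewrite fubini_polar.
apply: measurable_fun_fubini_tonelli_F.
- by apply/measurable_EFinP; exact: measurable_polar_restrict.
- by move=> p; rewrite lee_fin polar_restrict_ge0.
Qed.

(** The inner integral is known to be finite only almost everywhere; elsewhere [fine] returns a
    default value, so the two sides are compared up to a null set. *)
Lemma Rintegral_polar (Q : borelRd R d -> R -> R) :
  measurable_fun setT (fun p : (borelRd R d * measurableTypeR R)%type => Q p.1 p.2) ->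
  (polar_measure alpha).-integrable setT (EFin \o polar_restrict Q) ->
  \int[polar_measure alpha]_p (polar_restrict Q p) =
   \int[alpha]_(v in S) \int[leb]_(r in I) (Q v r).
Proof.
move=> mQ iQ; rewrite /Rintegral; congr fine.
rewrite -[LHS](integral12_prod_meas1 iQ) [RHS]integral_mkcond.
have iF := integrable_fubini_F iQ.
apply: ae_eq_integral => //.
- exact: measurable_fubini_F iQ.
- rewrite (_ : _ \_ S = EFin \o (fine \o fubini_F leb (EFin \o polar_restrict Q))).
    apply/measurable_EFinP; apply: measurableT_comp => //.
    exact: measurable_fubini_F iQ.
  apply/funext => v /=; rewrite fubini_polar !patchE /=.
  by case: ifP.
have := integrable_ae measurableT iF.
apply: filterS => v /(_ Logic.I) fv _.
rewrite -(fineK fv) fubini_polar !patchE/=.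
by case: ifP.
Qed.

Definition levy_weight : (borelRd R d * measurableTypeR R)%type -> R :=
  polar_restrict (fun v r => expR (- b v * r) / r).

Definition jump (z : 'cV[R]_d) (p : (borelRd R d * measurableTypeR R)%type) : R :=
  p.2 * dotv p.1 z.

Lemma Re_gamma_integrand (be : 'cV[R]_d -> R) z v r :
  complex.Re (gamma_integrand be z v r) =
  (cos (r * dotv v z) - 1) * (expR (- be v * r) / r).
Proof.
rewrite /gamma_integrand /cexp /= !(mul0r, mulr0, mul1r, subr0, sub0r, oppr0, add0r, addr0).
by rewrite expR0 mul1r.
Qed.

Lemma Im_gamma_integrand (be : 'cV[R]_d -> R) z v r :
  complex.Im (gamma_integrand be z v r) =
  sin (r * dotv v z) * (expR (- be v * r) / r).
Proof.
rewrite /gamma_integrand /cexp /= !(mul0r, mulr0, mul1r, subr0, sub0r, oppr0, add0r, addr0).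
by rewrite expR0 mul1r.
Qed.

Let mdot z : measurable_fun setT
  (fun p : (borelRd R d * measurableTypeR R)%type => dotv p.1 z).
Proof. by apply: (measurable_fst_comp (f := fun v : borelRd R d => dotv v z)); exact: measurable_dotv. Qed.

Let mrad : measurable_fun setT
  (fun p : (borelRd R d * measurableTypeR R)%type => (p.2 : R)).
Proof. exact: measurable_snd. Qed.

Let mb2 : measurable_fun setT
  (fun p : (borelRd R d * measurableTypeR R)%type => b p.1).
Proof. by apply: (measurable_fst_comp (f := b)). Qed.

Lemma measurable_jump z : measurable_fun setT (jump z).
Proof. by rewrite /jump; apply: measurable_funM. Qed.

Let mdens : measurable_fun setT
  (fun p : (borelRd R d * measurableTypeR R)%type => expR (- b p.1 * p.2) / p.2).
Proof.
apply: measurable_funM; last exact: measurable_fun_inv.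
by apply: measurable_fun_expR; apply: measurable_funM => //; exact: measurableT_comp.
Qed.

Lemma levy_weight_ge0 p : 0 <= levy_weight p.
Proof.
rewrite /levy_weight /polar_restrict mulr_ge0// indicE.
have [rI|rI] := boolP (p.2 \in I); last by rewrite mul0r.
rewrite mul1r divr_ge0 ?expR_ge0//.
by move: rI; rewrite inE /I/= in_itv/= andbT.
Qed.

Let weightE (Q : R -> R) z p :
  levy_weight p * Q (jump z p) =
  polar_restrict (fun v r => expR (- b v * r) / r * Q (r * dotv v z)) p.
Proof. by rewrite /levy_weight /polar_restrict /jump -!mulrA. Qed.

Let normc_ge_Re_Im (w : complex.complex R) :
  (`|complex.Re w| <= normc w) /\ (`|complex.Im w| <= normc w).
Proof.
case: w => x y /=; split.
  by rewrite -sqrtr_sqr ler_wsqrtr// lerDl sqr_ge0.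
by rewrite -sqrtr_sqr ler_wsqrtr// lerDr sqr_ge0.
Qed.

(** This is the absolute convergence clause of [is_gamma] after Tonelli. The modulus dominates real
    and imaginary parts, hence both the cosine and the sine integrands. *)
Let integrable_gamma_normc z : (polar_measure alpha).-integrable setT
  (EFin \o polar_restrict (fun v r => normc (gamma_integrand b z v r))).
Proof.
have mQ : measurable_fun setT (fun p : (borelRd R d * measurableTypeR R)%type =>
    normc (gamma_integrand b z p.1 p.2)).
  rewrite (_ : (fun p => _) = fun p : (borelRd R d * measurableTypeR R)%type =>
    Num.sqrt (((cos (p.2 * dotv p.1 z) - 1) * (expR (- b p.1 * p.2) / p.2)) ^+ 2 +
      (sin (p.2 * dotv p.1 z) * (expR (- b p.1 * p.2) / p.2)) ^+ 2)).
    apply: (measurableT_comp (continuous_measurable_fun (@sqrt_continuous R))).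
    apply: measurable_funD; apply: measurable_funX; apply: measurable_funM => //.
      by apply: measurable_funB => //; apply: measurable_fun_cos; exact: measurable_funM.
    by apply: measurable_fun_sin; exact: measurable_funM.
  apply/funext => p.
  by rewrite -Re_gamma_integrand -Im_gamma_integrand; case: (gamma_integrand b z p.1 p.2).
have Q0 v r : 0 <= normc (gamma_integrand b z v r).
  by rewrite (le_trans (normr_ge0 _) (normc_ge_Re_Im _).1).
apply: integrable_ge0P; first exact: measurable_polar_restrict.
  by move=> p; rewrite /polar_restrict !mulr_ge0.
rewrite integral_polar//.
rewrite (eq_integral (fun v : borelRd R d => \int[leb]_(r in I)
   (normc (gamma_integrand beta z v r))%:E)%E); first exact: (is_gamma_cvg mu_gamma z).
move=> v /set_mem vS; apply: eq_integral => r _.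
by rewrite /gamma_integrand bE.
Qed.

(** The frequency [t] is absorbed in the direction: the characteristic function of the marginal at
    [t] is that of [mu] at [t z]. *)
Lemma gamma_levy_khintchine (z : 'cV[R]_d) :
  levy_khintchine mu (polar_measure alpha)
    ((fun x => dotv x z) : borelRd R d -> R) levy_weight (jump z).
Proof.
have mQ (Q : R -> R) t : measurable_fun setT Q ->
    measurable_fun setT (fun p : (borelRd R d * measurableTypeR R)%type =>
      expR (- b p.1 * p.2) / p.2 * Q (t * (p.2 * dotv p.1 z))).
  move=> mQ; apply: measurable_funM => //; apply: (measurableT_comp mQ).
  by apply: measurable_funM => //; exact: measurable_jump.
have mcos1 : measurable_fun setT (fun u : R => 1 - cos u) by mfun.
have msin : measurable_fun setT (@sin R) by mfun.
have jumpE t p : t * jump z p = jump (t *: z) p.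
  by rewrite /jump dotvZr mulrCA.
have icos t : (polar_measure alpha).-integrable setT
    (fun p => (levy_weight p * (1 - cos (t * jump z p)))%:E).
  apply: (integrable_le_norm measurableT _ (integrable_gamma_normc (t *: z))).
    apply: measurable_funM; first exact: measurable_polar_restrict.
    by apply: (measurableT_comp mcos1); apply: measurable_funM => //; exact: measurable_jump.
  move=> p; rewrite jumpE (weightE (fun u => 1 - cos u)) /polar_restrict.
  rewrite !normrM ler_wpM2l// ler_wpM2l//.
  rewrite (le_trans _ (ler_norm _))// (le_trans _ (normc_ge_Re_Im _).1)//.
  by rewrite Re_gamma_integrand [X in _ <= X]normrM (distrC (cos _)) mulrC (normrM (expR _)).
have isin t : (polar_measure alpha).-integrable setT
    (fun p => (levy_weight p * sin (t * jump z p))%:E).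
  apply: (integrable_le_norm measurableT _ (integrable_gamma_normc (t *: z))).
    apply: measurable_funM; first exact: measurable_polar_restrict.
    by apply: (measurableT_comp msin); apply: measurable_funM => //; exact: measurable_jump.
  move=> p; rewrite jumpE (weightE sin) /polar_restrict.
  rewrite !normrM ler_wpM2l// ler_wpM2l//.
  rewrite (le_trans _ (ler_norm _))// (le_trans _ (normc_ge_Re_Im _).2)//.
  by rewrite Im_gamma_integrand [X in _ <= X]normrM mulrC (normrM (expR _)).
have ReE t : \int[alpha]_(v in S) \int[leb]_(r in I)
     complex.Re (gamma_integrand beta (t *: z) v r) =
   - \int[polar_measure alpha]_p (levy_weight p * (1 - cos (t * jump z p))).
  rewrite -mulN1r -RintegralZl//; last exact: icos.
  transitivity (\int[polar_measure alpha]_p polar_restrict (fun v r =>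
      -1 * (expR (- b v * r) / r * (1 - cos (t * (r * dotv v z))))) p); last first.
    apply: eq_Rintegral => p _; rewrite /levy_weight /polar_restrict /jump; ring.
  rewrite Rintegral_polar.
  - apply: eq_Rintegral => v /set_mem vS; apply: eq_Rintegral => r _.
    by rewrite Re_gamma_integrand bE// dotvZr (mulrCA r); ring.
  - by apply: measurable_funM => //; exact: (mQ (fun u => 1 - cos u)).
  - have := integrableZl measurableT (-1) (icos t); apply: eq_integrable => // p _.
    rewrite /= -EFinM; congr EFin.
    by rewrite /levy_weight /polar_restrict /jump; ring.
have ImE t : \int[alpha]_(v in S) \int[leb]_(r in I)
     complex.Im (gamma_integrand beta (t *: z) v r) =
   \int[polar_measure alpha]_p (levy_weight p * sin (t * jump z p)).
  transitivity (\int[polar_measure alpha]_p polar_restrict (fun v r =>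
      expR (- b v * r) / r * sin (t * (r * dotv v z))) p); last first.
    apply: eq_Rintegral => p _; rewrite /levy_weight /polar_restrict /jump; ring.
  rewrite Rintegral_polar.
  - apply: eq_Rintegral => v /set_mem vS; apply: eq_Rintegral => r _.
    by rewrite Im_gamma_integrand bE// dotvZr (mulrCA r); ring.
  - exact: (mQ sin).
  - apply: eq_integrable (isin t) => // p _.
    rewrite /=; congr EFin.
    by rewrite /levy_weight /polar_restrict /jump; ring.
have chf t := is_gamma_charfun mu_gamma (t *: z).
split => //.
- exact: measurable_dotv.
- exact: measurable_polar_restrict.
- exact: measurable_jump.
- exact: levy_weight_ge0.
- move=> t; transitivity (complex.Re (charfun mu (t *: z))).
    rewrite /charfun /cintegral/=; apply: eq_Rintegral => x _.
    rewrite !(mul0r, mul1r, subr0, sub0r, oppr0, add0r, addr0, mulr0) expR0 mul1r.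
    by rewrite (dotvC (t *: z)) dotvZr.
  by rewrite chf /cexp /= ReE ImE.
- move=> t; transitivity (complex.Im (charfun mu (t *: z))).
    rewrite /charfun /cintegral/=; apply: eq_Rintegral => x _.
    rewrite !(mul0r, mul1r, subr0, sub0r, oppr0, add0r, addr0, mulr0) expR0 mul1r.
    by rewrite (dotvC (t *: z)) dotvZr.
  by rewrite chf /cexp /= ReE ImE.
Qed.

End gamma_levy.

(** * Moments of the Gamma distribution *)

Section gamma_moments.
Context {R : realType} {d : nat} {N : 'cV[R]_d -> R}.
Context {alpha : {finite_measure set (borelRd R d) -> \bar R}}.
Context {beta : 'cV[R]_d -> R}.
Hypothesis N_norm : is_norm N.
Hypothesis beta_meas : measurable_fun (unit_sphere N) (beta : borelRd R d -> R).
Hypothesis beta_ge0 : forall v, unit_sphere N v -> 0 <= beta v.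

Let S : set (borelRd R d) := unit_sphere N.
Let mS : measurable S := measurable_unit_sphere N_norm.
Let b : borelRd R d -> R := beta \_ S.
Let h := @levy_weight R d N beta.

Let mb : measurable_fun setT b.
Proof. by apply: (measurable_restrictT _ mS).1. Qed.

Let bE v : S v -> b v = beta v.
Proof. by move=> Sv; rewrite /b patchE mem_set. Qed.

Let b_ge0 v : 0 <= b v.
Proof. by rewrite /b patchE; case: ifPn => //; rewrite inE; exact: beta_ge0. Qed.

Let mdot z : measurable_fun setT
  (fun p : (borelRd R d * measurableTypeR R)%type => dotv p.1 z).
Proof. by apply: (measurable_fst_comp (f := fun v : borelRd R d => dotv v z)); exact: measurable_dotv. Qed.

Let mb2 : measurable_fun setT
  (fun p : (borelRd R d * measurableTypeR R)%type => b p.1).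
Proof. by apply: (measurable_fst_comp (f := b)). Qed.

Let mdens : measurable_fun setT
  (fun p : (borelRd R d * measurableTypeR R)%type => expR (- b p.1 * p.2) / p.2).
Proof.
apply: measurable_funM; last exact: measurable_fun_inv.
by apply: measurable_fun_expR; apply: measurable_funM => //; exact: measurableT_comp.
Qed.

Let dens_ge0 v (r : R) : 0 <= r -> 0 <= expR (- b v * r) / r.
Proof. by move=> r0; rewrite divr_ge0 ?expR_ge0. Qed.

Lemma measurable_inv_powR_beta (k : R) :
  measurable_fun S (fun v : borelRd R d => ((beta v `^ k)%:E)^-1)%E.
Proof.
apply: (@eq_measurable_fun _ _ _ _ S
  (fun v => if b v `^ k == 0 then +oo%E else ((b v `^ k)^-1)%:E)).
  by move=> v /set_mem vS; rewrite inver bE.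
apply: measurable_funTS; apply: measurable_fun_ifT => //.
- by apply: measurable_fun_eqr => //; exact: measurable_fun_powR.
- by apply/measurable_EFinP; apply: measurable_fun_inv; exact: measurable_fun_powR.
Qed.

(** For [k > 0], a direction with [beta v = 0] counts as [+oo] unless [v.z = 0], where
    [0 (+oo) = 0]. This matches the radial integral, which diverges in the first case and vanishes
    in the second. *)
Definition directional_integral (z : 'cV[R]_d) (k : R) : \bar R :=
  (\int[alpha]_(v in S) ((`|dotv v z| `^ k)%:E * ((beta v `^ k)%:E)^-1))%E.

Let inv_powR_ge0 (x k : R) : (0%:E <= ((x `^ k)%:E)^-1)%E.
Proof. by rewrite inve_ge0 lee_fin powR_ge0. Qed.

Let mdir z k : measurable_fun S
  (fun v : borelRd R d => (`|dotv v z| `^ k)%:E * ((beta v `^ k)%:E)^-1)%E.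
Proof.
apply: emeasurable_funM; last exact: measurable_inv_powR_beta.
apply/measurable_EFinP; apply: measurable_funTS; apply: measurable_fun_powR.
by apply: measurable_fun_norm; exact: measurable_dotv.
Qed.

Let powR_jumpE (r c k : R) : 0 <= r -> `|r * c| `^ k = r `^ k * `|c| `^ k.
Proof. by move=> r0; rewrite normrM ger0_norm// powRM. Qed.

(** Tonelli, then [gamma_moment_le] along each ray after extracting [|v.z|^k]. *)
Lemma levy_moment_le z (k : R) : 0 < k -> (directional_integral z k < +oo ->
  \int[polar_measure alpha]_p (h p * `|jump z p| `^ k)%:E < +oo)%E.
Proof.
move=> k0 gfin.
(* A strictly positive constant keeps the right side equal to [+oo] on rays with [beta v = 0] and
   [v.z] nonzero. *)
have [C C0 HC] : exists2 C : R, 0 < C & forall b' : R, 0 < b' ->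
    (\int[lebesgue_measure]_(r in `[0%R, +oo[) (expR (- b' * r) / r * r `^ k)%:E
      <= (C / b' `^ k)%:E)%E.
  have [C C0 HC] := gamma_moment_le k k0; exists (C + 1); first by rewrite ltr_wpDl.
  move=> b' b'0; apply: (le_trans (HC _ b'0)).
  by rewrite lee_fin ler_pM2r ?invr_gt0 ?powR_gt0// lerDl.
pose Q (v : borelRd R d) r := expR (- b v * r) / r * `|r * dotv v z| `^ k.
have mQ : measurable_fun setT (fun p : (borelRd R d * measurableTypeR R)%type => Q p.1 p.2).
  apply: measurable_funM => //; apply: measurable_fun_powR; apply: measurable_fun_norm.
  exact: measurable_funM.
have Q0 v r : S v -> 0 <= r -> 0 <= Q v r.
  by move=> _ r0; rewrite mulr_ge0 ?powR_ge0 ?dens_ge0.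
rewrite (eq_integral (fun p => (polar_restrict (N := N) Q p)%:E)); last first.
  by move=> p _; congr EFin; rewrite /h /levy_weight /polar_restrict /Q /jump -!mulrA.
rewrite integral_polar//.
apply: (@le_lt_trans _ _ (C%:E * directional_integral z k)%E); last first.
  by rewrite lte_mul_pinfty// lee_fin ltW.
rewrite /directional_integral -ge0_integralZl_EFin ?(ltW C0)//; last first.
  by move=> v _; rewrite mule_ge0 ?lee_fin ?powR_ge0.
apply: ge0_le_integral => //.
- by move=> v vS; apply: integral_ge0 => r; rewrite /= in_itv/= andbT => r0; rewrite lee_fin Q0.
- exact: measurable_fun_integral_polar.
- by apply: measurable_funeM.
move=> v vS.
have [c0|c0] := eqVneq (dotv v z) 0.
  rewrite c0 normr0 powR0 ?gt_eqF// mul0e mule0.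
  rewrite (eq_integral (fun=> 0%E)) ?integral0// => r _.
  by rewrite /Q c0 mulr0 normr0 powR0 ?gt_eqF// mulr0.
have ck0 : 0 < `|dotv v z| `^ k by rewrite powR_gt0// normr_gt0.
rewrite -(bE _ vS) inver; case: ifPn => [_|bk0].
  by rewrite !gt0_muley ?lte_fin// leey.
have bv0 : 0 < b v.
  rewrite lt_neqAle b_ge0 andbT eq_sym; apply: contra bk0 => /eqP ->.
  by rewrite powR_eq0 eqxx gt_eqF.
rewrite (eq_integral (fun r : measurableTypeR R => (`|dotv v z| `^ k)%:E * (expR (- b v * r) / r * r `^ k)%:E)%E); last first.
  move=> r; rewrite inE/= in_itv/= andbT => r0.
  by rewrite -EFinM /Q powR_jumpE//; congr EFin; ring.
rewrite ge0_integralZl_EFin//; last first.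
- by apply/measurable_EFinP; exact: measurable_gamma_density.
- by move=> r; rewrite /= in_itv/= andbT => r0; rewrite lee_fin mulr_ge0 ?powR_ge0 ?dens_ge0.
apply: (le_trans (lee_wpmul2l _ (HC _ bv0))); first by rewrite lee_fin powR_ge0.
by rewrite -!EFinM lee_fin; rewrite le_eqVlt; apply/orP; left; apply/eqP; ring.
Qed.

(** On each ray [(|v.z| / beta)^k <= e F v + K^k], with [F] the truncated radial integral. If
    [|v.z| / beta >= K], [gamma_moment_ge] with [rho = 1 / beta] gives the first summand; otherwise
    the second is larger, and [alpha] is finite. *)
Lemma levy_moment_ge z (k K : R) : 0 < k -> 0 < K ->
  (\int[polar_measure alpha]_(p in norm_ge (jump z) K) (h p * `|jump z p| `^ k)%:E < +oo ->
   directional_integral z k < +oo)%E.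
Proof.
move=> k0 K0.
pose D : set (borelRd R d * measurableTypeR R)%type := norm_ge (jump z) K.
pose E : set R := norm_ge id K.
have mE : measurable E by apply: measurable_norm_ge.
have DE v r : ((v, r) \in D) = (r * dotv v z \in E) by [].
pose Q (v : borelRd R d) r := expR (- b v * r) / r * `|r * dotv v z| `^ k * \1_E (r * dotv v z).
have mQ : measurable_fun setT (fun p : (borelRd R d * measurableTypeR R)%type => Q p.1 p.2).
  apply: measurable_funM.
    apply: measurable_funM => //; apply: measurable_fun_powR; apply: measurable_fun_norm.
    exact: measurable_funM.
  apply: (measurableT_comp (measurable_indic mE)).
  exact: measurable_funM.
have Q0 v r : S v -> 0 <= r -> 0 <= Q v r.
  by move=> _ r0; rewrite mulr_ge0// mulr_ge0 ?powR_ge0 ?dens_ge0.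
rewrite integral_mkcond (eq_integral (fun p => (polar_restrict (N := N) Q p)%:E)); last first.
  move=> -[v r] _; rewrite patchE /polar_restrict /Q /= (indicE R E) -DE -/D.
  rewrite /h /levy_weight /polar_restrict /jump /=.
  by case: ifP => _; rewrite ?(mulr1, mulr0)//; congr EFin; ring.
rewrite integral_polar// => Qfin.
pose F v := (\int[lebesgue_measure]_(r in `[0%R, +oo[) (Q v r)%:E)%E.
have F0 v : S v -> (0 <= F v)%E.
  by move=> vS; apply: integral_ge0 => r; rewrite /= in_itv/= andbT => r0; rewrite lee_fin Q0.
(* The inverse of the constant [expR (-2) / 2] in [gamma_moment_ge]. *)
pose e := 2 * expR 2 : R.
have e0 : 0 < e by rewrite mulr_gt0 ?expR_gt0.
have mF : measurable_fun S F by exact: measurable_fun_integral_polar.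
apply: (@le_lt_trans _ _ (\int[alpha]_(v in S) (e%:E * F v + (K `^ k)%:E))%E); last first.
  rewrite ge0_integralD//; last first.
  - by move=> v _; rewrite lee_fin powR_ge0.
  - by apply: measurable_funeM.
  - by move=> v vS; rewrite mule_ge0 ?F0// lee_fin ltW.
  rewrite ge0_integralZl_EFin ?(ltW e0)//.
  rewrite lte_add_pinfty//; first by rewrite lte_mul_pinfty// lee_fin ltW.
  rewrite integral_cst// lte_mul_pinfty// ?lee_fin ?powR_ge0//.
  by rewrite ltey_eq fin_num_measure.
apply: ge0_le_integral => //.
- by move=> v vS; rewrite mule_ge0 ?lee_fin ?powR_ge0.
- by apply: emeasurable_funD => //; exact: measurable_funeM.
move=> v vS.
have eF0 : (0 <= e%:E * F v)%E by rewrite mule_ge0 ?F0// lee_fin ltW.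
have [c0|c0] := eqVneq (dotv v z) 0.
  by rewrite c0 normr0 powR0 ?gt_eqF// mul0e adde_ge0// lee_fin powR_ge0.
have cp : 0 < `|dotv v z| by rewrite normr_gt0.
have ck0 : 0 < `|dotv v z| `^ k by rewrite powR_gt0.
have Fge rho : 0 < rho -> b v * rho <= 1 -> K <= rho * `|dotv v z| ->
    (((rho * `|dotv v z|) `^ k)%:E <= e%:E * F v)%E.
  move=> rho0 brho Krho.
  pose I' : set (measurableTypeR R) := [set r : R | 0 <= r /\ K <= r * `|dotv v z|].
  have I'E : I' = `[K / `|dotv v z|, +oo[%classic.
    apply/seteqP; split => r; rewrite /I'/= in_itv/= andbT ler_pdivrMr//; first by case.
    move=> Kr; split => //; rewrite -(pmulr_lge0 _ cp).
    by rewrite (le_trans _ Kr)// ltW.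
  have mI' : measurable I' by rewrite I'E.
  have -> : F v = ((`|dotv v z| `^ k)%:E *
      \int[lebesgue_measure]_(r in I') (expR (- b v * r) / r * r `^ k)%:E)%E.
    rewrite -ge0_integralZl_EFin//; last first.
    - by apply/measurable_EFinP; exact: measurable_gamma_density.
    - by move=> r [r0 _]; rewrite lee_fin mulr_ge0 ?powR_ge0 ?dens_ge0.
    rewrite /F [LHS]integral_mkcond [RHS]integral_mkcond; apply: eq_integral => r _.
    rewrite !patchE; have [r0|r0] := leP 0 r; last first.
      rewrite !memNset//=; first by case; rewrite leNgt r0.
      by rewrite in_itv/= andbT leNgt r0.
    rewrite mem_set; last by rewrite /= in_itv/= andbT.
    rewrite /Q indicE powR_jumpE// (_ : (_ \in E) = (r \in I')).
      by case: ifP => _; rewrite ?(mulr1, mulr0)// -EFinM; congr EFin; ring.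
    have rE : `|r * dotv v z| = r * `|dotv v z| by rewrite normrM ger0_norm.
    apply/idP/idP; rewrite !in_setE /E /I' /norm_ge/= rE; first by [].
    by case.
  have := gamma_moment_ge k (b v) rho I' k0 (b_ge0 v) rho0 brho mI'.
  move=> /(_ _)/wrap[].
    move=> r; rewrite I'E/= !in_itv/= andbT => /andP[rr _].
    by rewrite (le_trans _ rr)// ler_pdivrMr.
  move=> /(_ _)/wrap[]; first by move=> r [].
  move=> H; rewrite muleA -EFinM.
  apply: le_trans (lee_wpmul2l _ H); last by rewrite lee_fin mulr_ge0 ?powR_ge0// ltW.
  rewrite -EFinM lee_fin powRM ?(ltW rho0)// le_eqVlt; apply/orP; left; apply/eqP.
  rewrite /e expRN; field; by rewrite gt_eqF ?expR_gt0.
rewrite -(bE _ vS) inver; case: ifPn => [bk0|bk0].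
  have bv0 : b v = 0.
    by apply/eqP; move: bk0; apply: contraTT => bv0; rewrite powR_eq0 negb_and bv0.
  suff -> : (e%:E * F v)%E = +oo%E by rewrite addye ?leey.
  apply/eqyP => A A0.
  (* For [b v = 0] any [rho] is admissible: with [rho = B / |v.z|] the truncation is respected and
     [(rho |v.z|)^k] exceeds the arbitrary [A]. *)
  pose B := K + A `^ k^-1.
  have B0 : 0 < B by rewrite ltr_wpDr ?powR_ge0.
  apply: le_trans (Fge (B / `|dotv v z|) _ _ _).
  - rewrite divfK ?gt_eqF// lee_fin.
    rewrite -[leLHS]powRr1 ?(ltW A0)// -(mulVf (lt0r_neq0 k0)) powRrM.
    by rewrite ge0_ler_powR ?nnegrE ?powR_ge0 ?(ltW k0) ?(ltW B0)// lerDr ltW.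
  - by rewrite divr_gt0.
  - by rewrite bv0 mul0r.
  - by rewrite divfK ?gt_eqF// lerDl powR_ge0.
have bv0 : 0 < b v.
  rewrite lt_neqAle b_ge0 andbT eq_sym; apply: contra bk0 => /eqP ->.
  by rewrite powR_eq0 eqxx gt_eqF.
rewrite -EFinM.
have ckE : `|dotv v z| `^ k * (b v `^ k)^-1 = ((b v)^-1 * `|dotv v z|) `^ k.
  rewrite mulrC powRM// ?invr_ge0// -(powR_inv1 (ltW bv0)) -powRrM.
  by rewrite mulN1r powRN.
have [Kc|Kc] := leP K ((b v)^-1 * `|dotv v z|).
  apply: (@le_trans _ _ (e%:E * F v)%E); last by rewrite leeDl// lee_fin powR_ge0.
  rewrite ckE; apply: Fge => //; first by rewrite invr_gt0.
  by rewrite mulfV ?gt_eqF.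
apply: (@le_trans _ _ (K `^ k)%:E); last by rewrite leeDr.
rewrite ckE lee_fin.
by rewrite ge0_ler_powR ?nnegrE ?(ltW k0) ?(ltW K0) ?(ltW Kc)// mulr_ge0// invr_ge0.
Qed.
End gamma_moments.

(** * Equivalence of the two finiteness conditions *)

Section moment_criterion.
Context {R : realType} {d : nat} {N : 'cV[R]_d -> R}.
Context {alpha : {finite_measure set (borelRd R d) -> \bar R}}.
Context {beta : 'cV[R]_d -> R} {mu : probability (borelRd R d) R}.
Hypothesis N_norm : is_norm N.
Hypothesis beta_meas : measurable_fun (unit_sphere N) (beta : borelRd R d -> R).
Hypothesis beta_ge0 : forall v, unit_sphere N v -> 0 <= beta v.
Hypothesis mu_gamma : is_gamma N alpha beta mu.

Let S : set (borelRd R d) := unit_sphere N.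
Let mS : measurable S := measurable_unit_sphere N_norm.
Let h := @levy_weight R d N beta.
Let gm := @directional_integral R d N alpha beta.
Let lk := gamma_levy_khintchine N_norm beta_meas mu_gamma.

Lemma integrable_levy_jump z : (gm z 1 < +oo)%E ->
  (polar_measure alpha).-integrable setT (fun p => (h p * `|jump z p|)%:E).
Proof.
move=> g1; apply: integrable_ge0P.
- apply: measurable_funM; first exact: (lk_measurable_h (lk z)).
  by apply: measurable_fun_norm; exact: measurable_jump.
- by move=> p; rewrite mulr_ge0// levy_weight_ge0.
rewrite (eq_integral (fun p => (h p * `|jump z p| `^ 1)%:E)); last first.
  by move=> p _; rewrite powRr1.
exact: levy_moment_le.
Qed.

(** Induction on an integer above [k], lowering the order by 1 until it is below 1. Finiteness is
    assumed at all orders up to [k] because the descent passes through [k - 1], [k - 2], ..., and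
    each step at or above 1 uses order 1. *)
Lemma marginal_moment_finite z (k : R) : 0 < k ->
  (forall k', 0 < k' <= k -> (gm z k' < +oo)%E) ->
  (\int[mu]_x (`|dotv x z| `^ k)%:E < +oo)%E.
Proof.
move=> k0; have [n kn] : exists n, k < n%:R.
  by exists (Num.bound k); apply: archi_boundP; exact: ltW.
elim: n k kn k0 => [|n IHn] k kn k0 gfin.
  by move: kn; rewrite ltNge (ltW k0).
have [k1|k1] := ltP k 1.
  apply: (moment_finite_lt1 (lk z)); rewrite ?k0//.
  by apply: levy_moment_le => //; apply: gfin; rewrite k0 lexx.
apply: (moment_finite_ge1 (lk z)) => //.
- by apply: integrable_levy_jump; apply: gfin; rewrite ltr01.
(* At [k = 1] the descent would reach order 0, outside the induction hypothesis; that moment is the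
   total mass. *)
- have [->|k1'] := eqVneq k 1.
    rewrite subrr (eq_integral (fun=> 1%E)); last by move=> x _; rewrite powRr0.
    by rewrite integral_cst// mul1e /= probability_setT ltry.
  apply: IHn; first by rewrite ltrBlDr natr1.
    by rewrite subr_gt0 lt_neqAle eq_sym k1'.
  move=> k' /andP[k'0 k'k]; apply: gfin; rewrite k'0 (le_trans k'k)//.
  by rewrite gerBl.
- by apply: levy_moment_le => //; apply: gfin; rewrite k0 lexx.
Qed.

(** For [k >= 1], order 1 is settled beforehand by the direct comparison, since the size-bias
    argument needs integrable jumps. *)
Lemma directional_integral_finite z (k : R) : 0 < k ->
  (\int[mu]_x (`|dotv x z| `^ k)%:E < +oo)%E -> (gm z k < +oo)%E.
Proof.
have lt2 k' : 0 < k' < 2 ->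
    (\int[mu]_x (`|dotv x z| `^ k')%:E < +oo)%E -> (gm z k' < +oo)%E.
  move=> k'02 mk'; have [K K0] := levy_moment_finite_lt2 (lk z) k' k'02 mk'.
  by apply: levy_moment_ge => //; case/andP: k'02.
move=> k0 mk; have [k1|k1] := ltP k 1.
  by apply: lt2 => //; rewrite k0 (lt_trans k1)// ltr1n.
have g1 : (gm z 1 < +oo)%E.
  apply: lt2; first by rewrite ltr01 ltr1n.
  by apply: (le_moment k) => //; [exact: measurable_dotv|rewrite ler01].
have [K K0] := levy_moment_finite_ge1 (lk z) (integrable_levy_jump z g1) k k1 mk.
exact: levy_moment_ge.
Qed.

(** [N x] is at most [A] times the largest coordinate in modulus, whose power is one term of the
    sum. *)
Lemma norm_powR_le (k : R) : (0 < d)%N -> 0 < k -> exists2 C, 0 < C &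
  forall x : 'cV[R]_d, N x `^ k <= C * \sum_i `|x i ord0| `^ k.
Proof.
move=> d0 k0; pose A := 1 + \sum_i N (delta_mx i ord0).
have A1 : 1 <= A by rewrite lerDl sumr_ge0// => i _; exact: is_norm_ge0.
have A0 : 0 < A by exact: lt_le_trans A1.
exists (A `^ k); first by rewrite powR_gt0.
move=> x; pose i0 : 'I_d := Ordinal d0.
have [j _ jmax] := arg_maxP (fun i => `|x i ord0|) (isT : xpredT i0).
apply: (@le_trans _ _ ((A * `|x j ord0|) `^ k)).
  rewrite ge0_ler_powR ?(ltW k0) ?nnegrE ?is_norm_ge0 ?mulr_ge0 ?(ltW A0)//.
  apply: (le_trans (is_norm_le_coord N_norm x)).
  rewrite /A mulrDl mul1r ler_wpDl// mulr_suml.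
  apply: ler_sum => i _; rewrite mulrC ler_wpM2l ?is_norm_ge0//; exact: jmax.
rewrite powRM ?(ltW A0)// ler_wpM2l ?powR_ge0//.
by rewrite (bigD1 j)//= lerDl sumr_ge0// => i _; exact: powR_ge0.
Qed.

Let mN : measurable_fun setT (N : borelRd R d -> R).
Proof. exact: continuous_measurable_borelRd (is_norm_continuous N_norm). Qed.

Lemma marginal_moment_le (k : R) i : (0 < d)%N -> 0 < k ->
  (moment N mu k < +oo)%E ->
  (\int[mu]_x (`|(x : 'cV[R]_d) i ord0| `^ k)%:E < +oo)%E.
Proof.
move=> d0 k0 Mk; have [C C0 HC] := coord_le_is_norm N_norm d0.
have mNk : measurable_fun setT (fun x : borelRd R d => N x `^ k).
  exact: measurable_fun_powR.
apply: (@le_lt_trans _ _ ((C `^ k)%:E * moment N mu k)%E); last first.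
  by rewrite lte_mul_pinfty// lee_fin powR_ge0.
rewrite -ge0_integralZl_EFin ?powR_ge0//; last first.
- exact/measurable_EFinP.
- by move=> x _; rewrite lee_fin powR_ge0.
apply: ge0_le_integral => //.
- apply/measurable_EFinP; apply: measurable_fun_powR; apply: measurable_fun_norm.
  exact: measurable_coord.
- by apply: measurable_funeM; exact/measurable_EFinP.
move=> x _; rewrite -EFinM lee_fin -powRM ?(ltW C0) ?is_norm_ge0//.
by rewrite ge0_ler_powR ?(ltW k0) ?nnegrE ?mulr_ge0 ?is_norm_ge0 ?(ltW C0).
Qed.

(** The 1 covers [x >= 1], the other term [x < 1], both being [+oo] at 0. Since [alpha] is finite,
    order [k] thus controls all lower positive orders. *)
Lemma inv_powR_le (x k k' : R) : 0 <= x -> 0 < k' <= k ->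
  (((x `^ k')%:E)^-1 <= 1 + ((x `^ k)%:E)^-1)%E.
Proof.
move=> x0 /andP[k'0 k'k]; have k0 : 0 < k by exact: lt_le_trans k'k.
have [->|xn0] := eqVneq x 0.
  by rewrite !powR0 ?gt_eqF// inver eqxx addey.
have xp : 0 < x by rewrite lt_neqAle eq_sym xn0.
rewrite !inver !gt_eqF ?powR_gt0//= -EFinD lee_fin.
have [x1|x1] := leP 1 x.
  rewrite (@le_trans _ _ 1)// ?lerDl ?invr_ge0 ?powR_ge0// invf_le1 ?powR_gt0//.
  by rewrite -[leLHS](powRr0 x) ler_powR// ltW.
rewrite (@le_trans _ _ (x `^ k)^-1) ?lerDr// lef_pV2 ?posrE ?powR_gt0//.
by rewrite ger_powR// xp ltW.
Qed.

Lemma directional_integral_le z (k k' : R) C : (forall v, S v -> `|dotv v z| <= C) ->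
  0 <= C -> 0 < k' <= k ->
  (\int[alpha]_(v in S) ((beta v `^ k)%:E)^-1 < +oo)%E -> (gm z k' < +oo)%E.
Proof.
move=> HC C0 kk' fin; have [k'0 k'k] := andP kk'.
have mi k1 : measurable_fun S (fun v : borelRd R d => ((beta v `^ k1)%:E)^-1)%E.
  exact: measurable_inv_powR_beta.
have i0 v k1 : (0 <= ((beta v `^ k1)%:E)^-1)%E by rewrite inve_ge0 lee_fin powR_ge0.
apply: (@le_lt_trans _ _
  (\int[alpha]_(v in S) ((C `^ k')%:E * (1 + ((beta v `^ k)%:E)^-1)))%E); last first.
  rewrite ge0_integralZl_EFin ?powR_ge0//; last first.
  - by apply: emeasurable_funD.
  - by move=> v _; rewrite adde_ge0.
  rewrite lte_mul_pinfty ?lee_fin ?powR_ge0// ge0_integralD// integral_cst// mul1e.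
  by rewrite lte_add_pinfty// ltey_eq fin_num_measure.
apply: ge0_le_integral => //.
- by move=> v _; rewrite mule_ge0// lee_fin powR_ge0.
- apply: emeasurable_funM => //; apply/measurable_EFinP; apply: measurable_funTS.
  by apply: measurable_fun_powR; apply: measurable_fun_norm; exact: measurable_dotv.
- by apply: measurable_funeM; apply: emeasurable_funD.
move=> v vS; apply: lee_pmul => //.
  by rewrite lee_fin ge0_ler_powR ?(ltW k'0) ?nnegrE ?HC.
by apply: inv_powR_le => //; exact: beta_ge0.
Qed.

(** The coordinate bound of [norm_powR_le] is used twice: at points of the space, to sum marginal
    moments, and on the unit sphere, to sum directional integrals. *)
Lemma gamma_moment_criterion (k : R) : (0 < d)%N -> 0 < k ->
  (moment N mu k < +oo)%E <-> (\int[alpha]_(v in S) ((beta v `^ k)%:E)^-1 < +oo)%E.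
Proof.
move=> d0 k0; have [C C0 HC] := norm_powR_le k d0 k0.
have mi : measurable_fun S (fun v : borelRd R d => ((beta v `^ k)%:E)^-1)%E.
  exact: measurable_inv_powR_beta.
have i0 v : (0 <= ((beta v `^ k)%:E)^-1)%E by rewrite inve_ge0 lee_fin powR_ge0.
have mxi i : measurable_fun setT (fun x : borelRd R d => (`|(x : 'cV[R]_d) i ord0| `^ k)%:E).
  apply/measurable_EFinP; apply: measurable_fun_powR; apply: measurable_fun_norm.
  exact: measurable_coord.
split=> fin.
- have gi i : (gm (delta_mx i ord0) k < +oo)%E.
    apply: (directional_integral_finite _ k k0).
    rewrite (eq_integral (fun x : borelRd R d => (`|(x : 'cV[R]_d) i ord0| `^ k)%:E)).
      exact: marginal_moment_le.
    by move=> x _; rewrite dotv_delta.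
  have m1 i : measurable_fun S (fun v : borelRd R d =>
      (`|dotv v (delta_mx i ord0)| `^ k)%:E * ((beta v `^ k)%:E)^-1)%E.
    apply: emeasurable_funM => //; apply/measurable_EFinP; apply: measurable_funTS.
    by apply: measurable_fun_powR; apply: measurable_fun_norm; exact: measurable_dotv.
  apply: (@le_lt_trans _ _ (\int[alpha]_(v in S) (C%:E * \sum_(i < d)
      ((`|dotv v (delta_mx i ord0)| `^ k)%:E * ((beta v `^ k)%:E)^-1)))%E); last first.
    rewrite ge0_integralZl_EFin ?(ltW C0)//; last first.
    - by apply: emeasurable_sum.
    - by move=> v _; apply: sume_ge0 => i _; rewrite mule_ge0// lee_fin powR_ge0.
    rewrite lte_mul_pinfty ?lee_fin ?(ltW C0)// ge0_integral_sum//; last first.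
      by move=> i v _; rewrite mule_ge0// lee_fin powR_ge0.
    by apply: lte_sum_pinfty => i _; exact: gi.
  apply: ge0_le_integral => //.
    by apply: measurable_funeM; exact: emeasurable_sum.
  move=> v vS; rewrite -ge0_sume_distrl; last by move=> i _; rewrite lee_fin powR_ge0.
  rewrite muleA sumEFin -EFinM -[leLHS]mul1e lee_wpmul2r// lee_fin.
  (* On the sphere [N v = 1], so the bound reads [1 <= C sum |v_i|^k]; multiplied by [beta^-k] it is
     the claim. *)
  have := HC v; rewrite vS powR1.
  by under eq_bigr do rewrite -dotv_delta.
- have [A A0 HA] := coord_le_is_norm N_norm d0.
  have ei i : (\int[mu]_x (`|(x : 'cV[R]_d) i ord0| `^ k)%:E < +oo)%E.
    rewrite (eq_integral (fun x : borelRd R d => (`|dotv x (delta_mx i ord0)| `^ k)%:E)); last first.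
      by move=> x _; rewrite dotv_delta.
    apply: marginal_moment_finite => // k' kk'.
    apply: (directional_integral_le _ k k' A) => //; last exact: ltW.
    by move=> v vS; have := HA v i; rewrite dotv_delta vS mulr1.
  apply: (@le_lt_trans _ _ (\int[mu]_x (C%:E * \sum_(i < d)
      (`|(x : 'cV[R]_d) i ord0| `^ k)%:E))%E); last first.
    rewrite ge0_integralZl_EFin ?(ltW C0)//; last first.
    - by apply: emeasurable_sum.
    - by move=> v _; apply: sume_ge0 => i _; rewrite lee_fin powR_ge0.
    rewrite lte_mul_pinfty ?lee_fin ?(ltW C0)// ge0_integral_sum//; last first.
    by apply: lte_sum_pinfty => i _; exact: ei.
  apply: ge0_le_integral => //.
  - by move=> x _; rewrite lee_fin powR_ge0.
  - by apply/measurable_EFinP; exact: measurable_fun_powR.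
  - by apply: measurable_funeM; exact: emeasurable_sum.
  by move=> x _; rewrite sumEFin -EFinM lee_fin.
Qed.

End moment_criterion.

(** * Levy integrals of the jump and of its square *)

Section first_two_moments_gamma.
Context {R : realType} {d : nat} {N : 'cV[R]_d -> R}.
Context {alpha : {finite_measure set (borelRd R d) -> \bar R}}.
Context {beta : 'cV[R]_d -> R} {mu : probability (borelRd R d) R}.
Hypothesis N_norm : is_norm N.
Hypothesis beta_meas : measurable_fun (unit_sphere N) (beta : borelRd R d -> R).
Hypothesis beta_ge0 : forall v, unit_sphere N v -> 0 <= beta v.
Hypothesis mu_gamma : is_gamma N alpha beta mu.

Let S : set (borelRd R d) := unit_sphere N.
Let mS : measurable S := measurable_unit_sphere N_norm.
Let h := @levy_weight R d N beta.
Let gm := @directional_integral R d N alpha beta.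
Let lk := gamma_levy_khintchine N_norm beta_meas mu_gamma.
Let leb : {sigma_finite_measure set (measurableTypeR R) -> \bar R} := (@lebesgue_measure R).

(* For [b = 0] both sides vanish: the integral of a nonzero constant over the
   half-line is infinite, and [fine] and division send infinities to [0]. *)
Lemma Rintegral_gamma_id (b c : R) : 0 <= b ->
  \int[leb]_(r in `[0, +oo[) (expR (- b * r) / r * (r * c)) = c / b.
Proof.
move=> b0; rewrite /Rintegral -integral_itv_obnd_cbnd; last first.
  apply/measurable_EFinP; apply: measurable_funTS.
  by apply: measurable_funM; mfun.
rewrite (eq_integral (fun r : measurableTypeR R => (c * expR (- b * r))%:E)); last first.
  move=> r; rewrite inE/= in_itv/= andbT => r0; congr EFin.
  by field; rewrite gt_eqF.
have me : measurable_fun setT (fun r : R => expR (- b * r)) by mfun.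
rewrite integral_itv_obnd_cbnd; last first.
  by apply/measurable_EFinP; apply: measurable_funTS; apply: measurable_funM.
move: b0; rewrite le_eqVlt => /predU1P[<-|b0].
  under eq_integral do rewrite oppr0 mul0r expR0 mulr1.
  rewrite integral_cst//= lebesgue_measure_itv/= ltry oppr0 addye// invr0 mulr0.
  have [c0|c0|->] := ltgtP c 0; last by rewrite mul0e.
  - by rewrite lt0_muley.
  - by rewrite gt0_muley.
under eq_integral do rewrite EFinM.
rewrite integralZl//; last first.
  apply: integrable_ge0P; [exact: measurable_funTS|by move=> r; exact: expR_ge0|].
  by rewrite integral_expRN// ltry.
by rewrite integral_expRN.
Qed.

(** For [b = 0] and [c] nonzero the integral is [+oo], which [fine] sends to 0, in agreement with
    [0^-1 = 0]. *)
Lemma Rintegral_gamma_sqr (b c : R) : 0 <= b ->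
  \int[leb]_(r in `[0, +oo[) (expR (- b * r) / r * (r * c) ^+ 2) = c ^+ 2 * b ^- 2.
Proof.
move=> b0; rewrite /Rintegral.
rewrite (eq_integral (fun r : measurableTypeR R => (c ^+ 2)%:E * (r * expR (- b * r))%:E)%E); last first.
  move=> r _; rewrite -EFinM; congr EFin.
  have [->|r0] := eqVneq r 0; first by rewrite !mul0r expr0n/= mulr0 mulr0.
  by field.
have me : measurable_fun setT (fun r : R => r * expR (- b * r)) by mfun.
rewrite ge0_integralZl_EFin ?sqr_ge0//; last first.
- by apply/measurable_EFinP; exact: measurable_funTS.
- by move=> r; rewrite /= in_itv/= andbT => r0; rewrite lee_fin mulr_ge0 ?expR_ge0.
move: (b0); rewrite le_eqVlt => /predU1P[<-|bp]; last by rewrite integral_id_expRN.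
have -> : (\int[leb]_(r in `[0%R, +oo[) (r * expR (- 0 * r))%:E = +oo)%E.
  apply/eqyP => A A0.
  have e0 : 0 < expR 2 :> R by exact: expR_gt0.
  (* Then [expR (-2) / 2] times [rho] exceeds [A], and [rho >= 1] gives [rho^2 >= rho]. *)
  pose rho := 2 * expR 2 * A + 1.
  have rho1 : 1 <= rho by rewrite lerDr !mulr_ge0// ltW.
  have rho0 : 0 < rho by exact: lt_le_trans rho1.
  have := gamma_moment_ge 2%:R 0 rho `[0, +oo[%classic (ltr0n _ 2) (lexx _) rho0.
  rewrite mul0r => /(_ ler01 (measurable_itv _))/(_ _)/wrap[].
    by move=> r /=; rewrite !in_itv/= andbT => /andP[/(le_trans (ltW rho0))].
  move=> /(_ _)/wrap[]; first by move=> r; rewrite /= in_itv/= andbT.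
  rewrite (eq_integral (fun r : measurableTypeR R => (r * expR (- 0 * r))%:E)); last first.
    move=> r; rewrite inE/= in_itv/= andbT => r0; congr EFin; rewrite powR_mulrn//.
    have [->|rn0] := eqVneq r 0; first by rewrite !mul0r expr0n mulr0.
    by field.
  apply: le_trans; rewrite lee_fin powR_mulrn ?(ltW rho0)//.
  apply: (@le_trans _ _ (expR (-2) / 2 * rho)).
    rewrite expRN /rho -(ler_pM2l e0) !mulrA mulfV ?gt_eqF// mul1r; lra.
  by rewrite ler_wpM2l ?divr_ge0 ?expR_ge0// expr2 ler_peMl// ltW.
rewrite expr0n /= invr0 mulr0.
have [->|c0] := eqVneq c 0; first by rewrite expr0n/= mul0e.
by rewrite gt0_muley// lte_fin exprn_even_gt0.
Qed.


Let b : borelRd R d -> R := beta \_ S.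

Let mb : measurable_fun setT b.
Proof. by apply: (measurable_restrictT _ mS).1. Qed.

Let bE v : S v -> b v = beta v.
Proof. by move=> Sv; rewrite /b patchE mem_set. Qed.

Let b_ge0 v : 0 <= b v.
Proof. by rewrite /b patchE; case: ifPn => //; rewrite inE; exact: beta_ge0. Qed.

Let mQ z n : measurable_fun setT (fun p : (borelRd R d * measurableTypeR R)%type =>
  expR (- b p.1 * p.2) / p.2 * (p.2 * dotv p.1 z) ^+ n).
Proof.
have mrad : measurable_fun setT
  (fun p : (borelRd R d * measurableTypeR R)%type => (p.2 : R)) by exact: measurable_snd.
apply: measurable_funM.
  apply: measurable_funM; last exact: measurable_fun_inv.
  apply: measurable_fun_expR; apply: measurable_funM => //.
  by apply: measurableT_comp => //; apply: (measurable_fst_comp (f := b)).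
apply: measurable_funX; apply: measurable_funM => //.
by apply: (measurable_fst_comp (f := fun v : borelRd R d => dotv v z)); exact: measurable_dotv.
Qed.

Let jump_polarE z n p : h p * jump z p ^+ n =
  polar_restrict (N := N) (fun v r => expR (- b v * r) / r * (r * dotv v z) ^+ n) p.
Proof. by rewrite /h /levy_weight /polar_restrict /jump -!mulrA. Qed.

Lemma integral_levy_jump z : (gm z 1 < +oo)%E ->
  \int[polar_measure alpha]_p (h p * jump z p) = \int[alpha]_(v in S) (dotv v z / beta v).
Proof.
move=> g1; pose Q (v : borelRd R d) (r : R) := expR (- b v * r) / r * (r * dotv v z) ^+ 1.
transitivity (\int[polar_measure alpha]_p polar_restrict (N := N) Q p).
  by apply: eq_Rintegral => p _; rewrite -jump_polarE.
rewrite (Rintegral_polar _ (mQ z 1)).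
  by apply: eq_Rintegral => v /set_mem vS; rewrite Rintegral_gamma_id// bE.
have iJ := integrable_levy_jump N_norm beta_meas beta_ge0 mu_gamma z g1.
apply: (integrable_le_norm measurableT _ iJ).
  exact: (measurable_polar_restrict N_norm _ (mQ z 1)).
by move=> p; rewrite -jump_polarE expr1 normrM [leRHS]normrM normr_id.
Qed.

Lemma integrable_levy_jump_sqr z : (gm z 2 < +oo)%E ->
  (polar_measure alpha).-integrable setT (EFin \o (fun p => h p * jump z p ^+ 2)).
Proof.
move=> g2; apply: integrable_ge0P.
- apply: measurable_funM; first exact: (lk_measurable_h (lk z)).
  by apply: measurable_funX; exact: measurable_jump.
- by move=> p; rewrite mulr_ge0 ?levy_weight_ge0 ?sqr_ge0.
rewrite (eq_integral (fun p => (h p * `|jump z p| `^ 2)%:E)); last first.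
  by move=> p _; rewrite powR_mulrn// real_normK ?num_real.
exact: levy_moment_le.
Qed.

Lemma integral_levy_jump_sqr z : (gm z 2 < +oo)%E ->
  \int[polar_measure alpha]_p (h p * jump z p ^+ 2) =
  \int[alpha]_(v in S) (dotv v z ^+ 2 * (beta v) ^- 2).
Proof.
move=> g2; pose Q (v : borelRd R d) (r : R) := expR (- b v * r) / r * (r * dotv v z) ^+ 2.
transitivity (\int[polar_measure alpha]_p polar_restrict (N := N) Q p).
  by apply: eq_Rintegral => p _; rewrite -jump_polarE.
rewrite (Rintegral_polar _ (mQ z 2)).
  by apply: eq_Rintegral => v /set_mem vS; rewrite Rintegral_gamma_sqr// bE.
rewrite (_ : polar_restrict Q = fun p => h p * jump z p ^+ 2).
  exact: integrable_levy_jump_sqr.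
by apply/funext => p; rewrite -jump_polarE.
Qed.

(** The real inverse is at most the extended one, with 0 against [+oo] where [beta] vanishes. *)
Lemma integrable_directional_sqr z : (gm z 2 < +oo)%E ->
  alpha.-integrable S (EFin \o (fun v => dotv v z ^+ 2 * (beta v) ^- 2)).
Proof.
move=> g2.
have mf : measurable_fun S (fun v : borelRd R d => dotv v z ^+ 2 * (beta v) ^- 2).
  apply: measurable_funM.
    by apply: measurable_funTS; apply: measurable_funX; exact: measurable_dotv.
  apply: (@eq_measurable_fun _ _ _ _ S (fun v => (b v) ^- 2)) => [v /set_mem vS|].
    by rewrite bE.
  by apply: measurable_funTS; apply: measurable_fun_inv; exact: measurable_funX.
apply: integrable_ge0P => //.
  by move=> v; rewrite mulr_ge0 ?invr_ge0 ?sqr_ge0.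
apply: le_lt_trans g2; apply: ge0_le_integral => //.
- by move=> v _; rewrite lee_fin mulr_ge0 ?invr_ge0 ?sqr_ge0.
- exact/measurable_EFinP.
- apply: emeasurable_funM; last exact: measurable_inv_powR_beta.
  apply/measurable_EFinP; apply: measurable_funTS; apply: measurable_fun_powR.
  by apply: measurable_fun_norm; exact: measurable_dotv.
move=> v vS; rewrite !powR_mulrn ?beta_ge0// real_normK ?num_real// EFinM.
apply: lee_wpmul2l; first by rewrite lee_fin sqr_ge0.
by rewrite inver; case: ifPn => // _; rewrite leey.
Qed.

End first_two_moments_gamma.

(** * Mean and covariance *)

Section mean_covariance.
Context {R : realType} {d : nat} {N : 'cV[R]_d -> R}.
Context {alpha : {finite_measure set (borelRd R d) -> \bar R}}.
Context {beta : 'cV[R]_d -> R} {mu : probability (borelRd R d) R}.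
Hypothesis d_gt0 : (0 < d)%N.
Hypothesis N_norm : is_norm N.
Hypothesis beta_meas : measurable_fun (unit_sphere N) (beta : borelRd R d -> R).
Hypothesis beta_ge0 : forall v, unit_sphere N v -> 0 <= beta v.
Hypothesis mu_gamma : is_gamma N alpha beta mu.

Let S : set (borelRd R d) := unit_sphere N.
Let mS : measurable S := measurable_unit_sphere N_norm.
Let gm := @directional_integral R d N alpha beta.
Let lk := gamma_levy_khintchine N_norm beta_meas mu_gamma.
Let ilj := integrable_levy_jump N_norm beta_meas beta_ge0 mu_gamma.

Let gm_finite (k k' : R) z : 0 < k' <= k -> (moment N mu k < +oo)%E ->
  (gm z k' < +oo)%E.
Proof.
move=> kk' Mk; have k0 : 0 < k by case/andP: kk' => /lt_le_trans; exact.
have [A A0 HA] := coord_le_is_norm N_norm d_gt0.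
apply: (directional_integral_le N_norm beta_meas beta_ge0 z k k'
  (A * \sum_i `|z i ord0|)) => //.
- move=> v vS; rewrite dotvE mulr_sumr (le_trans (ler_norm_sum _ _ _))//.
  by apply: ler_sum => i _; rewrite normrM ler_wpM2r// -[leRHS]mulr1 -vS HA.
- by rewrite mulr_ge0 ?(ltW A0)// sumr_ge0.
by apply/(gamma_moment_criterion N_norm beta_meas beta_ge0 mu_gamma k d_gt0 k0).
Qed.

Let marginal_finite (k k' : R) z : 0 < k' <= k -> (moment N mu k < +oo)%E ->
  (\int[mu]_x (`|dotv x z| `^ k')%:E < +oo)%E.
Proof.
move=> /andP[k'0 k'k] Mk.
apply: (marginal_moment_finite N_norm beta_meas beta_ge0 mu_gamma z k' k'0).
move=> k2 /andP[k20 k2k]; apply: (gm_finite k) => //.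
by rewrite k20 (le_trans k2k).
Qed.

Let integrable_marginal (k : R) z : 1 <= k -> (moment N mu k < +oo)%E ->
  mu.-integrable setT (EFin \o (fun x : borelRd R d => dotv x z)).
Proof.
move=> k1 Mk; have mX : measurable_fun setT (fun x : borelRd R d => dotv x z).
  exact: measurable_dotv.
have iX : mu.-integrable setT (EFin \o (fun x : borelRd R d => `|dotv x z|)).
  apply: integrable_ge0P => //; first exact: measurable_fun_norm.
  rewrite (eq_integral (fun x : borelRd R d => (`|dotv x z| `^ 1)%:E)).
    by apply: (marginal_finite k 1 z) => //; rewrite ltr01.
  by move=> x _; rewrite powRr1.
by apply: (integrable_le_norm measurableT mX iX) => x; rewrite normr_id.
Qed.

Let mean_marginal z : (moment N mu 1 < +oo)%E ->
  \int[mu]_x dotv x z = \int[alpha]_(v in S) (dotv v z / beta v).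
Proof.
move=> M1; have g1 : (gm z 1 < +oo)%E by apply: (gm_finite 1); rewrite ?ltr01 ?lexx.
rewrite (mean_levy (lk z) (ilj z g1) (integrable_marginal 1 z (lexx _) M1)).
exact: (integral_levy_jump N_norm beta_meas beta_ge0 mu_gamma).
Qed.

Lemma gamma_mean : (moment N mu 1 < +oo)%E ->
  mean_vector mu = mxintegral alpha S (fun v : 'cV[R]_d => (beta v)^-1 *: v).
Proof.
move=> M1; apply/matrixP => i j; rewrite !mxE unlock (ord1 j).
transitivity (\int[mu]_x dotv x (delta_mx i ord0)).
  by apply: eq_Rintegral => x _; rewrite dotv_delta.
rewrite mean_marginal//; apply: eq_Rintegral => v _.
by rewrite mxE dotv_delta mulrC.
Qed.

Section second_moment.
Hypothesis M2 : (moment N mu 2 < +oo)%E.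

Let gm2 z : (gm z 2 < +oo)%E.
Proof. by apply: (gm_finite 2); rewrite ?lexx ?ltr0n. Qed.

Let iX z : mu.-integrable setT (EFin \o (fun x : borelRd R d => dotv x z)).
Proof. by apply: (integrable_marginal 2) => //; rewrite ler1n. Qed.

Let iX2 z : mu.-integrable setT (EFin \o (fun x : borelRd R d => dotv x z ^+ 2)).
Proof.
apply: integrable_ge0P.
- by apply: measurable_funX; exact: measurable_dotv.
- by move=> x; exact: sqr_ge0.
rewrite (eq_integral (fun x : borelRd R d => (`|dotv x z| `^ 2)%:E)).
  by apply: (marginal_finite 2 2 z); rewrite ?ltr0n ?lexx.
by move=> x _; rewrite powR_mulrn// real_normK ?num_real.
Qed.

Let second_moment_marginal z : \int[mu]_x (dotv x z ^+ 2) =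
  (\int[mu]_x dotv x z) ^+ 2 + \int[alpha]_(v in S) (dotv v z ^+ 2 * beta v ^- 2).
Proof.
have g1 : (gm z 1 < +oo)%E by apply: (gm_finite 2); rewrite ?ltr01 ?ler1n.
have iJ2 := integrable_levy_jump_sqr N_norm beta_meas beta_ge0 mu_gamma z (gm2 z).
rewrite (second_moment_levy (lk z) (ilj z g1) (iX z) (iX2 z) iJ2).
rewrite -(mean_levy (lk z) (ilj z g1) (iX z)); congr (_ + _).
exact: (integral_levy_jump_sqr N_norm beta_meas beta_ge0 mu_gamma z (gm2 z)).
Qed.

Let polarization (a b : R) : a * b = 2^-1 * ((a + b) ^+ 2 - a ^+ 2 - b ^+ 2).
Proof. by field. Qed.

(** The weight allows the same formula for [mu] (weight 1) and for [alpha] (weight [beta^-2]). *)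
Let integral_polarization {disp} {T : measurableType disp}
  (m : {measure set T -> \bar R}) (D : set T) (f g w : T -> R) : measurable D ->
  m.-integrable D (EFin \o (fun x => f x ^+ 2 * w x)) ->
  m.-integrable D (EFin \o (fun x => g x ^+ 2 * w x)) ->
  m.-integrable D (EFin \o (fun x => (f x + g x) ^+ 2 * w x)) ->
  m.-integrable D (EFin \o (fun x => f x * g x * w x)) /\
  \int[m]_(x in D) (f x * g x * w x) = 2^-1 *
    (\int[m]_(x in D) ((f x + g x) ^+ 2 * w x) -
     \int[m]_(x in D) (f x ^+ 2 * w x) - \int[m]_(x in D) (g x ^+ 2 * w x)).
Proof.
move=> mD fi gi fgi.
have E : (fun x => f x * g x * w x) = (fun x => 2^-1 *
    ((f x + g x) ^+ 2 * w x - f x ^+ 2 * w x - g x ^+ 2 * w x)).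
  by apply/funext => x; rewrite polarization; ring.
have i1 : m.-integrable D (EFin \o (fun x => (f x + g x) ^+ 2 * w x - f x ^+ 2 * w x)).
  have := integrableB mD fgi fi; apply: eq_integrable => // x _.
have i2 : m.-integrable D (EFin \o (fun x =>
    (f x + g x) ^+ 2 * w x - f x ^+ 2 * w x - g x ^+ 2 * w x)).
  have := integrableB mD i1 gi; apply: eq_integrable => // x _.
rewrite E; split; last by rewrite RintegralZl// RintegralB// RintegralB.
by have := integrableZl mD 2^-1 i2; apply: eq_integrable.
Qed.

(** The variance in each direction is known; the directions [e_i], [e_j] and [e_i + e_j] determine
    the entry [(i, j)]. *)
Lemma gamma_covariance : covariance_matrix mu =
  mxintegral alpha S (fun v : 'cV[R]_d => (beta v) ^- 2 *: (v *m v^T)).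
Proof.
apply/matrixP => i j; rewrite !mxE.
pose ei : 'cV[R]_d := delta_mx i ord0; pose ej : 'cV[R]_d := delta_mx j ord0.
pose X (x : borelRd R d) := dotv x ei; pose Y (x : borelRd R d) := dotv x ej.
have XYE x : X x + Y x = dotv x (ei + ej) by rewrite dotvDr.
have [iXY EXY] := integral_polarization mu setT X Y (cst 1) measurableT
  ltac:(by under eq_fun do rewrite mulr1; exact: iX2)
  ltac:(by under eq_fun do rewrite mulr1; exact: iX2)
  ltac:(by under eq_fun do rewrite mulr1 XYE; exact: iX2).
have [_ EVW] := integral_polarization alpha S X Y (fun v => beta v ^- 2) mS
  (integrable_directional_sqr N_norm beta_meas beta_ge0 ei (gm2 ei))
  (integrable_directional_sqr N_norm beta_meas beta_ge0 ej (gm2 ej))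
  ltac:(by under eq_fun do rewrite XYE;
    exact: (integrable_directional_sqr N_norm beta_meas beta_ge0 _ (gm2 (ei + ej)))).
have -> : (fun x : 'cV[R]_d => x i ord0) = X.
  by apply/funext => x; rewrite /X dotv_delta.
have -> : (fun x : 'cV[R]_d => x j ord0) = Y.
  by apply/funext => x; rewrite /Y dotv_delta.
have iXY' : mu.-integrable setT (EFin \o (X * Y)).
  by apply: eq_integrable iXY => // x _ /=; rewrite mulr1.
rewrite covarianceE; last first.
- exact/Lfun1_integrable.
- by apply/Lfun1_integrable; exact: iX.
- by apply/Lfun1_integrable; exact: iX.
rewrite unlock -(EFin_Rintegral measurableT iXY').
rewrite -(EFin_Rintegral measurableT (iX ei)) -(EFin_Rintegral measurableT (iX ej)).
rewrite -EFinM -EFinB /=.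
have -> : \int[mu]_x (X * Y) x = \int[mu]_x (X x * Y x * cst 1 x).
  by apply: eq_Rintegral => x _; rewrite mulr1.
transitivity (\int[alpha]_(v in S) (X v * Y v * beta v ^- 2)); last first.
  apply: eq_Rintegral => v _.
  by rewrite mxE [in RHS]mxE big_ord1 mxE mulrC /X /Y !dotv_delta.
rewrite EXY EVW.
have second z : \int[mu]_x (dotv x z ^+ 2 * cst 1 x) =
    (\int[mu]_x dotv x z) ^+ 2 + \int[alpha]_(v in S) (dotv v z ^+ 2 * beta v ^- 2).
  by rewrite -second_moment_marginal; apply: eq_Rintegral => x _; rewrite mulr1.
have -> : \int[mu]_x ((X x + Y x) ^+ 2 * cst 1 x) = (\int[mu]_x X x + \int[mu]_x Y x) ^+ 2
    + \int[alpha]_(v in S) ((X v + Y v) ^+ 2 * beta v ^- 2).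
  have -> : \int[mu]_x X x + \int[mu]_x Y x = \int[mu]_x dotv x (ei + ej).
    by rewrite -RintegralD ?iX//; apply: eq_Rintegral => x _; rewrite XYE.
  transitivity (\int[mu]_x (dotv x (ei + ej) ^+ 2 * cst 1 x)).
    by apply: eq_Rintegral => x _; rewrite XYE.
  by rewrite second; congr (_ + _); apply: eq_Rintegral => x _; rewrite XYE.
(* The squared means combine to [(s + t)^2 - s^2 - t^2 = 2 s t], half of which cancels the product
   of means in the covariance. *)
rewrite (second ei) (second ej) -/X -/Y.
set p := \int[alpha]_(v in S) _; set q := \int[alpha]_(v in S) (dotv v ei ^+ 2 * _).
set r := \int[alpha]_(v in S) (dotv v ej ^+ 2 * _).
set s := \int[mu]_x X x; set t := \int[mu]_x Y x.
by field.
Qed.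

End second_moment.
End mean_covariance.

(* alpha is a finite Borel measure on the unit sphere of N, seen as a measure
   on the whole space that does not charge the complement of the sphere. *)
Theorem proposition3p13 (R : realType) (d : nat) (d_gt0 : (0 < d)%N)
    (N : 'cV[R]_d -> R) (N_norm : is_norm N)
    (alpha : {finite_measure set (borelRd R d) -> \bar R})
    (alpha_sphere : alpha (~` unit_sphere N) = 0%E)
    (beta : 'cV[R]_d -> R)
    (beta_meas : measurable_fun (unit_sphere N) (beta : borelRd R d -> R))
    (beta_ge0 : forall v, unit_sphere N v -> 0 <= beta v)
    (mu : probability (borelRd R d) R)
    (mu_gamma : is_gamma N alpha beta mu) :
  (* inversion in \bar R, so that beta(v)^-k = +oo when beta(v) = 0 *)
  (forall k : R, 0 < k ->
     (moment N mu k < +oo)%E <->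
     (\int[alpha]_(v in unit_sphere N) ((beta v `^ k)%:E)^-1 < +oo)%E) /\
  ((moment N mu 1 < +oo)%E ->
     mean_vector mu =
     mxintegral alpha (unit_sphere N)
       (fun v : 'cV[R]_d => (beta v)^-1 *: v)) /\
  ((moment N mu 2 < +oo)%E ->
     covariance_matrix mu =
     mxintegral alpha (unit_sphere N)
       (fun v : 'cV[R]_d => (beta v) ^- 2 *: (v *m v^T))).
Proof.
split; first by move=> k k0; exact: gamma_moment_criterion.
by split; [exact: gamma_mean | exact: gamma_covariance].
Qed.
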